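(* Let $X\subset\mathbb{R}^2$ be a non-linear carpet which satisfies the coordinate open set condition. Then for every $\varepsilon>0$ there exists an ergodic measure $\mu$ on $X$ such that $\dim_H\mu\ge\dim_H X-\varepsilon$. Moreover, \[ \dim_H X=\lim_{n\to\infty}\max_{\mathbf{p}\in\mathcal{P}(\Lambda^n)}g(\mathbf{p},\mathbf{a}_n,\mathbf{b}_n). \]
   Context: An IFS on a compact $A\subset\mathbb{R}^d$ is a finite family of contractions of $A$; its attractor is the unique non-empty compact $X$ with $X=\bigcup_i f_i(X)$; OSC means there is open $U$ with $f_i(U)\subset U$ and $f_i(U)\cap f_j(U)=\emptyset$ for $i\ne j$. A self-conformal IFS on $[0,1]$ consists of $C^{1+\alpha}$ uniform contractions of $[0,1]$. Given self-conformal coordinate IFSs $(f_i)_{i\in\Lambda_1}$, $(g_j)_{j\in\Lambda_2}$ and $\Lambda\subset\Lambda_1\times\Lambda_2$, the attractor $X$ of $(S_{i,j}=(f_i,g_j))_{(i,j)\in\Lambda}$ is a non-linear carpet (normalized so $\operatorname{diam}X=1$); coordinate OSC means both coordinate IFSs satisfy the OSC. With $\Sigma=\Lambda^{\mathbb{N}}$, shift $\sigma$ and natural projection $\pi(\,(i_1,j_1)(i_2,j_2)\cdots)=\lim_n S_{i_1,j_1}\circ\cdots\circ S_{i_n,j_n}(0)$, a measure $\mu$ on $X$ is ergodic if $\mu=\pi_*\nu$ for a $\sigma$-ergodic Borel probability $\nu$ on $\Sigma$. Notation: $\|f\|=\sup_{[0,1]}|f|$, $f_{\mathtt{i}}=f_{i_1}\circ\cdots\circ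 f_{i_k}$; $\mathbf{a}_n=(\|f'_{\mathtt{i}}\|)_{\mathtt{i}\in\Lambda_1^n}$, $\mathbf{b}_n=(\|g'_{\mathtt{j}}\|)_{\mathtt{j}\in\Lambda_2^n}$, and $\Lambda^n$ is viewed as a subset of $\Lambda_1^n\times\Lambda_2^n$. For finite alphabets $A\subset A_1\times A_2$, $\mathbf{a}\in(0,1)^{A_1}$, $\mathbf{b}\in(0,1)^{A_2}$ and a probability vector $\mathbf{p}=(p_{i,j})_{(i,j)\in A}$ (the set of these is $\mathcal{P}(A)$): $q_i(\mathbf{p})=\sum_{j:(i,j)\in A}p_{i,j}$, $r_j(\mathbf{p})=\sum_{i:(i,j)\in A}p_{i,j}$, $\lambda_1=\sum p_{i,j}\log a_i$, $\lambda_2=\sum p_{i,j}\log b_j$, $H=\sum p_{i,j}\log p_{i,j}$, $H_1=\sum p_{i,j}\log q_i(\mathbf{p})$, $H_2=\sum p_{i,j}\log r_j(\mathbf{p})$; $g_1=\frac{H_1}{\lambda_1}+\frac{H-H_1}{\lambda_2}$, $g_2=\frac{H_2}{\lambda_2}+\frac{H-H_2}{\lambda_1}$; $g(\mathbf{p},\mathbf{a},\mathbf{b})=g_1$ if $\lambda_1\ge\lambda_2$ and $g_2$ if $\lambda_1<\lambda_2$.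
   Formalization: Self-conformal is taken to include that the derivatives of the maps vanish nowhere on [0,1]; for arbitrary C^{1+α} contractions the dimension formula fails, e.g. for f_1(x)=c+0.7(x-1/2)^2, f_2=1-f_1, whose attractor is two points. *)

(* Defs.v *)
From HB Require Import structures.
From mathcomp Require Import all_boot all_order all_algebra.
From mathcomp Require Import all_classical all_reals all_analysis.
Set Implicit Arguments.
Unset Strict Implicit.
Unset Printing Implicit Defensive.
Import Order.TTheory GRing.Theory Num.Theory.
Import numFieldNormedType.Exports.
Local Open Scope classical_set_scope.
Local Open Scope ring_scope.

(* The product topology of [R * R] comes with the max norm; diameters in the
   plane are Euclidean, so the Euclidean distance is introduced by hand. *)
Definition edist {R : realType} (z w : R * R) : R :=
  Num.sqrt ((z.1 - w.1) ^+ 2 + (z.2 - w.2) ^+ 2).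

(* [ediam set0 = -oo]; hence the special case in [diam_pow]. *)
Definition ediam {R : realType} (E : set (R * R)) : \bar R :=
  ereal_sup [set (edist z w)%:E | z in E & w in E].

(* |E|^s, with the conventions |set0|^s = 0 for every s >= 0 and |{z}|^0 = 1. *)
Definition diam_pow {R : realType} (s : R) (E : set (R * R)) : \bar R :=
  if `[< E = set0 >] then 0%E else (ediam E `^ s)%E.

Definition delta_covers {R : realType} (delta : R) (E : set (R * R)) :
    set (set (R * R))^nat :=
  [set U | E `<=` \bigcup_k U k /\ forall k, (ediam (U k) <= delta%:E)%E].

Definition hausdorff_premeasure {R : realType} (delta s : R)
    (E : set (R * R)) : \bar R :=
  ereal_inf [set (\sum_(0 <= k <oo) diam_pow s (U k))%E
            | U in delta_covers delta E].

(* The supremum over delta > 0 is the limit as delta tends to 0. *)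
Definition hausdorff_measure {R : realType} (s : R) (E : set (R * R)) :
    \bar R :=
  ereal_sup [set hausdorff_premeasure delta s E
            | delta in [set delta | 0 < delta]].

Definition dimH {R : realType} (E : set (R * R)) : \bar R :=
  ereal_inf [set s%:E | s in [set s | 0 <= s /\ hausdorff_measure s E = 0%E]].

(* The (lower) Hausdorff dimension of a measure: the infimum is over all Borel
   sets of positive measure, not only those of full measure. *)
Definition dimH_measure {R : realType}
    (mu : set (measurableTypeR R * measurableTypeR R) -> \bar R) : \bar R :=
  ereal_inf [set dimH A
            | A in [set A : set (measurableTypeR R * measurableTypeR R)
                   | measurable A /\ (0 < mu A)%E]].

Definition is_maximum {R : realType} (E : set R) (m : R) : Prop :=
  E m /\ ubound E m.

(* A map of [0,1] is represented by a map of the real line of which only the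
   restriction to [0,1] matters.  Requiring two-sided derivability at every
   point of [0,1] is no loss of generality: a C^{1+alpha} map of [0,1] extends
   affinely on both sides of [0,1], with the same (one-sided) derivatives at
   the endpoints.  The last clause is the conformality of the maps: in
   dimension one, the derivative is an invertible similarity. *)
Definition self_conformal {R : realType} (I : finType) (f : I -> R -> R) :
    Prop :=
  [/\ forall i (x : R), x \in `[0, 1] -> f i x \in `[0, 1],
      exists2 k : R, k < 1 &
        forall i (x y : R), x \in `[0, 1] -> y \in `[0, 1] ->
          `|f i x - f i y| <= k * `|x - y|,
      forall i (x : R), x \in `[0, 1] -> derivable (f i) x 1,
      exists2 alpha : R, 0 < alpha <= 1 &
        exists C : R, forall i (x y : R), x \in `[0, 1] -> y \in `[0, 1] ->
          `|derive1 (f i) x - derive1 (f i) y| <= C * `|x - y| `^ alpha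
    & forall i (x : R), x \in `[0, 1] -> derive1 (f i) x != 0].

(* U is nonempty, otherwise the condition would be void.
   For U `<=` [0,1] it makes no difference whether U is open in the line or
   relatively open in [0,1]: the maps are injective and continuous, so in the
   latter case one may replace U by its intersection with ]0,1[. *)
Definition open_set_condition {R : realType} (I : finType) (f : I -> R -> R) :
    Prop :=
  exists U : set R,
    [/\ U !=set0, open U, U `<=` `[0, 1]%classic,
        forall i, f i @` U `<=` U
      & forall i j, i != j -> f i @` U `&` f j @` U = set0].

Definition word_map (I : Type) (T : Type) (f : I -> T -> T) (w : seq I) :
    T -> T :=
  foldr (fun i h => f i \o h) id w.

Definition carpet_map {R : realType} (I J : finType) (f : I -> R -> R)
    (g : J -> R -> R) (l : I * J) (z : R * R) : R * R :=
  (f l.1 z.1, g l.2 z.2).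

Definition is_attractor (K : finType) (T : topologicalType) (L : {set K})
    (S : K -> T -> T) (X : set T) : Prop :=
  [/\ X !=set0, compact X & X = \bigcup_(l in [set` L]) (S l @` X)].

Definition nonlinear_carpet {R : realType} (I J : finType) (f : I -> R -> R)
    (g : J -> R -> R) (L : {set I * J}) (X : set (R * R)) : Prop :=
  [/\ self_conformal f, self_conformal g,
      X `<=` `[0, 1]%classic `*` `[0, 1]%classic,
      is_attractor L (carpet_map f g) X
    & ediam X = 1%E].

Definition coordinate_osc {R : realType} (I J : finType) (f : I -> R -> R)
    (g : J -> R -> R) : Prop :=
  open_set_condition f /\ open_set_condition g.

(* The measurable types of the library are pointed, hence the base letter [l0],
   which has no other role. *)
Definition letter (K : finType) (L : {set K}) (l0 : {l | l \in L}) : Type :=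
  {l | l \in L}.

HB.instance Definition _ (K : finType) (L : {set K}) (l0 : {l | l \in L}) :=
  Choice.on (letter l0).
HB.instance Definition _ (K : finType) (L : {set K}) (l0 : {l | l \in L}) :=
  isPointed.Build (letter l0) l0.
HB.instance Definition _ (K : finType) (L : {set K}) (l0 : {l | l \in L}) :=
  hasNbhs.Build (letter l0) principal_filter.
HB.instance Definition _ (K : finType) (L : {set K}) (l0 : {l | l \in L}) :=
  Discrete_ofNbhs.Build (letter l0) erefl.

Definition symbolic_top (K : finType) (L : {set K}) (l0 : {l | l \in L}) :
    Type :=
  prod_topology (fun _ : nat => letter l0).

HB.instance Definition _ (K : finType) (L : {set K}) (l0 : {l | l \in L}) :=
  Pointed.on (symbolic_top l0).
HB.instance Definition _ (K : finType) (L : {set K}) (l0 : {l | l \in L}) :=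
  Topological.on (symbolic_top l0).

(* L^nat with the Borel sigma-algebra of the product of discrete topologies. *)
Notation symbolic l0 := (g_sigma_algebraType (@open (symbolic_top l0))).

Definition symb_shift (K : finType) (L : {set K}) (l0 : {l | l \in L})
    (u : symbolic l0) : symbolic l0 :=
  fun n => u n.+1.

Definition shift_ergodic {R : realType} (K : finType) (L : {set K})
    (l0 : {l | l \in L}) (nu : probability (symbolic l0) R) : Prop :=
  (forall A : set (symbolic l0), measurable A ->
     nu (@symb_shift _ _ l0 @^-1` A) = nu A) /\
  (forall A : set (symbolic l0), measurable A ->
     @symb_shift _ _ l0 @^-1` A = A -> nu A = 0%E \/ nu A = 1%E).

(* The limit in the plane is taken coordinatewise. *)
Definition coding {R : realType} (I J : finType) (f : I -> R -> R)
    (g : J -> R -> R) (L : {set I * J}) (l0 : {l | l \in L})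
    (u : symbolic l0) : measurableTypeR R * measurableTypeR R :=
  let z n := word_map (carpet_map f g) (mkseq (fun k => val (u k)) n) (0, 0) in
  (limn (fun n => (z n).1), limn (fun n => (z n).2)).

Definition ergodic_on_carpet {R : realType} (I J : finType) (f : I -> R -> R)
    (g : J -> R -> R) (L : {set I * J}) (l0 : {l | l \in L})
    (mu : probability (measurableTypeR R * measurableTypeR R)%type R) : Prop :=
  exists2 nu : probability (symbolic l0) R, shift_ergodic nu &
    forall A : set (measurableTypeR R * measurableTypeR R), measurable A ->
      mu A = pushforward nu (@coding R I J f g L l0) A.

Section dimension_functional.
Context {R : realType} (A1 A2 : finType).
Variables (A : {set A1 * A2}) (p : A1 * A2 -> R) (a : A1 -> R) (b : A2 -> R).

Definition prob_vectors : set (A1 * A2 -> R) :=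
  [set p | [/\ forall x, 0 <= p x, forall x, x \notin A -> p x = 0
             & \sum_(x in A) p x = 1]].

Definition q_marg (i : A1) : R := \sum_(j | (i, j) \in A) p (i, j).
Definition r_marg (j : A2) : R := \sum_(i | (i, j) \in A) p (i, j).

Definition lambda1 : R := \sum_(x in A) p x * ln (a x.1).
Definition lambda2 : R := \sum_(x in A) p x * ln (b x.2).

(* Entropies are nonpositive with this sign; [ln 0 = 0] in the library, so the
   convention 0 log 0 = 0 holds. *)
Definition ent : R := \sum_(x in A) p x * ln (p x).
Definition ent1 : R := \sum_(x in A) p x * ln (q_marg x.1).
Definition ent2 : R := \sum_(x in A) p x * ln (r_marg x.2).

Definition g1 : R := ent1 / lambda1 + (ent - ent1) / lambda2.
Definition g2 : R := ent2 / lambda2 + (ent - ent2) / lambda1.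

Definition g_dim : R := if lambda2 <= lambda1 then g1 else g2.

End dimension_functional.

(* sup over [0,1] of |f_w'|, where f_w is the composition along the word w. *)
Definition deriv_norm {R : realType} (I : finType) (f : I -> R -> R) (n : nat)
    (w : n.-tuple I) : R :=
  sup [set `|derive1 (word_map f w) x| | x in `[0, 1]%classic].

(* L^n seen as a set of pairs of words, by unzipping. *)
Definition words (I J : finType) (L : {set I * J}) (n : nat) :
    {set n.-tuple I * n.-tuple J} :=
  [set w | [forall k : 'I_n, (tnth w.1 k, tnth w.2 k) \in L]].

Definition g_values {R : realType} (I J : finType) (f : I -> R -> R)
    (g : J -> R -> R) (L : {set I * J}) (n : nat) : set R :=
  [set g_dim (words L n) p (@deriv_norm R I f n) (@deriv_norm R J g n)
  | p in prob_vectors (words L n)].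

(* Main.v *)
(* Upper bound.  The letter frequencies of a finite word over [L^n] form a
   probability vector whose entropies and exponents are those of the word, so
   [max g <= s] compares entropies with contraction ratios along the prefixes of
   every code.  An elementary argument on these sequences gives, for each point
   and each eps > 0, arbitrarily small approximate squares around it, coded by
   [k] pairs of letters and by [l - k] further letters in the less contracted
   coordinate, whose total entropy is at most [(s + eps) * - ln] of their side.
   Since the sum of [exp (- entropy)] over the words of a given length grows only
   polynomially, these squares cover X with arbitrarily small
   (s + 2 eps)-dimensional sums.

   Lower bound.  Given [p] on [L^n], consider long concatenations of words of
   [L^n] that are typical for [p].  Bounded distortion and the open set condition
   bound the number of products of such blocks that meet a square of side [r] by
   [r ^ (g p - c / n)] times their total number, with [c] independent of [n].
   The law of independent uniform blocks, averaged over a period of the shift, is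
   therefore projected to an ergodic measure to which the mass distribution
   principle applies with exponent [g p - c / n].  Taking [p] optimal gives
   [max g - c / n <= dim X <= max g]. *)

Require Import Defs.
From HB Require Import structures.
From mathcomp Require Import all_boot all_order all_algebra.
From mathcomp Require Import all_classical all_reals all_analysis.
From mathcomp Require Import ring lra.
Set Implicit Arguments.
Unset Strict Implicit.
Unset Printing Implicit Defensive.
Import Order.TTheory GRing.Theory Num.Theory.
Import numFieldNormedType.Exports.
Local Open Scope classical_set_scope.
Local Open Scope ring_scope.

(** * Bounded distortion *)

(** No coordinate is dominant: which of the two contracts less depends on the code and may change
    along it. Hence the upper bound fixes no shape of approximate square; it treats both orders
    symmetrically and finds good scales along each code separately. It is exact at every fixed [n],
    because [deriv_norm] is a Lipschitz constant and Lipschitz constants multiply. In the lower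
    bound, typicality removes the inhomogeneity: up to a tolerance, typical blocks share their
    contraction in each coordinate and their probability, and the fibres over one coordinate have a
    controlled size. The tolerances are crude, one unit of logarithm per letter of [L^n], and
    distortion costs a factor [D] per such letter. Both are harmless, since the exponents over [L^n]
    are at least proportional to [n]; this is the whole origin of [c / n]. The resulting mass bound
    is uniform over small squares, so it serves both for X and for every Borel set of positive
    measure, as the lower dimension of a measure demands. *)

Section finite_bounds.
Context {R : realType}.

Lemma fin_pos_lower (T : finType) (phi : T -> R) :
  (forall x, 0 < phi x) -> exists2 c : R, 0 < c & forall x, c <= phi x.
Proof.
move=> phi0; pose S := \sum_x (phi x)^-1.
have S0 : 0 <= S by apply: sumr_ge0 => x _; rewrite invr_ge0 ltW.
(* An explicit bound instead of a minimum, which an empty [T] does not have; the 1 keeps the inverse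
   positive there. *)
exists (1 + S)^-1; first by rewrite invr_gt0 ltr_pwDl.
move=> x; rewrite -[leRHS]invrK lef_pV2 ?posrE ?invr_gt0 ?ltr_pwDl //.
rewrite /S (bigD1 x) //= addrCA lerDl addr_ge0 // sumr_ge0 // => y _.
by rewrite invr_ge0 ltW.
Qed.

Lemma fin_upper (T : finType) (phi : T -> R) : exists C : R, forall x, phi x <= C.
Proof.
exists (\sum_x `|phi x|) => x; apply: le_trans (ler_norm _) _.
by rewrite (bigD1 x) //= lerDl sumr_ge0.
Qed.

Lemma expR_small (eta C M : R) : 0 < eta -> 0 < M ->
  exists N : nat, expR (- (eta * N%:R)) * C <= M.
Proof.
move=> eta0 M0; exists (Num.bound `|C / M / eta|).
set N := Num.bound _.
have hN : C / M < 1 + eta * N%:R.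
  apply: ltr_pwDl => //; rewrite -ler_pdivrMl // mulrC.
  exact: le_trans (ler_norm _) (ltW (archi_boundP (normr_ge0 _))).
rewrite expRN mulrC ler_pdivrMr ?expR_gt0 //.
rewrite -ler_pdivrMl // mulrC; apply: le_trans (ltW hN) _; exact: expR_ge1Dx.
Qed.

End finite_bounds.

Section derivative_bound.
Context {R : realType}.

Lemma derive1_lip_le (f : R -> R) (k x : R) :
  (forall y z, y \in `[0, 1] -> z \in `[0, 1] -> `|f y - f z| <= k * `|y - z|) ->
  x \in `[0, 1] -> derivable f x 1 -> `|derive1 f x| <= k.
Proof.
move=> fk x01 dfx.
have cv : h^-1 *: (f (h + x) - f x) @[h --> 0^'] --> derive1 f x.
  have := dfx; rewrite /derivable /=.
  by under eq_fun do rewrite scaler1.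
apply/ler_addgt0Pr => e e0.
move/cvgrPdist_le : cv => /(_ e e0).
rewrite near_withinE => /nbhs_ballP[d /= d0 hd].
pose m := Num.min (d / 2) (1 / 2).
have m0 : 0 < m by rewrite lt_min !divr_gt0.
have m1 : m <= 1 / 2 by rewrite ge_min lexx orbT.
have md : m < d by rewrite gt_min; apply/orP; left; lra.
(* The Lipschitz bound is known inside [0,1] only, so at and near an endpoint the increment must
   point inwards. *)
have [h [h0 hd' hx]] : exists h, [/\ h != 0, `|h| < d & h + x \in `[0, 1]].
  move: x01; rewrite in_itv /= => /andP[x0 x1].
  have [xle|xge] := leP x (1 / 2).
    exists m; rewrite gt_eqF // gtr0_norm //; split => //.
    by rewrite in_itv /=; apply/andP; split; lra.
  exists (- m); rewrite oppr_eq0 gt_eqF // normrN gtr0_norm //; split => //.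
  by rewrite in_itv /=; apply/andP; split; lra.
have /(_ _ h0) := hd h; rewrite /ball /= sub0r normrN => /(_ hd').
set q := h^-1 *: _ => hq.
have qk : `|q| <= k.
  rewrite normrM normfV mulrC ler_pdivrMr ?normr_gt0 //.
  by have := fk _ _ hx x01; rewrite addrK.
rewrite -[derive1 f x](subrK q); apply: le_trans (ler_normD _ _) _.
by rewrite addrC lerD.
Qed.

Lemma hoelder_within_continuous (f : R -> R) (al C a b : R) :
  0 < al -> (forall x y, x \in `[a, b] -> y \in `[a, b] ->
    `|f x - f y| <= C * `|x - y| `^ al) ->
  {within `[a, b], continuous f}.
Proof.
move=> al0 hf; apply/subspace_continuousP => x xab.
apply/cvgrPdist_le => e e0; rewrite near_withinE.
pose C' := `|C| + 1; have C'0 : 0 < C' by rewrite ltr_wpDl.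
pose d := (e / C') `^ al^-1.
have d0 : 0 < d by rewrite powR_gt0 // divr_gt0.
apply/nbhs_ballP; exists d => //= y; rewrite /ball /= => xyd yab.
apply: le_trans (hf _ _ xab yab) _.
apply: (@le_trans _ _ (C' * d `^ al)); last first.
  have eC : 0 <= e / C' by rewrite divr_ge0 // ltW.
  have C'n : C' != 0 by rewrite gt_eqF.
  by rewrite -powRrM mulVf ?gt_eqF // powRr1 // mulrCA divff // mulr1.
apply: (@le_trans _ _ (C' * `|x - y| `^ al)).
  by rewrite ler_wpM2r ?powR_ge0 // ler_wpDr // ler_norm.
by rewrite ler_wpM2l ?ltW // gt0_ltr_powR ?nnegrE // ltW.
Qed.

End derivative_bound.

Section conformal.
Context {R : realType} (I : finType) (f : I -> R -> R).

(** The chain rule product. It is the derivative of [word_map f w] on [0,1], where derivability is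
    assumed. *)
Fixpoint word_deriv (w : seq I) (x : R) : R :=
  if w is i :: v then derive1 (f i) (word_map f v x) * word_deriv v x else 1.

Section fixed_constants.
Variables (k al C c : R).
Hypothesis f01 : forall i (x : R), x \in `[0, 1] -> f i x \in `[0, 1].
Hypothesis k01 : 0 < k < 1.
Hypothesis fk : forall i (x y : R), x \in `[0, 1] -> y \in `[0, 1] ->
  `|f i x - f i y| <= k * `|x - y|.
Hypothesis df : forall i (x : R), x \in `[0, 1] -> derivable (f i) x 1.
Hypothesis al0 : 0 < al.
Hypothesis C0 : 0 <= C.
Hypothesis fC : forall i (x y : R), x \in `[0, 1] -> y \in `[0, 1] ->
  `|derive1 (f i) x - derive1 (f i) y| <= C * `|x - y| `^ al.
Hypothesis c0 : 0 < c.
Hypothesis cf : forall i (x : R), x \in `[0, 1] -> c <= `|derive1 (f i) x|.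

Let w01 w (x : R) : x \in `[0, 1] -> word_map f w x \in `[0, 1].
Proof. by move=> x01; elim: w => //= i w /f01. Qed.

Let k0 : 0 < k. Proof. by case/andP: k01. Qed.

Lemma word_map_contract w (x y : R) : x \in `[0, 1] -> y \in `[0, 1] ->
  `|word_map f w x - word_map f w y| <= k ^+ size w * `|x - y|.
Proof.
move=> x01 y01; elim: w => [|i w IH] /=; first by rewrite mul1r.
apply: le_trans (fk _ (w01 w x01) (w01 w y01)) _.
by rewrite exprS -mulrA ler_wpM2l // ltW.
Qed.

Lemma is_derive_word w (x : R) : x \in `[0, 1] ->
  is_derive x 1 (word_map f w) (word_deriv w x).
Proof.
move=> x01; elim: w => [|i w IH] /=; first exact: is_derive_id.
apply: is_derive1_comp.
apply: DeriveDef; first exact/df/w01.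
by rewrite derive1E.
Qed.

Lemma derive1_word w (x : R) : x \in `[0, 1] ->
  derive1 (word_map f w) x = word_deriv w x.
Proof.
by move=> /(is_derive_word w) h; rewrite derive1E derive_val.
Qed.

Lemma word_deriv_le w (x : R) : x \in `[0, 1] -> `|word_deriv w x| <= k ^+ size w.
Proof.
move=> x01; elim: w => [|i w IH] /=; first by rewrite normr1.
rewrite normrM exprS ler_pM //.
by apply: derive1_lip_le; [exact: fk|exact: w01|exact/df/w01].
Qed.

Lemma word_deriv_neq0 w (x : R) : x \in `[0, 1] -> word_deriv w x != 0.
Proof.
move=> x01; elim: w => [|i w IH] /=; first exact: oner_neq0.
rewrite mulf_neq0 // -normr_gt0; exact: lt_le_trans (cf _ (w01 _ x01)).
Qed.

(** The logarithm of [D] is the geometric series of the relative Hoelder errors [C / c * th ^+ m] of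
    the successive derivatives, so it does not depend on the length of the word. *)
Let th := k `^ al.
Let D := expR (C / c / (1 - th)).

Let th01 : 0 <= th < 1.
Proof.
rewrite powR_ge0 /=; apply: (@lt_le_trans _ _ (1 `^ al)); last by rewrite powR1.
by rewrite gt0_ltr_powR ?nnegrE // ?ltW //; case/andP: k01.
Qed.

(* The contractions make the distances of the arguments of the successive
   derivatives decay geometrically. *)
Lemma word_deriv_distortion w (x y : R) : x \in `[0, 1] -> y \in `[0, 1] ->
  `|word_deriv w x| <= D * `|word_deriv w y|.
Proof.
move=> x01 y01.
suff h : `|word_deriv w x| <=
    expR (C / c * \sum_(m < size w) th ^+ m) * `|word_deriv w y|.
  apply: le_trans h _; rewrite ler_wpM2r // ler_expR ler_wpM2l //.
    by rewrite divr_ge0 // ltW.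
  have /andP[t0 t1] := th01.
  rewrite -[leRHS]mul1r ler_pdivlMr ?subr_gt0 //.
  rewrite mulrC -opprB mulNr -subrX1 opprB lerBlDr lerDl; exact: exprn_ge0.
elim: w => [|i w IH] /=.
  by rewrite big_ord0 mulr0 expR0 mul1r.
rewrite big_ord_recr /= mulrDr expRD !normrM.
set u := derive1 _ _; set v := derive1 (f i) (word_map f w y).
set n := size w in IH *.
have hv : c <= `|v| by exact/cf/w01.
have huv : `|u - v| <= C * th ^+ n.
  apply: le_trans (fC _ (w01 w x01) (w01 w y01)) _; rewrite ler_wpM2l //.
  have -> : th ^+ n = (k ^+ n) `^ al.
    rewrite -powR_mulrn ?powR_ge0 // powRAC powR_mulrn //; exact: ltW.
  apply: ge0_ler_powR; rewrite ?nnegrE ?exprn_ge0 // ?(ltW al0) ?(ltW k0) //.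
  apply: le_trans (word_map_contract w x01 y01) _.
  rewrite -[leRHS]mulr1 ler_wpM2l ?exprn_ge0 ?(ltW k0) //.
  by move: x01 y01; rewrite !in_itv /= ler_norml => /andP[? ?] /andP[? ?]; apply/andP; split; lra.
have hu : `|u| <= expR (C / c * th ^+ n) * `|v|.
  apply: (@le_trans _ _ ((1 + C / c * th ^+ n) * `|v|)); last first.
    by rewrite ler_wpM2r // expR_ge1Dx.
  rewrite -[u](subrK v); apply: le_trans (ler_normD _ _) _.
  rewrite mulrDl mul1r addrC lerD2l; apply: le_trans huv _.
  have t0 : 0 <= th ^+ n by rewrite exprn_ge0 // powR_ge0.
  rewrite mulrAC ler_wpM2r //.
  by rewrite mulrAC ler_pdivlMr // ler_wpM2l.
apply: le_trans (ler_pM _ _ hu IH) _ => //.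
by rewrite le_eqVlt; apply/orP; left; apply/eqP; ring.
Qed.

Lemma deriv_normE n (w : n.-tuple I) :
  deriv_norm f w = sup [set `|word_deriv w x| | x in `[0, 1]%classic].
Proof.
rewrite /deriv_norm; congr sup; apply/seteqP; split=> _ [x x01 <-]; exists x => //.
  by rewrite derive1_word.
by rewrite derive1_word.
Qed.

Let zero01 : (0 : R) \in `[0, 1]. Proof. by rewrite in_itv /= lexx ler01. Qed.

Let norms_sup n (w : n.-tuple I) :
  has_sup [set `|word_deriv w x| | x in `[0, 1]%classic].
Proof.
split; first by exists `|word_deriv w 0|, 0.
by exists (k ^+ size w) => _ [x x01 <-]; exact: word_deriv_le.
Qed.

Lemma deriv_norm_ge n (w : n.-tuple I) (x : R) : x \in `[0, 1] ->
  `|word_deriv w x| <= deriv_norm f w.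
Proof.
move=> x01; rewrite deriv_normE; apply: sup_upper_bound (norms_sup w) _ _.
by exists x.
Qed.

Lemma deriv_norm_distortion n (w : n.-tuple I) (x : R) : x \in `[0, 1] ->
  deriv_norm f w <= D * `|word_deriv w x|.
Proof.
move=> x01; rewrite deriv_normE; apply: ge_sup; first exact: (norms_sup w).1.
by move=> _ [y y01 <-]; exact: word_deriv_distortion.
Qed.

Lemma deriv_norm_gt0 n (w : n.-tuple I) : 0 < deriv_norm f w.
Proof.
apply: lt_le_trans (deriv_norm_ge w zero01).
by rewrite normr_gt0 word_deriv_neq0.
Qed.

Lemma deriv_norm_le n (w : n.-tuple I) : deriv_norm f w <= k ^+ n.
Proof.
rewrite deriv_normE; apply: ge_sup; first exact: (norms_sup w).1.
by move=> _ [y y01 <-]; have := word_deriv_le w y01; rewrite size_tuple.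
Qed.

Lemma word_map_mvt w (x y : R) : x \in `[0, 1] -> y \in `[0, 1] ->
  exists2 z, z \in `[0, 1] &
  `|word_map f w x - word_map f w y| = `|word_deriv w z| * `|x - y|.
Proof.
wlog xy : x y / x <= y => [hwlog|] x01 y01.
  have [/hwlog|/ltW /hwlog h] := leP x y; first exact.
  by have [z z01 hz] := h y01 x01; exists z => //; rewrite distrC hz distrC.
have sub z : z \in `[x, y] -> z \in `[0, 1].
  move: x01 y01; rewrite !in_itv /= => /andP[x0 _] /andP[_ y1] /andP[xz zy].
  by rewrite (le_trans x0 xz) (le_trans zy y1).
have [z zxy hz] := MVT_segment (f := word_map f w) (df := word_deriv w) xy
  (fun z zxy => is_derive_word w (sub z (subset_itv_oo_cc zxy)))
  (derivable_within_continuous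
    (fun z zxy => @ex_derive _ _ _ _ _ _ _ (is_derive_word w (sub z zxy)))).
exists z; first exact: sub.
by rewrite distrC hz normrM [in RHS]distrC.
Qed.

(** The mean value point is unknown, but distortion compares the derivative there with the
    supremum. *)
Lemma word_map_bilip n (w : n.-tuple I) (x y : R) : x \in `[0, 1] -> y \in `[0, 1] ->
  deriv_norm f w / D * `|x - y| <= `|word_map f w x - word_map f w y| <=
  deriv_norm f w * `|x - y|.
Proof.
move=> x01 y01; have [z z01 ->] := word_map_mvt w x01 y01.
apply/andP; split; rewrite ler_wpM2r //; last exact: deriv_norm_ge.
by rewrite ler_pdivrMr ?expR_gt0 // mulrC deriv_norm_distortion.
Qed.

End fixed_constants.

(** The point is the order of the quantifiers: one [D] and one [k] serve all lengths [n]. *)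
Lemma self_conformal_distortion : self_conformal f -> exists D k : R,
  [/\ 1 <= D, 0 < k < 1 & forall n (w : n.-tuple I),
    [/\ 0 < deriv_norm f w, deriv_norm f w <= k ^+ n &
     forall x y : R, x \in `[0, 1] -> y \in `[0, 1] ->
      deriv_norm f w / D * `|x - y| <= `|word_map f w x - word_map f w y| <=
      deriv_norm f w * `|x - y|]].
Proof.
move=> [f01 [k0 k01 fk0] df [al /andP[al0 _] [C0 fC0]] dn0].
(* The maximum with 1/2 makes the contraction constant positive as well as less than 1. *)
pose k := Num.max k0 (1 / 2).
have k01' : 0 < k < 1 by rewrite lt_max gt_max k01; apply/andP; split; lra.
have fk i (x y : R) : x \in `[0, 1] -> y \in `[0, 1] ->
    `|f i x - f i y| <= k * `|x - y|.
  move=> x01 y01; apply: le_trans (fk0 i _ _ x01 y01) _.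
  by rewrite ler_wpM2r // le_max lexx.
pose C := `|C0|.
have fC i (x y : R) : x \in `[0, 1] -> y \in `[0, 1] ->
    `|derive1 (f i) x - derive1 (f i) y| <= C * `|x - y| `^ al.
  move=> x01 y01; apply: le_trans (fC0 i _ _ x01 y01) _.
  by rewrite ler_wpM2r ?powR_ge0 // ler_norm.
(* A continuous nonvanishing derivative is bounded away from 0 on a compact interval; finiteness of
   [I] then gives a common constant. *)
have min_i i : exists2 c : R, 0 < c & forall x : R, x \in `[0, 1] -> c <= `|derive1 (f i) x|.
  have cont : {within `[0, 1], continuous (fun x => `|derive1 (f i) x|)}.
    move=> x; apply: continuous_comp; last exact: norm_continuous.
    by apply: (hoelder_within_continuous al0 (C := C)); exact: fC.
  have [c c01 hc] := EVT_min ler01 cont.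
  by exists `|derive1 (f i) c| => //; rewrite normr_gt0 dn0.
have /choice[cs csP] : forall i, exists c : R, 0 < c /\
    (forall x : R, x \in `[0, 1] -> c <= `|derive1 (f i) x|).
  by move=> i; have [c c0 hc] := min_i i; exists c.
have [c c0 hc] := fin_pos_lower (fun i => (csP i).1).
have cf i (x : R) : x \in `[0, 1] -> c <= `|derive1 (f i) x|.
  by move=> /(csP i).2; apply: le_trans.
have C0' : 0 <= C by exact: normr_ge0.
exists (expR (C / c / (1 - k `^ al))), k; split => //.
  have t1 : k `^ al < 1.
    apply: (@lt_le_trans _ _ (1 `^ al)); last by rewrite powR1.
    by rewrite gt0_ltr_powR ?nnegrE // ?ltW //; case/andP: k01'.
  have Cc : 0 <= C / c by rewrite divr_ge0 // ltW.
  by rewrite -[leLHS]expR0 ler_expR divr_ge0 // subr_ge0 ltW.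
move=> n w; split.
- exact: (deriv_norm_gt0 f01 fk df c0 cf).
- exact: (deriv_norm_le f01 fk df).
- exact: (word_map_bilip f01 k01' fk df al0 C0' fC c0 cf).
Qed.

End conformal.

(** * Adapted pairs of levels *)

Section adapted_pairs.
Context {R : realType}.
Implicit Types (e h S T : nat -> R) (s eps K c : R).

(** Here [S] and [T] are logarithmic contractions, [e] is the entropy of the pairs and [h] that of
    the [S]-coordinate. A rectangle coded by [l] letters in the [S]-coordinate and [k] in the other
    one has sides at most [expR (- S l)], and [e k - h k + h l] accounts for [k] pairs followed by
    [l - k] single letters. *)
Definition adapted e h S T s (k l : nat) : Prop :=
  S l <= T k /\ e k - h k + h l <= s * S l.

Definition step_bounds c0 c1 S : Prop :=
  S 0%N = 0 /\ forall n, S n + c0 <= S n.+1 <= S n + c1.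

Definition entropy_bounds K e h : Prop :=
  forall n, 0 <= h n <= K * n%:R /\ h n <= e n <= K * n%:R.

(** This is [g_dim <= s] at the letter frequencies of the prefix of length [n], in the case where
    the [S]-coordinate contracts less. *)
Definition ratio_bound e h S T s : Prop :=
  forall n, (0 < n)%N -> S n <= T n -> h n / S n + (e n - h n) / T n <= s.

Lemma step_bounds_ge c0 c1 S n : step_bounds c0 c1 S -> c0 * n%:R <= S n.
Proof.
case=> S0 hS; elim: n => [|n IH]; first by rewrite S0 mulr0.
have /andP[h1 _] := hS n; rewrite -natr1; lra.
Qed.

Lemma step_bounds_le c0 c1 S m n : 0 < c0 -> step_bounds c0 c1 S ->
  (m <= n)%N -> S m <= S n.
Proof.
move=> c00 [_ hS]; elim: n => [|n IH]; first by rewrite leqn0 => /eqP ->.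
rewrite leq_eqVlt => /orP[/eqP -> //|]; rewrite ltnS => /IH.
have /andP[h1 _] := hS n; lra.
Qed.

Lemma step_bounds_last c0 c1 S k x : 0 < c0 -> step_bounds c0 c1 S ->
  S k <= x -> exists2 l, (k <= l)%N & S l <= x < S l.+1.
Proof.
move=> c00 hS hk.
have [n hn] : exists n, x < S n.
  exists (Num.bound `|x / c0|); apply: lt_le_trans (step_bounds_ge _ hS).
  rewrite -ltr_pdivrMl // mulrC.
  exact: le_lt_trans (ler_norm _) (archi_boundP (normr_ge0 _)).
have {hn}ex : exists n, x < S n by exists n.
case: (ex_minnP ex) => -[|m] hm mmin.
  have := step_bounds_le c00 hS (leq0n k); lra.
have hmx : S m <= x.
  by rewrite leNgt; apply/negP => /mmin; rewrite ltnn.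
exists m; last by rewrite hmx.
rewrite leqNgt; apply/negP => mk; have := step_bounds_le c00 hS mk; lra.
Qed.

(** The quotient is at most [K / c0], while [S l] grows linearly. So an error of one step [c1] in
    [T n], made when [T n] is replaced by some [S l], is absorbed by [eps / 2] for large [n]. *)
Lemma ratio_slack c0 c1 K e h S T eps n :
  0 < c0 -> 0 < eps -> step_bounds c0 c1 S -> step_bounds c0 c1 T ->
  entropy_bounds K e h -> (0 < n)%N -> 2 * c1 * K <= eps * c0 ^+ 2 * n%:R ->
  0 <= (e n - h n) / T n /\
  forall l, (n <= l)%N -> c1 * ((e n - h n) / T n) <= eps / 2 * S l.
Proof.
move=> c00 eps0 hS hT he n0 hn.
have n0' : (0 : R) < n%:R by rewrite ltr0n.
have T0 : c0 * n%:R <= T n := step_bounds_ge _ hT.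
have cn : 0 < c0 * n%:R by exact: mulr_gt0.
have Tn : 0 < T n by exact: lt_le_trans cn T0.
have [/andP[h0 hK] /andP[eh eK]] := he n.
have c10 : 0 <= c1 by have /andP[] := hS.2 0%N; lra.
split; first by rewrite divr_ge0 //; lra.
move=> l nl.
have Sl : c0 * n%:R <= S l.
  exact: le_trans (step_bounds_ge _ hS) (step_bounds_le c00 hS nl).
apply: (@le_trans _ _ (c1 * (K / c0))).
  apply: ler_wpM2l => //; rewrite ler_pdivrMr // mulrAC ler_pdivlMr //.
  have K0 : 0 <= K by rewrite -(@pmulr_lge0 _ n%:R) //; lra.
  apply: (@le_trans _ _ (K * n%:R * c0)).
    by apply: ler_wpM2r; [exact: ltW|lra].
  by rewrite -mulrA; apply: ler_wpM2l => //; rewrite mulrC.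
apply: (@le_trans _ _ (eps / 2 * (c0 * n%:R))).
  by rewrite mulrA ler_pdivrMr //; nra.
by apply: ler_wpM2l => //; lra.
Qed.

(* If [k] never succeeds, then replacing [k] by the last [l] with
   [S l <= T k] increases [h / S] by a fixed amount; but [h / S] is bounded. *)
Lemma adapted_ordered c0 c1 K e h S T s eps N :
  0 < c0 -> 0 < eps -> step_bounds c0 c1 S -> step_bounds c0 c1 T ->
  entropy_bounds K e h -> ratio_bound e h S T s ->
  (0 < N)%N -> 2 * c1 * K <= eps * c0 ^+ 2 * N%:R ->
  (forall n, (N <= n)%N -> S n <= T n) ->
  exists k l, [/\ (N <= k)%N, (k <= l)%N & adapted e h S T (s + eps) k l].
Proof.
move=> c00 eps0 hS hT he hr N0 hN hST; apply: contrapT => hno.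
have step k : (N <= k)%N -> exists2 l, (N <= l)%N &
    h k / S k + eps / 2 <= h l / S l.
  move=> Nk; have k0 : (0 < k)%N by exact: leq_trans N0 Nk.
  have [l kl /andP[l1 l2]] := step_bounds_last c00 hS (hST _ Nk).
  exists l; first exact: leq_trans kl.
  (* By the choice of [l], [T k < S l + c1]. Without a gain of [eps / 2], the ratio bound at [k]
     multiplied by [S l] would make the pair adapted. *)
  rewrite leNgt; apply/negP => hlt; apply: hno; exists k, l; split=> //.
  split=> //.
  have hk : 2 * c1 * K <= eps * c0 ^+ 2 * k%:R.
    apply: le_trans hN _; apply: ler_wpM2l; last by rewrite ler_nat.
    by rewrite mulr_ge0 ?sqr_ge0 // ltW.
  have [F0 /(_ l kl) F1] := ratio_slack c00 eps0 hS hT he k0 hk.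
  have r1 := hr k k0 (hST _ Nk).
  have k0' : (0 : R) < k%:R by rewrite ltr0n.
  have Sk := lt_le_trans (mulr_gt0 c00 k0') (step_bounds_ge k hS).
  have Tk := lt_le_trans (mulr_gt0 c00 k0') (step_bounds_ge k hT).
  have Sl := lt_le_trans Sk (step_bounds_le c00 hS kl).
  have -> : e k - h k = (e k - h k) / T k * T k by rewrite divfK // gt_eqF.
  have -> : h l = h l / S l * S l by rewrite divfK // gt_eqF.
  have /andP[_ u1] := hS.2 l.
  set F := (e k - h k) / T k in F0 F1 r1 *.
  set G := h l / S l in hlt *; set G' := h k / S k in hlt r1.
  have FT : F * T k <= F * (S l + c1) by apply: ler_wpM2l => //; lra.
  have GS : G * S l <= (G' + eps / 2) * S l by apply: ler_wpM2r; lra.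
  have FGS : (F + G') * S l <= s * S l by apply: ler_wpM2r; lra.
  nra.
have iter m : exists2 k, (N <= k)%N & eps / 2 * m%:R <= h k / S k.
  elim: m => [|m [k Nk hk]].
    exists N => //; rewrite mulr0.
    by rewrite divr_ge0 //; [case: (he N) => /andP[]|
      apply: le_trans (step_bounds_ge _ hS); rewrite mulr_ge0 // ltW].
  have [l Nl hl] := step _ Nk; exists l => //; rewrite -[m.+1%:R]natr1 mulrDr mulr1; lra.
(* So many gains of [eps / 2] exceed the upper bound [K / c0] of [h / S]. *)
have [k Nk] := iter (Num.bound (K / c0 / (eps / 2))).
have k0 : (0 : R) < k%:R by rewrite ltr0n (leq_trans N0).
have Sk : c0 * k%:R <= S k := step_bounds_ge k hS.
have Sk0 : 0 < S k by apply: lt_le_trans Sk; exact: mulr_gt0.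
have hk : h k / S k <= K / c0.
  have [/andP[h0 hK] _] := he k.
  have K0 : 0 <= K by rewrite -(@pmulr_lge0 _ k%:R) //; lra.
  rewrite ler_pdivrMr // mulrAC ler_pdivlMr //.
  apply: (@le_trans _ _ (K * k%:R * c0)); first by apply: ler_wpM2r=> //; lra.
  by rewrite -mulrA; apply: ler_wpM2l => //; rewrite mulrC.
apply/negP; rewrite -ltNge; apply: le_lt_trans hk _.
rewrite -ltr_pdivrMl ?divr_gt0 // [X in X < _]mulrC; apply: archi_boundP.
have [/andP[h0 hK] _] := he k.
have K0 : 0 <= K by rewrite -(@pmulr_lge0 _ k%:R) //; lra.
by rewrite !divr_ge0 // ltW.
Qed.

(** Just before the order changes, [T n] exceeds [S n] by less than [c1], so both fractions of the
    ratio bound can be given the denominator [S n]. *)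
Lemma adapted_switch c0 c1 K e h S T s eps n :
  0 < c0 -> 0 < eps -> step_bounds c0 c1 S -> step_bounds c0 c1 T ->
  entropy_bounds K e h -> ratio_bound e h S T s ->
  (0 < n)%N -> 2 * c1 * K <= eps * c0 ^+ 2 * n%:R ->
  S n <= T n -> T n.+1 < S n.+1 -> adapted e h S T (s + eps) n n.
Proof.
move=> c00 eps0 hS hT he hr n0 hn ST TS; split=> //.
have [F0 /(_ n (leqnn n)) F1] := ratio_slack c00 eps0 hS hT he n0 hn.
have r1 := hr n n0 ST.
have n0' : (0 : R) < n%:R by rewrite ltr0n.
have Sn := lt_le_trans (mulr_gt0 c00 n0') (step_bounds_ge n hS).
have Tn := lt_le_trans (mulr_gt0 c00 n0') (step_bounds_ge n hT).
have -> : e n - h n = (e n - h n) / T n * T n by rewrite divfK // gt_eqF.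
have hGE : h n = h n / S n * S n by rewrite divfK // gt_eqF.
rewrite [X in _ + X]hGE.
have /andP[_ u1] := hS.2 n; have /andP[u2 _] := hT.2 n.
set F := (e n - h n) / T n in F0 F1 r1 *; set G := h n / S n in r1 *.
have FT : F * T n <= F * (S n + c1) by apply: ler_wpM2l => //; lra.
have FGS : (F + G) * S n <= s * S n by apply: ler_wpM2r; lra.
nra.
Qed.

(* At a change of order between [S] and [T] the pair [(n, n)] is adapted, so
   otherwise the order is eventually constant. *)
Lemma adapted_exists c0 c1 K e h1 h2 S1 S2 s eps N :
  0 < c0 -> 0 < eps -> step_bounds c0 c1 S1 -> step_bounds c0 c1 S2 ->
  entropy_bounds K e h1 -> entropy_bounds K e h2 ->
  ratio_bound e h1 S1 S2 s -> ratio_bound e h2 S2 S1 s ->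
  exists k l, [/\ (N <= l)%N, (k <= l)%N & adapted e h1 S1 S2 (s + eps) k l \/
     adapted e h2 S2 S1 (s + eps) k l].
Proof.
move=> c00 eps0 hS1 hS2 he1 he2 hr1 hr2.
pose x := 2 * c1 * K / (eps * c0 ^+ 2).
pose M := maxn N (Num.bound `|x|).+1.
have M0 : (0 < M)%N by rewrite leq_max orbT.
have NM : (N <= M)%N by rewrite leq_max leqnn.
have hM n : (M <= n)%N -> 2 * c1 * K <= eps * c0 ^+ 2 * n%:R.
  move=> Mn; rewrite -ler_pdivrMl ?mulr_gt0 ?exprn_gt0 // [X in X <= _]mulrC.
  rewrite -/x; apply: le_trans (ler_norm x) _.
  apply: ltW; apply: lt_le_trans (archi_boundP (normr_ge0 x)) _.
  by rewrite ler_nat (leq_trans _ Mn) // leq_max leqnSn orbT.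
apply: contrapT => hno.
have no1 k l : (M <= l)%N -> (k <= l)%N -> ~ adapted e h1 S1 S2 (s + eps) k l.
  move=> Ml kl ha; apply: hno; exists k, l; split; [|by []|by left].
  exact: leq_trans NM Ml.
have no2 k l : (M <= l)%N -> (k <= l)%N -> ~ adapted e h2 S2 S1 (s + eps) k l.
  move=> Ml kl ha; apply: hno; exists k, l; split; [|by []|by right].
  exact: leq_trans NM Ml.
have [h|h] := leP (S1 M) (S2 M).
  have hord n : (M <= n)%N -> S1 n <= S2 n.
    elim: n => [|n IH]; first by rewrite leqNgt M0.
    rewrite leq_eqVlt => /orP[/eqP <- //|]; rewrite ltnS => Mn.
    rewrite leNgt; apply/negP => hlt; apply: (no1 n n Mn (leqnn n)).
    apply: (adapted_switch c00 eps0 hS1 hS2 he1 hr1) => //.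
    - exact: leq_trans M0 Mn.
    - exact: hM.
    - exact: IH.
  have [k [l [Mk kl ha]]] := adapted_ordered c00 eps0 hS1 hS2 he1 hr1 M0
    (hM _ (leqnn M)) hord.
  by apply: (no1 k l) => //; exact: leq_trans kl.
have hord n : (M <= n)%N -> S2 n <= S1 n.
  elim: n => [|n IH]; first by rewrite leqNgt M0.
  rewrite leq_eqVlt => /orP[/eqP <- |]; first exact: ltW.
  rewrite ltnS => Mn.
  rewrite leNgt; apply/negP => hlt; apply: (no2 n n Mn (leqnn n)).
  apply: (adapted_switch c00 eps0 hS2 hS1 he2 hr2) => //.
  - exact: leq_trans M0 Mn.
  - exact: hM.
  - exact: IH.
have [k [l [Mk kl ha]]] := adapted_ordered c00 eps0 hS2 hS1 he2 hr2 M0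
  (hM _ (leqnn M)) hord.
by apply: (no2 k l) => //; exact: leq_trans kl.
Qed.

End adapted_pairs.

(** * Entropy of finite words *)

Lemma sum_tuple_prod (K : comPzRingType) (T : finType) n (q : 'I_n -> T -> K) :
  \sum_(w : n.-tuple T) \prod_(i < n) q i (tnth w i) = \prod_(i < n) \sum_x q i x.
Proof.
rewrite bigA_distr_bigA /=.
rewrite [RHS](reindex (fun w : n.-tuple T => [ffun i => tnth w i])) /=.
  by apply: eq_bigr => w _; apply: eq_bigr => i _; rewrite ffunE.
exists (fun f : {ffun 'I_n -> T} => [tuple f i | i < n]) => [w|f] _.
  by apply: eq_from_tnth => i; rewrite tnth_mktuple ffunE.
by apply/ffunP => i; rewrite ffunE tnth_mktuple.
Qed.

Lemma sum_bool_card (K : pzSemiRingType) (T : finType) (P : pred T) :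
  \sum_x (P x)%:R = #|P|%:R :> K.
Proof.
rewrite -sum1_card natr_sum [RHS]big_mkcond; apply: eq_bigr => x _.
by rewrite unfold_in; case: (P x).
Qed.

Section word_entropy.
Context {R : realType}.
Implicit Types (A : finType).

(** This is [size w] times the Shannon entropy of the letter frequencies. Summing over positions
    involves only letters that occur. *)
Definition word_entropy A (w : seq A) : R :=
  \sum_(x <- w) ln ((size w)%:R / (count_mem x w)%:R).

Lemma sum_count A (w : seq A) (phi : A -> R) :
  \sum_(x <- w) phi x = \sum_x (count_mem x w)%:R * phi x.
Proof.
elim: w => [|y w IH].
  by rewrite big_nil big1 // => x _; rewrite /= mul0r.
rewrite big_cons IH.
have -> : phi y = \sum_x (y == x)%:R * phi x.
  rewrite (bigD1 y) //= eqxx mul1r big1 ?addr0 // => x.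
  by rewrite eq_sym => /negPf ->; rewrite mul0r.
by rewrite -big_split /=; apply: eq_bigr => x _; rewrite natrD mulrDl.
Qed.

Lemma sum_count_size A (w : seq A) :
  \sum_x (count_mem x w)%:R = (size w)%:R :> R.
Proof.
have := sum_count w (fun=> 1); under [in RHS]eq_bigr do rewrite mulr1.
by move=> <-; rewrite big_const_seq count_predT iter_addr addr0.
Qed.

Lemma count_mem_gt0 A (w : seq A) x : x \in w -> 0 < (count_mem x w)%:R :> R.
Proof. by rewrite ltr0n -has_count has_pred1. Qed.

Lemma word_entropy_ge0 A (w : seq A) : 0 <= word_entropy w.
Proof.
rewrite /word_entropy big_seq; apply: sumr_ge0 => x xw; apply: ln_ge0.
by rewrite ler_pdivlMr ?count_mem_gt0 // mul1r ler_nat count_size.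
Qed.

(** The Gibbs inequality: [ln y <= y - 1], applied at each position to the quotient of [q x] by the
    frequency of [x]. *)
Lemma word_entropy_gibbs A (w : seq A) (q : A -> R) :
  (forall x, 0 <= q x) -> \sum_x q x <= 1 -> (forall x, x \in w -> 0 < q x) ->
  word_entropy w <= \sum_(x <- w) - ln (q x).
Proof.
move=> q0 q1 qw; rewrite -subr_ge0 -sumrB.
case: (posnP (size w)) => [/size0nil ->|w0]; first by rewrite big_nil.
have n0 : (0 : R) < (size w)%:R by rewrite ltr0n.
apply: (@le_trans _ _ (\sum_(x <- w)
    (1 - q x * ((size w)%:R / (count_mem x w)%:R)))).
  rewrite sumrB 2!(sum_count w); under eq_bigr do rewrite mulr1.
  rewrite sum_count_size subr_ge0.
  apply: (@le_trans _ _ (\sum_x q x * (size w)%:R)); last first.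
    by rewrite -mulr_suml -[leRHS]mul1r ler_wpM2r // ltW.
  apply: ler_sum => x _; have [->|c0] := eqVneq (count_mem x w) 0%N.
    by rewrite mul0r mulr_ge0 // ltW.
  by rewrite mulrCA [X in q x * X <= _]mulrC divfK ?pnatr_eq0.
rewrite big_seq [leRHS]big_seq; apply: ler_sum => x xw.
have c0 : 0 < (count_mem x w)%:R :> R := count_mem_gt0 xw.
have q0' := qw _ xw.
rewrite -opprD -lnM ?posrE ?divr_gt0 // lerNr opprB.
set y := (X in ln X); have y0 : 0 < y by rewrite mulr_gt0 ?divr_gt0.
by rewrite -[y in ln y](subrKC 1) le_ln1Dx //; lra.
Qed.

Lemma word_entropy_nil A : word_entropy ([::] : seq A) = 0.
Proof. by rewrite /word_entropy big_nil. Qed.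

(** Concavity of entropy, obtained from the Gibbs inequality for [u] and for [v] with the
    frequencies of [u ++ v] as the competitor. *)
Lemma word_entropy_cat A (u v : seq A) :
  word_entropy u + word_entropy v <= word_entropy (u ++ v).
Proof.
pose n : R := (size (u ++ v))%:R.
pose q x : R := (count_mem x (u ++ v))%:R / n.
have q0 x : 0 <= q x by rewrite divr_ge0.
have q1 : \sum_x q x <= 1.
  rewrite -mulr_suml sum_count_size -/n.
  by have [->|n0] := eqVneq n 0; rewrite ?mul0r ?divff.
(* The identity extends to absent letters because [ln 0 = 0] and [0^-1 = 0]. *)
have qE x : - ln (q x) = ln (n / (count_mem x (u ++ v))%:R).
  have [nz|n0] := eqVneq n 0; first by rewrite /q nz invr0 mulr0 mul0r ln0 ?oppr0.
  have [c0|c0] := eqVneq ((count_mem x (u ++ v))%:R : R) 0.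
    by rewrite /q c0 invr0 mul0r mulr0 ln0 ?oppr0.
  by rewrite -lnV ?posrE ?invfM ?invrK 1?mulrC // divr_gt0 // lt0r ?n0 ?c0 /=.
have qgt0 x : x \in u ++ v -> 0 < q x.
  move=> xuv; rewrite divr_gt0 ?count_mem_gt0 // ltr0n.
  by case: (u ++ v) xuv.
have sub w : {subset w <= u ++ v} -> word_entropy w <=
    \sum_(x <- w) ln (n / (count_mem x (u ++ v))%:R).
  move=> suv; apply: le_trans (word_entropy_gibbs q0 q1 _) _.
    by move=> x /suv; exact: qgt0.
  by apply: ler_sum => x _; rewrite qE.
rewrite [leRHS]/word_entropy big_cat /=; apply: lerD; apply: sub => x xu.
  by rewrite mem_cat xu.
by rewrite mem_cat xu orbT.
Qed.

(** Merging letters can only increase the count seen at each position. *)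
Lemma word_entropy_map A (B : finType) (phi : A -> B) (w : seq A) :
  word_entropy (map phi w) <= word_entropy w.
Proof.
rewrite /word_entropy big_map size_map big_seq [leRHS]big_seq.
apply: ler_sum => x xw.
have c0 : 0 < (count_mem x w)%:R :> R := count_mem_gt0 xw.
have cc : (count_mem x w <= count_mem (phi x) (map phi w))%N.
  by rewrite count_map; apply: sub_count => y /= /eqP ->.
have n0 : 0 < (size w)%:R :> R by case: w xw {c0 cc}.
have c0' : 0 < (count_mem (phi x) (map phi w))%:R :> R.
  by apply: lt_le_trans c0 _; rewrite ler_nat.
rewrite ler_ln ?posrE ?divr_gt0 //.
by rewrite ler_pM2l // lef_pV2 ?posrE // ler_nat.
Qed.

Lemma word_entropy_le A (w : seq A) :
  word_entropy w <= ln #|A|%:R * (size w)%:R.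
Proof.
case: w => [|y w]; first by rewrite word_entropy_nil mulr0.
have A0 : 0 < #|A|%:R :> R by rewrite ltr0n; apply/card_gt0P; exists y.
apply: le_trans (word_entropy_gibbs (q := fun=> #|A|%:R^-1) _ _ _) _.
- by move=> x; rewrite invr_ge0.
- by rewrite sumr_const -[_ *+ _]mulr_natr mulVf ?gt_eqF.
- by move=> x _; rewrite invr_gt0.
by rewrite big_const_seq count_predT iter_addr addr0 lnV ?posrE // opprK mulr_natr.
Qed.

(* Words with the same counts have weights [exp (- word_entropy w)] adding up
   to at most 1, and there are at most [n.+1 ^ #|A|] count vectors. *)
Lemma word_entropy_kraft A n :
  \sum_(w : n.-tuple A) expR (- word_entropy w) <= (n.+1 ^ #|A|)%:R.
Proof.
case: n => [|n].
  rewrite exp1n (bigD1 [tuple]) //= word_entropy_nil oppr0 expR0 big1 ?addr0 //.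
  by move=> w; rewrite tuple0.
pose ty (w : n.+1.-tuple A) : {ffun A -> 'I_n.+2} :=
  [ffun x => inord (count_mem x w)].
have tyE w x : ty w x = count_mem x w :> nat.
  rewrite ffunE inordK // ltnS -[X in (_ <= X)%N](size_tuple w).
  exact: count_size.
rewrite (partition_big ty predT) //=.
have -> : (n.+2 ^ #|A|)%:R = \sum_(c : {ffun A -> 'I_n.+2}) 1 :> R.
  by rewrite sumr_const card_ffun card_ord.
apply: ler_sum => c _.
case: (pickP (fun w => ty w == c)) => [w0 /eqP tw0|none]; last first.
  by rewrite big_pred0.
pose q x : R := (c x)%:R / n.+1%:R.
have q1 : \sum_x q x = 1.
  rewrite -mulr_suml -tw0; under eq_bigr do rewrite tyE.
  by rewrite sum_count_size size_tuple divff // pnatr_eq0.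
have -> : 1 = \sum_(w : n.+1.-tuple A) \prod_(i < n.+1) q (tnth w i).
  by rewrite (sum_tuple_prod (fun=> q)) big1.
rewrite [leRHS](bigID (fun w => ty w == c)) /=.
rewrite -[leLHS]addr0; apply: lerD; last first.
  by apply: sumr_ge0 => w _; apply: prodr_ge0 => i _; rewrite divr_ge0.
apply: ler_sum => w /eqP tw.
rewrite -(big_tuple _ _ w xpredT q).
rewrite /word_entropy -sumrN expR_sum size_tuple.
rewrite big_seq [leRHS]big_seq le_eqVlt; apply/orP; left; apply/eqP.
apply: eq_bigr => x xw.
rewrite /q -tw tyE -lnV ?posrE ?divr_gt0 ?count_mem_gt0 ?ltr0n //.
by rewrite invfM invrK mulrC lnK // posrE divr_gt0 ?count_mem_gt0 ?ltr0n.
Qed.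

End word_entropy.

(** * Letter frequencies of a word as a probability vector *)

Section word_type.
Context {R : realType} (A1 A2 : finType).
Variables (A : {set A1 * A2}) (a : A1 -> R) (b : A2 -> R).

Definition contraction (B : Type) (c : B -> R) (v : seq B) : R :=
  \sum_(x <- v) - ln (c x).

Definition word_type (w : seq (A1 * A2)) (x : A1 * A2) : R :=
  (count_mem x w)%:R / (size w)%:R.

Section fixed_word.
Variable w : seq (A1 * A2).
Hypotheses (wA : {subset w <= A}) (w0 : (0 < size w)%N).

Let n0 : (0 : R) < (size w)%:R. Proof. by rewrite ltr0n. Qed.

Lemma word_type_notin x : x \notin A -> word_type w x = 0.
Proof.
move=> xA; rewrite /word_type (count_memPn _) ?mul0r //.
by apply: contra xA => /wA.
Qed.

Lemma sum_word_type (phi : A1 * A2 -> R) :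
  \sum_(x in A) word_type w x * phi x = (\sum_(x <- w) phi x) / (size w)%:R.
Proof.
rewrite (sum_count w) mulr_suml [RHS](bigID (mem A)) /= [X in _ + X]big1 ?addr0.
  by apply: eq_bigr => x _; rewrite /word_type mulrAC.
by move=> x xA; have := word_type_notin xA; rewrite /word_type mulrAC => ->; rewrite mul0r.
Qed.

Lemma word_type_prob : prob_vectors A (word_type w).
Proof.
split; first by move=> x; rewrite divr_ge0.
  exact: word_type_notin.
have := sum_word_type (fun=> 1); under eq_bigr do rewrite mulr1.
by move=> ->; rewrite big_const_seq count_predT iter_addr addr0 divff ?gt_eqF.
Qed.

Lemma word_type_q i :
  q_marg A (word_type w) i = (count_mem i (unzip1 w))%:R / (size w)%:R.
Proof.
have -> : (count_mem i (unzip1 w))%:R = \sum_(x <- w) (x.1 == i)%:R :> R.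
  by rewrite -natr_sum count_map -sum1_count big_mkcond.
rewrite -sum_word_type /q_marg.
rewrite [RHS](eq_bigr (fun x => if x.1 == i then word_type w x else 0)); last first.
  by move=> x _; case: eqP; rewrite ?mulr1 ?mulr0.
rewrite -big_mkcondr (reindex_onto (fun j => (i, j)) snd) /=; last first.
  by move=> [? ?] /= /andP[_ /eqP ->].
by apply: eq_bigl => j; rewrite !eqxx !andbT.
Qed.

Lemma word_type_r j :
  r_marg A (word_type w) j = (count_mem j (unzip2 w))%:R / (size w)%:R.
Proof.
have -> : (count_mem j (unzip2 w))%:R = \sum_(x <- w) (x.2 == j)%:R :> R.
  by rewrite -natr_sum count_map -sum1_count big_mkcond.
rewrite -sum_word_type /r_marg.
rewrite [RHS](eq_bigr (fun x => if x.2 == j then word_type w x else 0)); last first.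
  by move=> x _; case: eqP; rewrite ?mulr1 ?mulr0.
rewrite -big_mkcondr (reindex_onto (fun i => (i, j)) fst) /=; last first.
  by move=> [? ?] /= /andP[_ /eqP ->].
by apply: eq_bigl => i; rewrite !eqxx !andbT.
Qed.

Lemma word_type_lambda1 :
  lambda1 A (word_type w) a = - contraction a (unzip1 w) / (size w)%:R.
Proof.
by rewrite /lambda1 sum_word_type /contraction big_map sumrN opprK.
Qed.

Lemma word_type_lambda2 :
  lambda2 A (word_type w) b = - contraction b (unzip2 w) / (size w)%:R.
Proof.
by rewrite /lambda2 sum_word_type /contraction big_map sumrN opprK.
Qed.

Let ln_ratio (B : finType) (v : seq B) y : y \in v -> size v = size w ->
  ln ((count_mem y v)%:R / (size w)%:R) =
  - ln ((size v)%:R / (count_mem y v)%:R) :> R.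
Proof.
move=> yv ->; rewrite -lnV ?posrE ?divr_gt0 ?count_mem_gt0 //.
by rewrite invfM invrK mulrC.
Qed.

Let frac_opp (x y : R) : - x / (size w)%:R / (- y / (size w)%:R) = x / y.
Proof.
by rewrite invfM invrK mulrACA mulVf ?gt_eqF // mulr1 invrN mulrNN.
Qed.

Lemma word_type_ent : ent A (word_type w) = - word_entropy w / (size w)%:R.
Proof.
rewrite /ent sum_word_type /word_entropy -sumrN; congr (_ / _).
by rewrite big_seq [RHS]big_seq; apply: eq_bigr => x xw; exact: ln_ratio.
Qed.

Lemma word_type_ent1 :
  ent1 A (word_type w) = - word_entropy (unzip1 w) / (size w)%:R.
Proof.
rewrite /ent1 sum_word_type /word_entropy -sumrN; congr (_ / _).
rewrite [RHS]big_map big_seq [RHS]big_seq; apply: eq_bigr => x xw.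
by rewrite word_type_q; apply: ln_ratio; [exact: map_f|rewrite size_map].
Qed.

Lemma word_type_ent2 :
  ent2 A (word_type w) = - word_entropy (unzip2 w) / (size w)%:R.
Proof.
rewrite /ent2 sum_word_type /word_entropy -sumrN; congr (_ / _).
rewrite [RHS]big_map big_seq [RHS]big_seq; apply: eq_bigr => x xw.
by rewrite word_type_r; apply: ln_ratio; [exact: map_f|rewrite size_map].
Qed.

(** The factors [size w] cancel in the quotients, so [g_dim] at the frequencies of [w] is computed
    from total entropies and contractions. *)
Lemma word_type_g1 : contraction a (unzip1 w) <= contraction b (unzip2 w) ->
  g_dim A (word_type w) a b = word_entropy (unzip1 w) / contraction a (unzip1 w) +
    (word_entropy w - word_entropy (unzip1 w)) / contraction b (unzip2 w).
Proof.
move=> ab; rewrite /g_dim word_type_lambda1 word_type_lambda2.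
rewrite ler_pM2r ?invr_gt0 // lerN2 ab /g1.
rewrite word_type_lambda1 word_type_lambda2 word_type_ent word_type_ent1.
by rewrite -mulrBl -opprD !frac_opp.
Qed.

Lemma word_type_g2 : contraction b (unzip2 w) <= contraction a (unzip1 w) ->
  g_dim A (word_type w) a b = word_entropy (unzip2 w) / contraction b (unzip2 w) +
    (word_entropy w - word_entropy (unzip2 w)) / contraction a (unzip1 w).
Proof.
(* At equality [g_dim] takes the branch [g1]; both formulas are then the full entropy over the
   common contraction. *)
move=> ba; have [ab|ab] := leP (contraction a (unzip1 w)) (contraction b (unzip2 w)).
  rewrite word_type_g1 //; have -> : contraction b (unzip2 w) = contraction a (unzip1 w).
    by apply/eqP; rewrite eq_le ab ba.
  by rewrite -!mulrDl !subrKC.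
rewrite /g_dim word_type_lambda1 word_type_lambda2.
rewrite ler_pM2r ?invr_gt0 // lerN2 leNgt ab /= /g2.
rewrite word_type_lambda1 word_type_lambda2 word_type_ent word_type_ent2.
by rewrite -mulrBl -opprD !frac_opp.
Qed.

End fixed_word.
End word_type.

(** * Summability of entropy weights over all words *)

Section word_sums.
Context {R : realType}.

Lemma ler_sum_uniq (T : finType) (r : seq T) (phi : T -> R) :
  uniq r -> (forall x, 0 <= phi x) -> \sum_(x <- r) phi x <= \sum_x phi x.
Proof.
move=> ur phi0; rewrite big_uniq //= [leRHS](bigID (mem r)) /=.
by rewrite -[leLHS]addr0 lerD2l sumr_ge0.
Qed.

Lemma ler_sum_words (A : finType) (r : seq (seq A)) (phi : seq A -> R) :
  uniq r -> (forall w, 0 <= phi w) -> exists L,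
  \sum_(w <- r) phi w <= \sum_(n < L) \sum_(w : n.-tuple A) phi w.
Proof.
move=> ur phi0; exists (\max_(w <- r) size w).+1; set L := _.+1.
have sL w : w \in r -> (size w < L)%N.
  by move=> wr; rewrite ltnS; exact: leq_bigmax_seq.
have -> : \sum_(w <- r) phi w =
    \sum_(n < L) \sum_(w <- r | size w == n) phi w.
  rewrite (exchange_big_dep predT) //= big_seq [RHS]big_seq.
  apply: eq_bigr => w wr; rewrite (bigD1 (Ordinal (sL w wr))) //=.
  by rewrite big1 ?addr0 // => n /andP[/eqP wn /eqP]; case; exact: val_inj.
apply: ler_sum => n _; rewrite -big_filter.
set r' := [seq w <- r | size w == n].
have ur' : uniq r' by exact: filter_uniq.
have -> : r' = map val (pmap (insub : seq A -> option (n.-tuple A)) r').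
  rewrite pmap_filter; last by move=> w /=; case: insubP.
  by apply/esym/all_filterP/allP => w; rewrite mem_filter => /andP[wn _]; rewrite insubT.
rewrite big_map; apply: ler_sum_uniq => //.
exact: pmap_sub_uniq.
Qed.

Lemma geometric_bound (x : R) L : 0 <= x < 1 -> \sum_(n < L) x ^+ n <= (1 - x)^-1.
Proof.
move=> /andP[x0 x1]; rewrite -[leRHS]mul1r ler_pdivlMr ?subr_gt0 //.
rewrite mulrC -opprB mulNr -subrX1 opprB lerBlDr lerDl; exact: exprn_ge0.
Qed.

(** After a root of order [P] it remains to see that [1 + n] is at most
    [(1 + P / eta) * (1 + eta * n / P)], whose last factor is at most an exponential. *)
Lemma ler_poly_exp (P n : nat) (eta : R) : 0 < eta ->
  (n.+1 ^ P)%:R <= (1 + P%:R / eta) ^+ P * expR (eta * n%:R).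
Proof.
move=> eta0; case: P => [|P]; first 
  by rewrite expn0 expr0 mul1r -expR0 ler_expR mulr_ge0 // ltW.
have -> : expR (eta * n%:R) = expR (eta * n%:R / P.+1%:R) ^+ P.+1.
  by rewrite -expRM_natl [in RHS]mulrC divfK // pnatr_eq0.
rewrite natrX -exprMn lerXn2r ?nnegrE //.
  by rewrite mulr_ge0 ?expR_ge0 // addr_ge0 // divr_ge0 // ltW.
apply: (@le_trans _ _ ((1 + P.+1%:R / eta) * (1 + eta * n%:R / P.+1%:R))).
  have -> : (1 + P.+1%:R / eta) * (1 + eta * n%:R / P.+1%:R) =
      (1 + n%:R) + (P.+1%:R / eta + eta * n%:R / P.+1%:R).
    move: (P.+1%:R) (pnatr_eq0 R P.+1) => p /= /negbT p0.
    by field; rewrite p0 gt_eqF.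
  by rewrite nat1r lerDl addr_ge0 // divr_ge0 // ?mulr_ge0 // ltW.
apply: ler_wpM2l; first by rewrite addr_ge0 // divr_ge0 // ltW.
exact: expR_ge1Dx.
Qed.

(** One half of [eta] beats the polynomial number of count vectors, the other half leaves a
    geometric series over the lengths. *)
Lemma word_weights_summable (A : finType) (eta : R) : 0 < eta ->
  exists2 Z : R, 0 <= Z & forall r : seq (seq A), uniq r ->
    \sum_(w <- r) expR (- word_entropy w - eta * (size w)%:R) <= Z.
Proof.
move=> eta0; pose P := #|A|.
pose C := (1 + P%:R / (eta / 2)) ^+ P.
have C0 : 0 <= C.
  by rewrite exprn_ge0 // addr_ge0 // divr_ge0 // divr_ge0 // ltW.
pose x := expR (- (eta / 2)).
have x01 : 0 <= x < 1 by rewrite expR_ge0 expR_lt1 /=; lra.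
exists (C * (1 - x)^-1).
  by rewrite mulr_ge0 // invr_ge0; lra.
move=> r ur.
have [L hL] := ler_sum_words ur
  (fun w => expR_ge0 (- word_entropy w - eta * (size w)%:R)).
apply: le_trans hL _.
apply: (@le_trans _ _ (\sum_(n < L) C * x ^+ n)); last first.
  by rewrite -mulr_sumr ler_wpM2l // geometric_bound.
apply: ler_sum => n _.
have -> : \sum_(w : n.-tuple A) expR (- word_entropy w - eta * (size w)%:R) =
    expR (- (eta * n%:R)) * \sum_(w : n.-tuple A) expR (- word_entropy w).
  by rewrite mulr_sumr; apply: eq_bigr => w _; rewrite size_tuple expRD mulrC.
apply: (@le_trans _ _ (expR (- (eta * n%:R)) * (C * expR (eta / 2 * n%:R)))).
  rewrite ler_wpM2l ?expR_ge0 //; apply: le_trans (word_entropy_kraft _ _) _.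
  by apply: ler_poly_exp; lra.
rewrite mulrCA -expRD -expRM_natl ler_wpM2l // ler_expR; lra.
Qed.

Lemma ler_sum_pairs (T1 T2 : eqType) (r : seq (T1 * T2))
    (phi : T1 -> R) (psi : T2 -> R) Z1 Z2 :
  uniq r -> (forall x, 0 <= phi x) -> (forall x, 0 <= psi x) ->
  (forall r1, uniq r1 -> \sum_(x <- r1) phi x <= Z1) ->
  (forall r2, uniq r2 -> \sum_(x <- r2) psi x <= Z2) ->
  \sum_(x <- r) phi x.1 * psi x.2 <= Z1 * Z2.
Proof.
move=> ur phi0 psi0 h1 h2.
pose r1 := undup (unzip1 r); pose r2 := undup (unzip2 r).
have s1 := h1 r1 (undup_uniq _); have s2 := h2 r2 (undup_uniq _).
apply: (@le_trans _ _ ((\sum_(x <- r1) phi x) * \sum_(x <- r2) psi x)); last first.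
  by apply: ler_pM => //; apply: sumr_ge0.
have -> : (\sum_(x <- r1) phi x) * (\sum_(x <- r2) psi x) =
    \sum_(x <- [seq (x, y) | x <- r1, y <- r2]) phi x.1 * psi x.2.
  by rewrite big_distrlr big_allpairs_dep.
have -> : \sum_(x <- r) phi x.1 * psi x.2 =
    \sum_(x <- [seq (x, y) | x <- r1, y <- r2] | x \in r) phi x.1 * psi x.2.
  rewrite -[RHS]big_filter; apply: perm_big; apply: uniq_perm => //.
    by rewrite filter_uniq // allpairs_uniq ?undup_uniq // => -[? ?] [? ?].
  move=> [x y]; rewrite mem_filter; case xr: ((x, y) \in r) => //=.
  apply/esym/allpairsP; exists (x, y); rewrite /= !mem_undup.
  by split=> //; apply/mapP; exists (x, y).
rewrite [leRHS](bigID (mem r)) /= lerDl; apply: sumr_ge0 => x _.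
exact: mulr_ge0.
Qed.

End word_sums.

(** * Upper bound for the dimension *)

Section hausdorff_upper.
Context {R : realType}.

Lemma ediam_ge0 (E : set (R * R)) : E !=set0 -> (0 <= ediam E)%E.
Proof.
move=> [z Ez]; apply: ereal_sup_ubound; exists z => //; exists z => //.
by congr _%:E; rewrite /Defs.edist !subrr expr0n /= addr0 sqrtr0.
Qed.

Lemma edist_le_coord (z w : R * R) (d : R) :
  `|z.1 - w.1| <= d -> `|z.2 - w.2| <= d -> Defs.edist z w <= 2 * d.
Proof.
move=> h1 h2; have d0 : 0 <= d by exact: le_trans h1.
rewrite /Defs.edist -[leRHS]ger0_norm ?mulr_ge0 // -sqrtr_sqr ler_wsqrtr //.
rewrite -[(z.1 - w.1) ^+ 2]real_normK ?num_real // -[(z.2 - w.2) ^+ 2]real_normK ?num_real //.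
apply: (@le_trans _ _ (d ^+ 2 + d ^+ 2)).
  by apply: lerD; rewrite lerXn2r ?nnegrE.
rewrite exprMn; have := sqr_ge0 d; lra.
Qed.

Lemma ediam_le (E : set (R * R)) (d : R) :
  (forall z w, E z -> E w -> `|z.1 - w.1| <= d /\ `|z.2 - w.2| <= d) ->
  (ediam E <= (2 * d)%:E)%E.
Proof.
move=> h; apply: ge_ereal_sup => _ [z Ez [w Ew <-]].
by rewrite lee_fin; have [h1 h2] := h z w Ez Ew; exact: edist_le_coord.
Qed.

Lemma diam_pow_ge0 (t : R) (E : set (R * R)) : (0 <= diam_pow t E)%E.
Proof. by rewrite /diam_pow; case: ifP => // _; exact: poweR_ge0. Qed.

Lemma diam_pow_set0 (t : R) : diam_pow t (set0 : set (R * R)) = 0%E.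
Proof. by rewrite /diam_pow; case: asboolP. Qed.

Lemma diam_pow_le (t d : R) (E : set (R * R)) : 0 <= t -> 0 <= d ->
  (ediam E <= d%:E)%E -> (diam_pow t E <= (d `^ t)%:E)%E.
Proof.
move=> t0 d0 h; rewrite /diam_pow; case: asboolP => [_|/eqP/set0P E0].
  by rewrite lee_fin powR_ge0.
have := ediam_ge0 E0; case: (ediam E) h => [r||] //=; rewrite !lee_fin => h r0.
by rewrite ge0_ler_powR ?nnegrE.
Qed.

(** Lets a cover be indexed by any countable type: pickling enumerates it, and the numbers that code
    nothing get the empty set, which costs 0. Bounding finite sums over lists without repetition is
    then enough. *)
Lemma hausdorff_premeasure_le (T : countType) (Q : T -> set (R * R))
    (wt : T -> R) (delta t M : R) (E : set (R * R)) :
  (forall x, (diam_pow t (Q x) <= (wt x)%:E)%E) ->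
  (forall x, (ediam (Q x) <= delta%:E)%E) ->
  E `<=` \bigcup_x Q x ->
  (forall r, uniq r -> \sum_(x <- r) wt x <= M) ->
  (hausdorff_premeasure delta t E <= M%:E)%E.
Proof.
move=> hwt hQ EQ hM.
pose U n := oapp Q set0 (@pickle_inv T n).
apply: (@le_trans _ _ (\sum_(0 <= k <oo) diam_pow t (U k))%E).
  apply: ereal_inf_lbound; exists U => //; split.
    move=> z /EQ[x _ Qz]; exists (pickle x) => //.
    by rewrite /U pickleK_inv.
  move=> k; rewrite /U; case: pickle_inv => [x|] /=; first exact: hQ.
  by rewrite /ediam; apply: ge_ereal_sup => _ [z []].
apply: lime_le; first by apply: is_cvg_nneseries => n _ _; exact: diam_pow_ge0.
apply: nearW => n; rewrite big_mkord.
apply: (@le_trans _ _ (\sum_(x <- pmap (@pickle_inv T) (iota 0 n)) (wt x)%:E)%E).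
  rewrite -(big_mkord xpredT (fun k => diam_pow t (U k))) /index_iota subn0.
  elim: (iota 0 n) => [|k l IH]; first by rewrite !big_nil.
  rewrite big_cons /= {1}/U; case: (@pickle_inv T k) => [x|] /=.
    by rewrite big_cons leeD.
  by rewrite diam_pow_set0 add0e.
rewrite sumEFin lee_fin; apply: hM.
apply: (@pmap_uniq _ _ _ (@pickle T)); last exact: iota_uniq.
exact: pickle_invK.
Qed.

Lemma hausdorff_premeasure_ge0 (delta t : R) (E : set (R * R)) :
  (0 <= hausdorff_premeasure delta t E)%E.
Proof.
apply: le_ereal_inf_tmp => _ [U _ <-].
by apply: nneseries_ge0 => n _ _; exact: diam_pow_ge0.
Qed.

Lemma hausdorff_measure_eq0 (t : R) (E : set (R * R)) :
  (forall delta M : R, 0 < delta -> 0 < M ->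
    (hausdorff_premeasure delta t E <= M%:E)%E) ->
  hausdorff_measure t E = 0%E.
Proof.
move=> h; apply/eqP; rewrite eq_le; apply/andP; split; last first.
  apply: (@le_trans _ _ (hausdorff_premeasure 1 t E)).
    exact: hausdorff_premeasure_ge0.
  by apply: ereal_sup_ubound; exists 1 => //=.
apply: ge_ereal_sup => _ [delta /= delta0 <-].
by apply/lee_addgt0Pr => M M0; rewrite add0e; exact: h.
Qed.

Lemma dimH_ge0 (E : set (R * R)) : (0 <= dimH E)%E.
Proof. by apply: le_ereal_inf_tmp => _ [s [s0 _] <-]; rewrite lee_fin. Qed.

Lemma dimH_le (E : set (R * R)) (t : R) : 0 <= t ->
  hausdorff_measure t E = 0%E -> (dimH E <= t%:E)%E.
Proof. by move=> t0 h; apply: ereal_inf_lbound; exists t. Qed.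

End hausdorff_upper.

Section word_maps.
Context {R : realType}.

Lemma word_map_cat (I T : Type) (f : I -> T -> T) (u v : seq I) x :
  word_map f (u ++ v) x = word_map f u (word_map f v x).
Proof. by elim: u => //= i u ->. Qed.

Lemma word_map_carpet (I J : finType) (f : I -> R -> R) (g : J -> R -> R) w z :
  word_map (carpet_map f g) w z =
  (word_map f (unzip1 w) z.1, word_map g (unzip2 w) z.2).
Proof. by elim: w => [|l w /= ->] //; case: z. Qed.

Variables (I : Type) (f : I -> R -> R) (a : I -> R).
Hypothesis f01 : forall i (x : R), x \in `[0, 1] -> f i x \in `[0, 1].

Lemma word_map01 w x : x \in `[0, 1] -> word_map f w x \in `[0, 1].
Proof. by move=> x01; elim: w => //= i w /f01. Qed.

Hypothesis a0 : forall i, 0 < a i.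
Hypothesis fa : forall i (x y : R), x \in `[0, 1] -> y \in `[0, 1] ->
  `|f i x - f i y| <= a i * `|x - y|.

Lemma word_map_lip w x y : x \in `[0, 1] -> y \in `[0, 1] ->
  `|word_map f w x - word_map f w y| <= expR (- contraction a w) * `|x - y|.
Proof.
move=> x01 y01; elim: w => [|i w IH] /=.
  by rewrite /contraction big_nil oppr0 expR0 mul1r.
rewrite /contraction big_cons -/(contraction a w) opprD opprK expRD lnK ?posrE //.
apply: le_trans (fa _ _ _) _; [exact: word_map01|exact: word_map01|].
by rewrite -mulrA ler_wpM2l // ltW.
Qed.

End word_maps.

Lemma unzip1_cat (S T : Type) (u v : seq (S * T)) :
  unzip1 (u ++ v) = unzip1 u ++ unzip1 v.
Proof. exact: map_cat. Qed.

Lemma unzip2_cat (S T : Type) (u v : seq (S * T)) :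
  unzip2 (u ++ v) = unzip2 u ++ unzip2 v.
Proof. exact: map_cat. Qed.

(** * Efficient covers of the attractor *)

Section attractor_upper.
Context {R : realType} (A1 A2 : finType).
Variables (A : {set A1 * A2}) (F : A1 -> R -> R) (G : A2 -> R -> R).
Variables (a : A1 -> R) (b : A2 -> R) (X : set (R * R)) (s : R).
Hypothesis a01 : forall i, 0 < a i < 1.
Hypothesis b01 : forall j, 0 < b j < 1.
Hypothesis F01 : forall i (x : R), x \in `[0, 1] -> F i x \in `[0, 1].
Hypothesis G01 : forall j (x : R), x \in `[0, 1] -> G j x \in `[0, 1].
Hypothesis Fa : forall i (x y : R), x \in `[0, 1] -> y \in `[0, 1] ->
  `|F i x - F i y| <= a i * `|x - y|.
Hypothesis Gb : forall j (x y : R), x \in `[0, 1] -> y \in `[0, 1] ->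
  `|G j x - G j y| <= b j * `|x - y|.
Hypothesis X01 : X `<=` `[0, 1]%classic `*` `[0, 1]%classic.
Hypothesis X0 : X !=set0.
Hypothesis XS : X `<=` \bigcup_(l in [set` A]) (carpet_map F G l @` X).
Hypothesis gs : forall p, prob_vectors A p -> g_dim A p a b <= s.

(** A point may have several codes; one is built by choosing preimages in [X] step after step. *)
Lemma attractor_code z : X z -> exists omega : nat -> A1 * A2,
  (forall n, omega n \in A) /\
  forall n, exists2 z', X z' & z = word_map (carpet_map F G) (mkseq omega n) z'.
Proof.
move=> Xz; have [l0 _ _] := XS Xz.
have /choice[next nextP] : forall z, exists lz : (A1 * A2) * (R * R), X z ->
    [/\ lz.1 \in A, X lz.2 & z = carpet_map F G lz.1 lz.2].
  move=> z0; have [Xz0|Xz0] := pselect (X z0); last by exists (l0, z0).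
  by have [l lA [z' Xz' zE]] := XS Xz0; exists (l, z').
pose zs n := iter n (snd \o next) z.
have Xzs n : X (zs n) by elim: n => //= n /nextP[].
exists (fun n => (next (zs n)).1); split; first by move=> n; case: (nextP _ (Xzs n)).
move=> n; exists (zs n) => //; elim: n => // n {1}->.
rewrite mkseqS -cats1 word_map_cat; congr (word_map _ _ _).
by case: (nextP _ (Xzs n)).
Qed.

Let K : R := ln #|{: A1 * A2}|%:R.

Section code.
Variables (omega : nat -> A1 * A2) (c0 c1 : R).
Hypothesis omegaA : forall n, omega n \in A.
Hypothesis c00 : 0 < c0.
Hypothesis ac : forall i, c0 <= - ln (a i) <= c1.
Hypothesis bc : forall j, c0 <= - ln (b j) <= c1.

Let w n := mkseq omega n.
Let e n : R := word_entropy (w n).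
Let e1 n : R := word_entropy (unzip1 (w n)).
Let e2 n : R := word_entropy (unzip2 (w n)).
Let S1 n : R := contraction a (unzip1 (w n)).
Let S2 n : R := contraction b (unzip2 (w n)).

Let step1 : step_bounds c0 c1 S1.
Proof.
split; first by rewrite /S1 /contraction big_nil.
move=> n; rewrite /S1 /w mkseqS /unzip1 map_rcons /contraction -cats1 big_cat big_seq1 /=.
by rewrite !lerD2l.
Qed.

Let step2 : step_bounds c0 c1 S2.
Proof.
split; first by rewrite /S2 /contraction big_nil.
move=> n; rewrite /S2 /w mkseqS /unzip2 map_rcons /contraction -cats1 big_cat big_seq1 /=.
by rewrite !lerD2l.
Qed.

Let ent_bounds1 : entropy_bounds K e e1.
Proof.
move=> n; have h := word_entropy_map (R := R) fst (w n); have h' := word_entropy_le (R := R) (w n).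
rewrite size_mkseq in h'; rewrite /e1 word_entropy_ge0 h h' !andbT /=.
by split=> //; exact: le_trans h h'.
Qed.

Let ent_bounds2 : entropy_bounds K e e2.
Proof.
move=> n; have h := word_entropy_map (R := R) snd (w n); have h' := word_entropy_le (R := R) (w n).
rewrite size_mkseq in h'; rewrite /e2 word_entropy_ge0 h h' !andbT /=.
by split=> //; exact: le_trans h h'.
Qed.

Let wA n : {subset w n <= A}.
Proof. by move=> x /mapP[m _ ->]. Qed.

Let ratio1 : ratio_bound e e1 S1 S2 s.
Proof.
move=> n n0 h; rewrite -(word_type_g1 (@wA n)) ?size_mkseq //.
by apply: gs; apply: word_type_prob; rewrite ?size_mkseq //; exact: wA.
Qed.

Let ratio2 : ratio_bound e e2 S2 S1 s.
Proof.
move=> n n0 h; rewrite -(word_type_g2 (@wA n)) ?size_mkseq //.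
by apply: gs; apply: word_type_prob; rewrite ?size_mkseq //; exact: wA.
Qed.

Lemma code_bound_ge0 : 0 <= s.
Proof.
have pos (x y : R) : 0 <= x -> 0 <= y -> 0 <= x / y by exact: divr_ge0.
have S1p : 0 <= S1 1%N.
  by apply: le_trans (step_bounds_ge 1 step1); rewrite mulr1 ltW.
have S2p : 0 <= S2 1%N.
  by apply: le_trans (step_bounds_ge 1 step2); rewrite mulr1 ltW.
have [/andP[a1 _] /andP[a2 _]] := ent_bounds1 1%N.
have [/andP[d1 _] /andP[d2 _]] := ent_bounds2 1%N.
have [h|/ltW h] := leP (S1 1%N) (S2 1%N).
  by apply: le_trans (ratio1 (ltn0Sn 0) h); rewrite addr_ge0 // pos // subr_ge0.
by apply: le_trans (ratio2 (ltn0Sn 0) h); rewrite addr_ge0 // pos // subr_ge0.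
Qed.

(* A triple [(u, v1, v2)] encodes the approximate square coded by [u ++ v1] in
   the first coordinate and by [u ++ v2] in the second; its side is at most
   [exp (- sigma)]. *)
Definition good_triple (eps : R) N (x : seq (A1 * A2) * seq A1 * seq A2) : Prop :=
  let: (u, v1, v2) := x in
  let n := (size u + size v1 + size v2)%N in
  let sigma := Num.min (contraction a (unzip1 u ++ v1)) (contraction b (unzip2 u ++ v2)) in
  [/\ (N <= n)%N, c0 * n%:R <= sigma &
      word_entropy u + word_entropy v1 + word_entropy v2 <= (s + eps) * sigma].

(** An adapted pair gives the triple: [u] is the prefix of length [k], and the letters from [k] to
    [l] appear in one coordinate only. By superadditivity their entropy is at most [e1 l - e1 k] (or
    [e2 l - e2 k]), which is how they enter [adapted]. *)
Lemma code_good (eps : R) N : 0 < eps -> exists x, good_triple eps N x /\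
  exists n1 n2, [/\ unzip1 x.1.1 ++ x.1.2 = unzip1 (w n1) &
                    unzip2 x.1.1 ++ x.2 = unzip2 (w n2)].
Proof.
move=> eps0.
have [k [l [Nl kl ad]]] := adapted_exists N c00 eps0 step1 step2 ent_bounds1
  ent_bounds2 ratio1 ratio2.
pose v := [seq omega i | i <- iota k (l - k)].
have wl : w l = w k ++ v.
  by rewrite /w /v /mkseq -map_cat -[X in iota X (l - k)]add0n -iotaD subnKC.
have sv : size v = (l - k)%N by rewrite size_map size_iota.
case: ad => -[Sle ele].
- exists (w k, unzip1 v, [::]); split; last first.
    by exists l, k; rewrite /= cats0 wl unzip1_cat.
  rewrite /good_triple /= cats0 [size (unzip1 v)]size_map sv size_mkseq addn0 subnKC //.
  have -> : unzip1 (w k) ++ unzip1 v = unzip1 (w l) by rewrite wl unzip1_cat.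
  rewrite -/(S1 l) -/(S2 k) (min_idPl Sle); split => //.
    exact: step_bounds_ge step1.
  rewrite word_entropy_nil addr0; apply: le_trans ele.
  have := word_entropy_cat (unzip1 (w k)) (unzip1 v) (R := R).
  rewrite -unzip1_cat -wl -/(e k) -/(e1 k) -/(e1 l); lra.
- exists (w k, [::], unzip2 v); split; last first.
    by exists k, l; rewrite /= cats0 wl unzip2_cat.
  rewrite /good_triple /= cats0 [size (unzip2 v)]size_map sv size_mkseq addn0 subnKC //.
  have -> : unzip2 (w k) ++ unzip2 v = unzip2 (w l) by rewrite wl unzip2_cat.
  rewrite -/(S2 l) -/(S1 k) (min_idPr Sle); split => //.
    exact: step_bounds_ge step2.
  rewrite word_entropy_nil addr0; apply: le_trans ele.
  have := word_entropy_cat (unzip2 (w k)) (unzip2 v) (R := R).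
  rewrite -unzip2_cat -wl -/(e k) -/(e2 k) -/(e2 l); lra.
Qed.

End code.

(** Images of the whole unit interval are used, so that a rectangle depends on finite words alone
    and countably many of them cover [X]. *)
Definition rectangle (x : seq (A1 * A2) * seq A1 * seq A2) : set (R * R) :=
  [set z | exists2 y, y \in `[0, 1] & z.1 = word_map F (unzip1 x.1.1 ++ x.1.2) y] `&`
  [set z | exists2 y, y \in `[0, 1] & z.2 = word_map G (unzip2 x.1.1 ++ x.2) y].

Lemma ediam_rectangle x :
  (ediam (rectangle x) <= (2 * expR (- Num.min
    (contraction a (unzip1 x.1.1 ++ x.1.2))
    (contraction b (unzip2 x.1.1 ++ x.2))))%:E)%E.
Proof.
have le1 (y y' : R) : y \in `[0, 1] -> y' \in `[0, 1] -> `|y - y'| <= 1.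
  by rewrite !in_itv /= ler_norml => /andP[? ?] /andP[? ?]; apply/andP; split; lra.
apply: ediam_le => z z' [[y1 hy1 ->] [y2 hy2 ->]] [[y1' hy1' ->] [y2' hy2' ->]].
have a0 i : 0 < a i by case/andP: (a01 i).
have b0 j : 0 < b j by case/andP: (b01 j).
split.
  apply: le_trans (word_map_lip F01 a0 Fa _ hy1 hy1') _.
  apply: le_trans (ler_wpM2l (expR_ge0 _) (le1 _ _ hy1 hy1')) _.
  by rewrite mulr1 ler_expR lerN2 ge_min lexx.
apply: le_trans (word_map_lip G01 b0 Gb _ hy2 hy2') _.
apply: le_trans (ler_wpM2l (expR_ge0 _) (le1 _ _ hy2 hy2')) _.
by rewrite mulr1 ler_expR lerN2 ge_min lexx orbT.
Qed.

Lemma dimH_attractor_le : (dimH X <= s%:E)%E.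
Proof.
have la i : 0 < - ln (a i) by rewrite oppr_gt0 ln_lt0.
have lb j : 0 < - ln (b j) by rewrite oppr_gt0 ln_lt0.
have [ca ca0 hca] := fin_pos_lower la.
have [cb cb0 hcb] := fin_pos_lower lb.
have [da hda] := fin_upper (fun i => - ln (a i)).
have [db hdb] := fin_upper (fun j => - ln (b j)).
pose c0 := Num.min ca cb; pose c1 := Num.max da db.
have c00 : 0 < c0 by rewrite lt_min ca0.
have ac i : c0 <= - ln (a i) <= c1 by rewrite ge_min le_max hca hda.
have bc j : c0 <= - ln (b j) <= c1 by rewrite ge_min le_max hcb hdb !orbT.
have s0 : 0 <= s.
  have [z Xz] := X0; have [omega [oA _]] := attractor_code Xz.
  exact: code_bound_ge0 oA c00 ac bc.
(* One half of the excess is spent on finding adapted pairs, the other half on making the sum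
   converge. *)
apply/lee_addgt0Pr => eps' eps'0; rewrite -EFinD.
pose eps := eps' / 2; have eps0 : 0 < eps by rewrite divr_gt0.
have -> : s + eps' = s + eps + eps by rewrite -addrA -splitr.
set t := s + eps + eps; have t0 : 0 <= t by rewrite !addr_ge0 // ltW.
apply: dimH_le => //; apply: hausdorff_measure_eq0 => delta M delta0 M0.
(* For a good triple of total length [n], the spare term [eps * sigma] is at least [2 * eta * n]:
   one [eta * n] makes the weights summable, the other makes their sum as small as [M] through
   [n >= N1]. *)
pose eta := eps * c0 / 2.
have eta0 : 0 < eta by rewrite divr_gt0 // mulr_gt0.
have [Z Z0 hZ] := word_weights_summable (A1 * A2)%type eta0.
have [Z1 Z10 hZ1] := word_weights_summable A1 eta0.
have [Z2 Z20 hZ2] := word_weights_summable A2 eta0.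
pose C := 2 `^ t; have C0 : 0 <= C by exact: powR_ge0.
have [N1 hN1] := expR_small (C * (Z * Z1 * Z2)) eta0 M0.
have [N2 hN2] := expR_small 2 c00 delta0.
pose N := maxn N1 N2.
pose phi (T : finType) (u : seq T) := expR (- word_entropy u - eta * (size u)%:R).
pose wt (x : seq (A1 * A2) * seq A1 * seq A2) :=
  expR (- (eta * N1%:R)) * C * (phi _ x.1.1 * phi _ x.1.2 * phi _ x.2).
(* All triples serve as indices; those that are not good contribute the empty set. *)
pose Q x := if `[< good_triple c0 eps N x >] then rectangle x else set0.
have eQ0 : ediam (set0 : set (R * R)) = -oo%E.
  rewrite /ediam (_ : [set _ | _ in _ & _ in _] = set0) ?ereal_sup0 //.
  by rewrite -subset0 => _ [z []].
apply: (hausdorff_premeasure_le (Q := Q) (wt := wt)).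
- move=> [[u v1] v2]; rewrite /Q; case: asboolP => [[hN hs he]|_]; last first.
    by rewrite diam_pow_set0 lee_fin !mulr_ge0 ?expR_ge0.
  have := ediam_rectangle (u, v1, v2); rewrite /= -/(Num.min _ _).
  set sg := Num.min _ _ in hs he * => hd.
  apply: le_trans (diam_pow_le t0 _ hd) _; first by rewrite mulr_ge0 ?expR_ge0.
  rewrite lee_fin powRM ?expR_ge0 // -/C -expRM /wt /phi /= -!expRD.
  rewrite mulrAC -expRD [leRHS]mulrC ler_wpM2l // ler_expR.
  move: hs he hN; rewrite geq_max => hs he /andP[hN _].
  have hN' : N1%:R <= (size u + size v1 + size v2)%:R :> R by rewrite ler_nat.
  move: hs hN'; rewrite !natrD /t /eta.
  move: (size u)%:R (size v1)%:R (size v2)%:R => x y z hs hN'.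
  have h1 : eps * (c0 * (x + y + z)) <= eps * sg by rewrite ler_pM2l.
  have h2 : eps * c0 * N1%:R <= eps * c0 * (x + y + z) by rewrite ler_pM2l // mulr_gt0.
  lra.
- move=> [[u v1] v2]; rewrite /Q; case: asboolP => [[hN hs he]|_]; last first.
    by rewrite eQ0 leNye.
  have := ediam_rectangle (u, v1, v2); rewrite /=.
  set sg := Num.min _ _ in hs he * => hd.
  apply: le_trans hd _; rewrite lee_fin; apply: le_trans hN2.
  rewrite mulrC ler_wpM2r // ler_expR lerN2; apply: le_trans hs.
  rewrite ler_pM2l // ler_nat; apply: leq_trans hN.
  by rewrite leq_max leqnn orbT.
- move=> z Xz; have [omega [oA oX]] := attractor_code Xz.
  have [x [gx [n1 [n2 [hx1 hx2]]]]] := code_good oA c00 ac bc N eps0.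
  exists x => //; rewrite /Q asboolT //; split.
    have [z' /X01[z1 _] zE] := oX n1.
    by exists z'.1 => //; rewrite hx1 zE word_map_carpet.
  have [z' /X01[_ z2] zE] := oX n2.
  by exists z'.2 => //; rewrite hx2 zE word_map_carpet.
move=> r ur; rewrite /wt -mulr_sumr; apply: le_trans hN1.
rewrite -mulrA ler_wpM2l ?expR_ge0 // ler_wpM2l //.
have phi0 T u : 0 <= phi T u by exact: expR_ge0.
apply: (ler_sum_pairs (phi := fun x => phi _ x.1 * phi _ x.2)) => //.
  by move=> x; rewrite mulr_ge0.
move=> r1 ur1; exact: ler_sum_pairs.
Qed.

End attractor_upper.

(** * Words hitting a small square *)

Section separated.
Context {R : realType}.

(** Pigeonhole: rounding [m x] down to a multiple of [eta], counted from the smallest value, is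
    injective on [S]. *)
Lemma card_separated (T : finType) (S : {set T}) (m : T -> R) (ell eta : R) :
  0 < eta -> 0 <= ell ->
  {in S &, forall x y, `|m x - m y| <= ell} ->
  {in S &, forall x y, x != y -> eta <= `|m x - m y|} ->
  #|S|%:R <= ell / eta + 1.
Proof.
move=> eta0 ell0 hl hs.
have [->|/set0Pn[y Sy]] := eqVneq S finset.set0.
  by rewrite cards0 addr_ge0 // divr_ge0 // ltW.
have [x0 Sx0 minx0] : exists2 x0, x0 \in S & forall x, x \in S -> m x0 <= m x.
  by case: (@arg_minP _ _ _ y (fun x => x \in S) m Sy) => x0; exists x0.
pose q x := Num.truncn ((m x - m x0) / eta).
have q0 x : x \in S -> 0 <= (m x - m x0) / eta.
  by move=> Sx; rewrite divr_ge0 ?subr_ge0 ?minx0 // ltW.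
have inj : {in S &, injective q}.
  move=> x x' Sx Sx' qq; apply/eqP; apply: contraT => /(hs _ _ Sx Sx').
  have /andP[a1 a2] := truncn_itv (q0 x Sx); have /andP[b1 b2] := truncn_itv (q0 x' Sx').
  rewrite -/(q x) in a1 a2; rewrite -/(q x') -qq in b1 b2.
  rewrite leNgt => /negP; case.
  have -> : m x - m x' = ((m x - m x0) / eta - (m x' - m x0) / eta) * eta.
    by rewrite -mulrBl divfK ?gt_eqF // opprB addrA subrK.
  rewrite normrM (gtr0_norm eta0) -[ltRHS]mul1r ltr_pM2r // ltr_norml.
  rewrite -natr1 in a2 b2; apply/andP; split; lra.
have := @uniq_leq_size _ [seq q x | x in S] (iota 0 (Num.truncn (ell / eta)).+1).
rewrite size_map size_iota -cardE map_inj_in_uniq ?enum_uniq //; last first.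
  by move=> x x'; rewrite !mem_enum; exact: inj.
move=> /(_ isT) h.
apply: (@le_trans _ _ (Num.truncn (ell / eta)).+1%:R).
  rewrite ler_nat; apply: h => n /mapP[x]; rewrite mem_enum => Sx ->.
  rewrite mem_iota /= add0n ltnS; apply: le_truncn.
  rewrite ler_pM2r ?invr_gt0 //; apply: le_trans (ler_norm _) _; exact: hl.
by rewrite -natr1 lerD2r truncn_le ?divr_ge0 // ltW.
Qed.

End separated.

Section word_osc.
Context {R : realType} (B : finType) (F : B -> R -> R) (U : set R).
Hypothesis U01 : U `<=` `[0, 1]%classic.
Hypothesis FU : forall i, F i @` U `<=` U.
Hypothesis Fdisj : forall i j, i != j -> F i @` U `&` F j @` U = set0.
Hypothesis Finj : forall i (x y : R), x \in `[0, 1] -> y \in `[0, 1] ->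
  F i x = F i y -> x = y.

Lemma word_map_U w x : U x -> U (word_map F w x).
Proof. by move=> Ux; elim: w => //= i w IH; apply: (FU (i := i)); exists (word_map F w x). Qed.

(** Injectivity on [0,1] peels off the common prefix; at the first difference the open set condition
    separates the images of [U]. *)
Lemma word_map_disjoint w w' x x' : size w = size w' -> U x -> U x' ->
  word_map F w x = word_map F w' x' -> w = w'.
Proof.
move=> + Ux Ux'; elim: w w' => [|i w IH] [|j w'] //= [sw] h.
have [ij|ij] := eqVneq i j; last first.
  have : (F i @` U `&` F j @` U) (F i (word_map F w x)).
    by split; [exists (word_map F w x)|exists (word_map F w' x')] => //;
       exact: word_map_U.
  by rewrite Fdisj.
rewrite -ij in h *; congr cons; apply: IH => //.
exact: Finj (U01 (word_map_U w Ux)) (U01 (word_map_U w' Ux')) h.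
Qed.

End word_osc.

Section hits.
Context {R : realType} (B : finType) (F : B -> R -> R) (lo hi : R) (U : set R).
Hypothesis F01 : forall i (x : R), x \in `[0, 1] -> F i x \in `[0, 1].
Hypothesis lo0 : 0 < lo.
Hypothesis lohi : lo <= hi.
Hypothesis hi1 : hi < 1.
Hypothesis Flip : forall i (x y : R), x \in `[0, 1] -> y \in `[0, 1] ->
  lo * `|x - y| <= `|F i x - F i y| <= hi * `|x - y|.
Hypothesis U0 : U !=set0.
Hypothesis Uo : open U.
Hypothesis U01 : U `<=` `[0, 1]%classic.
Hypothesis FU : forall i, F i @` U `<=` U.
Hypothesis Fdisj : forall i j, i != j -> F i @` U `&` F j @` U = set0.

Definition meets (w : seq B) (V : set R) : Prop :=
  exists2 y : R, y \in `[0, 1] & V (word_map F w y).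

Definition hits l (V : set R) : {set l.-tuple B} :=
  [set w : l.-tuple B | `[< meets w V >]]%SET.

Let w01 w (x : R) : x \in `[0, 1] -> word_map F w x \in `[0, 1].
Proof. exact: word_map01. Qed.

Let hi0 : 0 < hi. Proof. exact: lt_le_trans lohi. Qed.

Lemma word_map_bounds w (x y : R) : x \in `[0, 1] -> y \in `[0, 1] ->
  lo ^+ size w * `|x - y| <= `|word_map F w x - word_map F w y| <= hi ^+ size w * `|x - y|.
Proof.
move=> x01 y01; elim: w => [|i w /andP[IH1 IH2]] /=; first by rewrite !mul1r lexx.
have /andP[h1 h2] := Flip i (w01 w x01) (w01 w y01).
rewrite !exprS -!mulrA; apply/andP; split.
  by apply: le_trans h1; rewrite ler_pM2l.
by apply: le_trans h2 _; rewrite ler_pM2l.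
Qed.

Let Finj i (x y : R) : x \in `[0, 1] -> y \in `[0, 1] -> F i x = F i y -> x = y.
Proof.
move=> x01 y01 h; have /andP[+ _] := Flip i x01 y01.
by rewrite h subrr normr0 pmulr_rle0 // normr_le0 subr_eq0 => /eqP.
Qed.

(** The set [U] contains an interval [u, v]. Its images under words of length [l] are disjoint
    intervals, and each has length at least [lo ^+ l * (v - u)], so few of them fit near [V]. *)
Lemma hits_card : exists2 C : R, 0 < C & forall l (r : R) (V : set R),
  hi ^+ l <= r -> (forall x y, V x -> V y -> `|x - y| <= r) ->
  #|hits l V|%:R <= 1 + C * r / lo ^+ l.
Proof.
have [u Uu] := U0.
have /nbhs_ballP[d /= d0 hd] : nbhs u U by apply: open_nbhs_nbhs.
pose v := u + d / 2.
have Uuv x : x \in `[u, v] -> U x.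
  rewrite in_itv /= => /andP[ux xv]; apply: hd; rewrite /ball /= distrC ger0_norm ?subr_ge0 //.
  by rewrite /v in xv; lra.
have uv : u < v by rewrite /v ltrDl divr_gt0.
have Uv : U v by apply: Uuv; rewrite in_itv /= lexx ltW.
(* The left ends of the images spread over at most [3 * r]: one [r] for [V] and one for each of the
   two images being compared. *)
exists (3 / (v - u)); first by rewrite divr_gt0 // subr_gt0.
move=> l r V hr hV.
have r0 : 0 <= r by apply: le_trans hr; rewrite exprn_ge0 // ltW.
pose m (w : l.-tuple B) := Num.min (word_map F w u) (word_map F w v).
pose M (w : l.-tuple B) := Num.max (word_map F w u) (word_map F w v).
pose eta := lo ^+ l * (v - u).
have eta0 : 0 < eta by rewrite mulr_gt0 ?exprn_gt0 // subr_gt0.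
have mM w : eta <= M w - m w.
  have /andP[+ _] := word_map_bounds w (U01 Uu) (U01 Uv).
  rewrite size_tuple [X in _ * X <= _]distrC (gtr0_norm (_ : 0 < v - u)) ?subr_gt0 //.
  move=> /le_trans; apply; rewrite /M /m.
  by case: (leP (word_map F w u)) => h;
    [rewrite distrC ger0_norm ?subr_ge0|rewrite gtr0_norm ?subr_gt0].
have ivt w c : m w <= c <= M w -> exists2 x, U x & word_map F w x = c.
  move=> hc; have cont : {within `[u, v], continuous (word_map F w)}.
    apply: (hoelder_within_continuous (al := 1) (C := 1)) => // x y xuv yuv.
    have /andP[_ h] := word_map_bounds w (U01 (Uuv _ xuv)) (U01 (Uuv _ yuv)).
    apply: le_trans h _; rewrite powRr1 // ler_wpM2r // exprn_ile1 // ?ltW //.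
  by have [x xuv xc] := IVT (ltW uv) cont hc; exists x => //; exact: Uuv.
have m01 w : exists2 x, x \in `[0, 1] & m w = word_map F w x.
  by rewrite /m; case: leP => _; [exists u|exists v] => //; exact: U01.
have -> : 1 + 3 / (v - u) * r / lo ^+ l = 3 * r / eta + 1.
  by rewrite /eta addrC invfM; ring.
apply: (card_separated (m := m)) => //; first by rewrite mulr_ge0.
  move=> w w'; rewrite /hits !finset.inE => /asboolP[y y01 Vy] /asboolP[y' y'01 Vy'].
  have le1 (p q : R) : p \in `[0, 1] -> q \in `[0, 1] -> `|p - q| <= 1.
    by rewrite !in_itv /= ler_norml => /andP[? ?] /andP[? ?]; apply/andP; split; lra.
  have close (t : l.-tuple B) p q : p \in `[0, 1] -> q \in `[0, 1] ->
      `|word_map F t p - word_map F t q| <= r.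
    move=> p01 q01; have /andP[_ h] := word_map_bounds t p01 q01.
    apply: le_trans h _; rewrite size_tuple; apply: le_trans hr.
    by rewrite -[leRHS]mulr1 ler_wpM2l ?le1 // exprn_ge0 // ltW.
  have [x x01 ->] := m01 w; have [x' x'01 ->] := m01 w'.
  have h1 := close w _ _ x01 y01; have h2 := close w' _ _ y'01 x'01.
  have h3 := hV _ _ Vy Vy'.
  move: h1 h2 h3; rewrite !ler_norml => /andP[? ?] /andP[? ?] /andP[? ?].
  apply/andP; split; lra.
(* Otherwise the left end of the image of [u, v] under [w'] would lie in that under [w], and the two
   words would share a value on [U]. *)
have sep w w' : w != w' -> m w <= m w' -> eta <= m w' - m w.
  move=> ww' mm; rewrite leNgt; apply/negP => lt.
  have [x Ux hx] : exists2 x, U x & word_map F w x = m w'.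
    by apply: ivt; rewrite mm /=; have := mM w; lra.
  have [x' Ux' hx'] : exists2 x, U x & word_map F w' x = m w'.
    by apply: ivt; rewrite lexx /=; have := mM w'; lra.
  case/eqP: ww'; apply: val_inj; apply: (word_map_disjoint U01 FU Fdisj Finj _ Ux Ux').
    by rewrite !size_tuple.
  by rewrite hx.
move=> w w' _ _ ww'; have [h|h] := leP (m w) (m w').
  by rewrite distrC ger0_norm ?subr_ge0 // sep.
by rewrite gtr0_norm ?subr_gt0 // sep 1?eq_sym // ltW.
Qed.

End hits.

(** * Counting words by their two coordinates *)

Section two_coordinates.
Context {R : realType} (T B1 B2 : finType).
Variables (kap1 : T -> B1) (kap2 : T -> B2).
Hypothesis kap_inj : forall t t', kap1 t = kap1 t' -> kap2 t = kap2 t' -> t = t'.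
Variable Phi : R.
Hypothesis Phi1 : 1 <= Phi.
Hypothesis fib1 : forall b, #|[set t | kap1 t == b]%SET|%:R <= Phi.

(** Both coordinates are prescribed at the first [k] positions, which leaves one letter there; each
    later position leaves at most [Phi]. *)
Lemma prefix_fiber_card l k (w : l.-tuple B1) (v : k.-tuple B2) : (k <= l)%N ->
  #|[set t : l.-tuple T | (map kap1 t == w) && (map kap2 (take k t) == v)]%SET|%:R
    <= Phi ^+ (l - k).
Proof.
move=> kl; set E := [set t | _]%SET.
have [->|/set0Pn[t0 t0E]] := eqVneq E finset.set0.
  by rewrite cards0 exprn_ge0 // (le_trans ler01).
(* The second coordinates are read off a fixed element [t0] of the fibre, which has an entry at
   every index below [l]. The indicator of the fibre is then bounded by a product over positions,
   and the sum factorises. *)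
pose q (i : 'I_l) (x : T) : R :=
  ((kap1 x == tnth w i) && ((i < k)%N ==> (kap2 x == kap2 (tnth t0 i))))%:R.
apply: (@le_trans _ _ (\sum_(t : l.-tuple T) \prod_(i < l) q i (tnth t i))).
  rewrite -sum1_card natr_sum big_mkcond /=; apply: ler_sum => t _.
  case: ifP => tE; last by apply: prodr_ge0 => i _.
  rewrite big1 // => i _; rewrite /q.
  move: tE t0E; rewrite !finset.inE => /andP[/eqP tw /eqP tv] /andP[_ /eqP t0v].
  have -> : kap1 (tnth t i) == tnth w i.
    by rewrite (tnth_nth (tnth w i) w) -tw (nth_map (tnth t i)) ?size_tuple // -tnth_nth.
  have [ik|//] := ltnP i k; rewrite /=.
  have := congr1 (fun u => nth (kap2 (tnth t0 i)) u i) (etrans tv (esym t0v)).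
  rewrite !(nth_map (tnth t0 i)) ?size_takel ?size_tuple // !nth_take // -!tnth_nth.
  by move=> ->; rewrite eqxx.
rewrite sum_tuple_prod.
apply: (@le_trans _ _ (\prod_(i < l) if (i < k)%N then 1 else Phi)).
  apply: ler_prod => i _; rewrite sumr_ge0 //=.
  rewrite /q sum_bool_card.
  have [ik|ik] /= := ltnP i k; last first.
    apply: le_trans (fib1 (tnth w i)); rewrite ler_nat subset_leq_card //.
    by apply/fintype.subsetP => x; rewrite finset.inE unfold_in => /andP[].
  rewrite -[leRHS]/(1%:R) ler_nat; apply/card_le1_eqP => x y.
  rewrite !unfold_in => /andP[/eqP x1 /eqP x2] /andP[/eqP y1 /eqP y2].
  by apply: kap_inj; rewrite ?x1 ?x2 ?y1 ?y2.
rewrite le_eqVlt; apply/orP; left; apply/eqP.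
rewrite -(big_mkord xpredT (fun i => if (i < k)%N then 1 else Phi)).
rewrite (big_cat_nat (leq0n k) kl) /= big_nat big1 ?mul1r; last by move=> i /andP[_ ->].
rewrite big_nat (eq_bigr (fun=> Phi)); last by move=> i /andP[ki _]; rewrite ltnNge ki.
by rewrite -big_nat prodr_const_nat.
Qed.

(* A square of side [r] determines the first letters up to the level [l] where
   the first maps contract by [r], but the second letters only up to the level
   [k <= l]; each of the remaining letters has at most [Phi] choices. *)
Lemma prefix_hits_card l k (S1 : {set l.-tuple B1}) (S2 : {set k.-tuple B2})
    (E : {set l.-tuple T}) : (k <= l)%N ->
  (forall t, t \in E -> exists w v, [/\ w \in S1, v \in S2,
     map kap1 t = w & map kap2 (take k t) = v]) ->
  #|E|%:R <= #|S1|%:R * #|S2|%:R * Phi ^+ (l - k).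
Proof.
move=> kl hE.
pose P (t : l.-tuple T) (w : l.-tuple B1) (v : k.-tuple B2) :=
  (map kap1 t == w) && (map kap2 (take k t) == v).
apply: (@le_trans _ _ (\sum_(t : l.-tuple T) \sum_(w in S1) \sum_(v in S2) (P t w v)%:R)).
  rewrite -sum1_card natr_sum big_mkcond /=; apply: ler_sum => t _.
  case: ifP => [/hE[w [v [wS vS tw tv]]]|_]; last first.
    by apply: sumr_ge0 => w _; apply: sumr_ge0.
  rewrite (bigD1 w) //= (bigD1 v) //= /P tw tv !eqxx -addrA lerDl addr_ge0 //.
    exact: sumr_ge0.
  by apply: sumr_ge0 => w' _; apply: sumr_ge0.
rewrite exchange_big /= -mulrA mulr_natl -sumr_const; apply: ler_sum => w _.
rewrite exchange_big /= mulr_natl -sumr_const; apply: ler_sum => v _.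
apply: le_trans (prefix_fiber_card w v kl); rewrite sum_bool_card ler_nat.
by apply: subset_leq_card; apply/fintype.subsetP => t; rewrite finset.inE unfold_in.
Qed.

End two_coordinates.

Section hitting_numbers.
Context {R : realType}.

Lemma geometric_level (h r : R) : 0 < h < 1 -> 0 < r <= 1 ->
  exists l, [/\ h ^+ l <= r, h * r <= h ^+ l & forall n, h ^+ n <= r -> (l <= n)%N].
Proof.
move=> /andP[h0 h1] /andP[r0 r1].
have lnh : 0 < - ln h by rewrite oppr_gt0 ln_lt0 // h0 h1.
have ex : exists n, h ^+ n <= r.
  have [n hn] := expR_small 1 lnh r0; exists n.
  by rewrite -(lnK (h0 : h \is Num.pos)) -expRM_natr -[ln h]opprK mulNr -[leLHS]mulr1.
case: (ex_minnP ex) => l hl hmin; exists l; split=> //.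
(* At level 0 the lower bound comes from [r <= 1]; at a later level it comes from minimality. *)
case: l hl hmin => [_ _|l hl hmin].
  by rewrite expr0 mulr_ile1 // ltW.
rewrite exprS ler_pM2l //; rewrite leNgt; apply/negP => /ltW /hmin.
by rewrite ltnn.
Qed.

(** At the level where [hi ^+ l] is about [r], the spread of the ratios costs a factor [hi / lo] per
    letter; this power is at least 1 and absorbs the summand 1. *)
Lemma count_level (lo hi C r : R) l : 0 < lo -> lo <= hi -> 0 < C ->
  hi * r <= hi ^+ l ->
  1 + C * r / lo ^+ l <= (1 + C / hi) * expR (l%:R * - ln (lo / hi)).
Proof.
move=> lo0 lohi C0 hr; have hi0 : 0 < hi by exact: lt_le_trans lohi.
have q0 : 0 < hi / lo by rewrite divr_gt0.
have -> : expR (l%:R * - ln (lo / hi)) = (hi / lo) ^+ l.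
  by rewrite -lnV ?posrE ?divr_gt0 // invf_div expRM_natl lnK.
have q1 : 1 <= (hi / lo) ^+ l by rewrite exprn_ege1 // ler_pdivlMr // mul1r.
rewrite mulrDl mul1r; apply: lerD => //.
rewrite -!mulrA ler_pM2l // exprMn mulrA exprVn ler_pM2r ?invr_gt0 ?exprn_gt0 //.
by rewrite ler_pdivlMl.
Qed.

(** With [P = - ln r], the level is [P / x] up to one unit, so a term linear in the level becomes a
    power of [r] up to a bounded factor. *)
Lemma exponent_level (x P : R) (l : nat) (E : R) : 0 < x -> P <= l%:R * x <= P + x ->
  - (E * l%:R) <= - (E / x * P) + `|E|.
Proof.
move=> x0 /andP[h1 h2].
have -> : E * l%:R = E / x * (l%:R * x) by field; rewrite gt_eqF.
have -> : `|E| = `|E / x| * x by rewrite normrM normfV (gtr0_norm x0) divfK // gt_eqF.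
rewrite -lerBlDl opprK addrC -mulrBr.
have d0 : 0 <= l%:R * x - P by lra.
apply: le_trans (ler_norm _) _.
rewrite normrM ler_wpM2l // -normrN opprB ger0_norm //; lra.
Qed.

End hitting_numbers.

Section hitting_bound.
Context {R : realType} (T B1 B2 : finType).
Variables (kap1 : T -> B1) (kap2 : T -> B2).
Hypothesis kap_inj : forall t t', kap1 t = kap1 t' -> kap2 t = kap2 t' -> t = t'.
Variable Phi : R.
Hypothesis Phi1 : 1 <= Phi.
Hypothesis fib1 : forall b, #|[set t | kap1 t == b]%SET|%:R <= Phi.
Hypothesis T0 : (0 < #|T|)%N.
Variables (F1 : B1 -> R -> R) (F2 : B2 -> R -> R) (lo1 hi1 lo2 hi2 : R).
Variables (U1 U2 : set R).

Definition homogeneous_ifs (B : finType) (F : B -> R -> R) (lo hi : R) (U : set R) :=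
  [/\ forall i (x : R), x \in `[0, 1] -> F i x \in `[0, 1],
      [/\ 0 < lo, lo <= hi & hi < 1],
      forall i (x y : R), x \in `[0, 1] -> y \in `[0, 1] ->
        lo * `|x - y| <= `|F i x - F i y| <= hi * `|x - y|,
      [/\ U !=set0, open U & U `<=` `[0, 1]%classic] &
      (forall i, F i @` U `<=` U) /\
      (forall i j, i != j -> F i @` U `&` F j @` U = set0)].

Hypothesis ifs1 : homogeneous_ifs F1 lo1 hi1 U1.
Hypothesis ifs2 : homogeneous_ifs F2 lo2 hi2 U2.
Hypothesis hi21 : hi2 <= hi1.

Definition hitting_words l (V1 V2 : set R) : {set l.-tuple T} :=
  [set t : l.-tuple T | `[< meets F1 (map kap1 t) V1 >] &&
                        `[< meets F2 (map kap2 t) V2 >]]%SET.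

(** When [lo = hi], this is the entropy left after removing the fibres over the contraction in the
    first coordinate, plus the fibre entropy over the contraction in the second: the shape of [g1].
    The logarithms of [lo / hi] are losses. *)
Definition hitting_exponent : R :=
  (ln #|T|%:R + ln (lo1 / hi1) + ln (lo2 / hi2) - ln Phi) / - ln hi1 +
  ln Phi / - ln hi2.

(** The levels [l] and [k] are those at which [hi1] and [hi2] reach the scale [r]; [hi2 <= hi1]
    gives [k <= l]. The count is the product of the hits in each coordinate and of
    [Phi ^+ (l - k)]. *)
Lemma hitting_words_card : exists2 C : R, 0 < C & forall r : R, 0 < r <= 1 ->
  exists l, forall V1 V2 : set R,
  (forall x y, V1 x -> V1 y -> `|x - y| <= r) ->
  (forall x y, V2 x -> V2 y -> `|x - y| <= r) ->
  #|hitting_words l V1 V2|%:R <= C * r `^ hitting_exponent * #|T|%:R ^+ l.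
Proof.
have [F101 [lo10 lohi1 hi11] Flip1 [U10 U1o U101] [FU1 Fdisj1]] := ifs1.
have [F201 [lo20 lohi2 hi21'] Flip2 [U20 U2o U201] [FU2 Fdisj2]] := ifs2.
have hi10 : 0 < hi1 by exact: lt_le_trans lohi1.
have hi20 : 0 < hi2 by exact: lt_le_trans lohi2.
have [C1 C10 hC1] := hits_card F101 lo10 lohi1 hi11 Flip1 U10 U1o U101 FU1 Fdisj1.
have [C2 C20 hC2] := hits_card F201 lo20 lohi2 hi21' Flip2 U20 U2o U201 FU2 Fdisj2.
pose x := - ln hi1; pose y := - ln hi2.
have x0 : 0 < x by rewrite oppr_gt0 ln_lt0 // hi10.
have y0 : 0 < y by rewrite oppr_gt0 ln_lt0 // hi20.
pose u1 := - ln (lo1 / hi1); pose u2 := - ln (lo2 / hi2).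
pose phi := ln Phi; pose tau := ln (#|T|%:R : R).
have Phi0 : 0 < Phi by exact: lt_le_trans ltr01 _.
have T0' : 0 < #|T|%:R :> R by rewrite ltr0n.
pose A := tau - u1 - u2 - phi.
have u20 : 0 <= u2.
  by rewrite oppr_ge0 ln_le0 // ler_pdivrMr // mul1r.
exists ((1 + C1 / hi1) * (1 + C2 / hi2) * expR (`|A| + `|phi|)).
  by rewrite !mulr_gt0 ?expR_gt0 // addr_gt0 // divr_gt0.
move=> r r01; have /andP[r0 r1] := r01.
have hi101 : 0 < hi1 < 1 by rewrite hi10.
have hi201 : 0 < hi2 < 1 by rewrite hi20.
have [l [l1 l2 lmin]] := geometric_level hi101 r01.
have [k [k1 k2 kmin]] := geometric_level hi201 r01.
have kl : (k <= l)%N.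
  by apply: kmin; apply: le_trans l1; rewrite lerXn2r ?nnegrE ?(ltW hi10) ?(ltW hi20).
exists l => V1 V2 hV1 hV2.
have levels h n : 0 < h -> h ^+ n <= r -> h * r <= h ^+ n ->
    - ln r <= n%:R * - ln h <= - ln r + - ln h.
  move=> h0 hn hn'; rewrite mulrN -opprD lerN2 lerN2 mulr_natl -lnXn // addrC -lnM ?posrE //.
  by rewrite !ler_ln ?posrE ?exprn_gt0 ?mulr_gt0 // hn hn'.
have lx := levels _ _ hi10 l1 l2; have ky := levels _ _ hi20 k1 k2.
have cS1 := le_trans (hC1 l r V1 l1 hV1) (count_level lo10 lohi1 C10 l2).
have cS2 := le_trans (hC2 k r V2 k1 hV2) (count_level lo20 lohi2 C20 k2).
have key := prefix_hits_card kap_inj Phi1 fib1 (S1 := hits F1 l V1)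
  (S2 := hits F2 k V2) (E := hitting_words l V1 V2) kl.
apply: le_trans (key _) _.
  (* The image of a word lies in that of its prefix, so a hit at level [l] in the second coordinate
     is also a hit at level [k]. *)
  move=> t; rewrite finset.inE => /andP[m1 /asboolP[z z01 Vz]].
  have sz : size (take k (map kap2 t)) == k by rewrite size_takel // size_map size_tuple.
  exists (map_tuple kap1 t), (Tuple sz); rewrite /= map_take; split=> //.
    by rewrite finset.inE.
  rewrite finset.inE; apply/asboolP.
  exists (word_map F2 (drop k (map kap2 t)) z); first exact: word_map01.
  by rewrite /= -word_map_cat cat_take_drop.
apply: (@le_trans _ _ ((1 + C1 / hi1) * expR (l%:R * u1) *
    ((1 + C2 / hi2) * expR (k%:R * u2)) * Phi ^+ (l - k))).
  rewrite ler_wpM2r ?exprn_ge0 ?(ltW Phi0) //.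
  by apply: ler_pM.
rewrite mulrACA -!mulrA ler_wpM2l ?addr_ge0 ?divr_ge0 ?(ltW C10) ?(ltW hi10) //.
rewrite ler_wpM2l ?addr_ge0 ?divr_ge0 ?(ltW C20) ?(ltW hi20) //.
have -> : Phi ^+ (l - k) = expR ((l%:R - k%:R) * phi).
  by rewrite -natrB // expRM_natl lnK.
have -> : #|T|%:R ^+ l = expR (l%:R * tau) by rewrite expRM_natl lnK.
have -> : r `^ hitting_exponent = expR (hitting_exponent * ln r).
  by rewrite /powR gt_eqF.
rewrite -!expRD ler_expR.
have eA := exponent_level A x0 lx; have ePhi := exponent_level phi y0 ky.
have -> : hitting_exponent = A / x + phi / y.
  by rewrite /hitting_exponent /A /u1 /u2 !opprK.
have kl' : k%:R <= l%:R :> R by rewrite ler_nat.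
(* The loss in the second coordinate occurs only [k] times; counting it [l] times puts it over
   [- ln hi1] with the other losses. *)
have ukl : k%:R * u2 <= l%:R * u2 by rewrite ler_wpM2r.
rewrite mulrDl; rewrite !mulrN in eA ePhi.
move: (A / x) (phi / y) eA ePhi => a b; rewrite /A; nra.
Qed.

End hitting_bound.

(** * Typical blocks *)

Section weak_law.
Context {R : realType} (T : finType) (p : T -> R).
Hypothesis p0 : forall x, 0 <= p x.
Hypothesis p1 : \sum_x p x = 1.

Definition mean (phi : T -> R) : R := \sum_x p x * phi x.

Definition word_prob n (w : n.-tuple T) : R := \prod_(i < n) p (tnth w i).

Lemma word_prob_ge0 n (w : n.-tuple T) : 0 <= word_prob w.
Proof. by apply: prodr_ge0. Qed.

Lemma sum_word_prob n : \sum_(w : n.-tuple T) word_prob w = 1.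
Proof. by rewrite /word_prob (sum_tuple_prod (fun=> p)) big1. Qed.

(** Independence of the letters: a mixed term contains the factor [mean psi], which vanishes. *)
Lemma word_variance n (psi : T -> R) : mean psi = 0 ->
  \sum_(w : n.-tuple T) word_prob w * (\sum_(i < n) psi (tnth w i)) ^+ 2 =
  n%:R * mean (fun x => psi x ^+ 2).
Proof.
move=> psi0.
have cross (i j : 'I_n) :
    \sum_(w : n.-tuple T) word_prob w * (psi (tnth w i) * psi (tnth w j)) =
    if j == i then mean (fun x => psi x ^+ 2) else 0.
  pose q (m : 'I_n) x := p x * ((if m == i then psi x else 1) * (if m == j then psi x else 1)).
  transitivity (\sum_(w : n.-tuple T) \prod_(m < n) q m (tnth w m)).
    apply: eq_bigr => w _; rewrite /q !big_split /=; congr (_ * (_ * _)).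
      by rewrite -big_mkcond big_pred1_eq.
    by rewrite -big_mkcond big_pred1_eq.
  rewrite sum_tuple_prod (bigD1 i) //= /q eqxx.
  have [->|ji] := eqVneq j i.
    rewrite [X in _ * X]big1 ?mulr1.
      by rewrite /mean; apply: eq_bigr => x _; rewrite expr2.
    move=> m /negPf mi; rewrite mi -[RHS]p1; apply: eq_bigr => x _.
    by rewrite !mulr1.
  have -> : \sum_x p x * (psi x * 1) = 0.
    by rewrite -[RHS]psi0; apply: eq_bigr => x _; rewrite mulr1.
  by rewrite mul0r.
under eq_bigr => w _ do rewrite expr2 big_distrlr /= mulr_sumr.
rewrite exchange_big /=.
under eq_bigr => i _ do under eq_bigr => w _ do rewrite mulr_sumr.
under eq_bigr => i _ do rewrite exchange_big /=.
under eq_bigr => i _ do under eq_bigr => j _ do rewrite cross.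
under eq_bigr => i _ do rewrite -big_mkcond big_pred1_eq.
by rewrite sumr_const card_ord mulr_natl.
Qed.

Definition deviation n (phi : T -> R) (w : n.-tuple T) : R :=
  \sum_(i < n) phi (tnth w i) - n%:R * mean phi.

Lemma deviation_chebyshev n (phi : T -> R) : (0 < n)%N ->
  \sum_(w : n.-tuple T | n%:R < `|deviation phi w|) word_prob w <=
  mean (fun x => (phi x - mean phi) ^+ 2) / n%:R.
Proof.
move=> n0; have n0' : (0 : R) < n%:R by rewrite ltr0n.
pose psi x := phi x - mean phi.
have psi0 : mean psi = 0.
  rewrite /mean; under eq_bigr do rewrite mulrBr.
  by rewrite sumrB -mulr_suml p1 mul1r subrr.
have devE (w : n.-tuple T) : deviation phi w = \sum_(i < n) psi (tnth w i).
  by rewrite /deviation /psi sumrB sumr_const card_ord mulr_natl.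
have := word_variance n psi0; rewrite -/psi => var.
rewrite ler_pdivlMr // -(ler_pM2r n0') -mulrA [leRHS]mulrC -var mulr_suml big_mkcond /=.
apply: ler_sum => w _; case: ifP => [h|_]; last first.
  by rewrite mulr_ge0 ?word_prob_ge0 ?sqr_ge0.
rewrite ler_wpM2l ?word_prob_ge0 // -devE -[leRHS]real_normK ?num_real // -expr2.
by apply: lerXn2r; rewrite ?nnegrE ?(ltW h) ?ler0n.
Qed.

(** Chebyshev for finitely many functions at once, with tolerance [n%:R], that is, one unit per
    letter. Words of probability 0 are discarded so that logarithms of probabilities make sense
    along the remaining ones. *)
Lemma typical_words (fs : seq (T -> R)) : exists n (S : {set n.-tuple T}),
  [/\ (0 < n)%N, 2^-1 <= \sum_(w in S) word_prob w &
   forall w, w \in S -> (forall i, 0 < p (tnth w i)) /\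
     forall k, (k < size fs)%N -> `|deviation (nth (fun=> 0) fs k) w| <= n%:R].
Proof.
pose V := \sum_(phi <- fs) mean (fun x => (phi x - mean phi) ^+ 2).
have V0 : 0 <= V.
  apply: sumr_ge0 => phi _; apply: sumr_ge0 => x _.
  by rewrite mulr_ge0 ?sqr_ge0.
(* The bad words have mass at most [V / n], hence at most one half. *)
pose n := (Num.bound (2 * V)).+1.
have nV : 2 * V <= n%:R.
  apply: ltW; apply: lt_le_trans (archi_boundP _) _; first by rewrite mulr_ge0.
  by rewrite ler_nat.
have n0' : (0 : R) < n%:R by rewrite ltr0n.
pose bad (w : n.-tuple T) := has (fun phi => n%:R < `|deviation phi w|) fs.
exists n, [set w | (0 < word_prob w) && ~~ bad w]%SET; split=> //.
  have bad_le : \sum_(w : n.-tuple T | bad w) word_prob w <= V / n%:R.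
    rewrite /V /bad mulr_suml; elim: (fs) => [|phi l IH].
      by rewrite big_pred0 // big_nil.
    rewrite big_cons; apply: le_trans (lerD (deviation_chebyshev phi _) IH) => //.
    rewrite [leLHS]big_mkcond [X in _ <= X + _]big_mkcond [X in _ <= _ + X]big_mkcond.
    rewrite -big_split /=; apply: ler_sum => w _.
    case: (n%:R < _) => /=; case: has => /=; rewrite ?addr0 ?add0r //.
    by rewrite lerDl word_prob_ge0.
  have := sum_word_prob n; rewrite (bigID bad) /= => tot.
  have -> : \sum_(w in [set w | (0 < word_prob w) && ~~ bad w]%SET) word_prob w =
      \sum_(w : n.-tuple T | ~~ bad w) word_prob w.
    rewrite big_mkcond [RHS]big_mkcond; apply: eq_bigr => w _.
    rewrite finset.inE; case: (bad w); rewrite ?andbF ?andbT //=.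
    by case: ltP => // h; apply/eqP; rewrite eq_le h word_prob_ge0.
  have h : V / n%:R <= 2^-1.
    by rewrite ler_pdivrMr // ler_pdivlMl.
  lra.
move=> w; rewrite finset.inE => /andP[w0].
rewrite /bad -all_predC => /(all_nthP (fun=> 0)) hb; split.
  move=> i; rewrite lt0r p0 andbT; apply/eqP => pi0.
  by move: w0; rewrite /word_prob (bigD1 i) //= pi0 mul0r ltxx.
by move=> k kf; rewrite leNgt; exact: hb.
Qed.

End weak_law.

Lemma word_map_flatten (I T : Type) (f : I -> T -> T) (ws : seq (seq I)) x :
  word_map f (flatten ws) x = word_map (fun w => word_map f w) ws x.
Proof. by elim: ws => //= w ws IH; rewrite word_map_cat IH. Qed.

Lemma word_map_map (I J T : Type) (f : J -> T -> T) (phi : I -> J) (w : seq I) x :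
  word_map f (map phi w) x = word_map (fun i => f (phi i)) w x.
Proof. by elim: w => //= i w ->. Qed.

Section marginals.
Context {R : realType} (T B : finType) (p : T -> R) (kap : T -> B).
Hypothesis p0 : forall x, 0 <= p x.

Definition marginal (c : B) : R := \sum_(x | kap x == c) p x.

Lemma marginal_ge x : p x <= marginal (kap x).
Proof. by rewrite /marginal (bigD1 x) //= lerDl sumr_ge0. Qed.

Lemma sum_fiber_prob n (v : n.-tuple B) :
  \sum_(w : n.-tuple T | map kap w == v) word_prob p w =
  \prod_(i < n) marginal (tnth v i).
Proof.
have -> : \prod_(i < n) marginal (tnth v i) =
    \prod_(i < n) \sum_x (if kap x == tnth v i then p x else 0).
  by apply: eq_bigr => i _; rewrite /marginal big_mkcond.
rewrite -sum_tuple_prod big_mkcond; apply: eq_bigr => w _.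
have mE : (map kap w == v) = [forall i, kap (tnth w i) == tnth v i].
  rewrite -[LHS]/(val (map_tuple kap w) == val v) (inj_eq val_inj) eqEtuple.
  by apply: eq_forallb => i; rewrite tnth_map.
rewrite mE; case: forallP => h.
  by apply: eq_bigr => i _; rewrite h.
have [i /negPf hi] : exists i, kap (tnth w i) != tnth v i.
  by apply/existsP; rewrite -negb_forall; apply/negP => /forallP.
by rewrite (bigD1 i) //= hi mul0r.
Qed.

(** The words over [v] have total probability equal to the product of the marginals, and each of
    them that lies in [S] takes at least [expR c]. *)
Lemma fiber_card n (S : {set n.-tuple T}) (c d : R) :
  (forall w, w \in S -> expR c <= word_prob p w) ->
  (forall w, w \in S -> \prod_(i < n) marginal (kap (tnth w i)) <= expR d) ->
  forall v : n.-tuple B,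
    #|[set w in S | map kap w == v]%SET|%:R <= expR (d - c).
Proof.
move=> hc hd v; set E := [set w in S | _]%SET.
have [->|/set0Pn[w0]] := eqVneq E finset.set0; first by rewrite cards0 expR_ge0.
rewrite finset.inE => /andP[w0S /eqP w0v].
rewrite expRB ler_pdivlMr ?expR_gt0 //; apply: le_trans (hd _ w0S).
have -> : \prod_(i < n) marginal (kap (tnth w0 i)) = \prod_(i < n) marginal (tnth v i).
  apply: eq_bigr => i _; congr marginal.
  by rewrite -(tnth_map kap) (tnth_nth (tnth v i)) /= w0v -tnth_nth.
rewrite -sum_fiber_prob -sum1_card natr_sum mulr_suml.
rewrite [leRHS]big_mkcond [leLHS]big_mkcond; apply: ler_sum => w _.
rewrite finset.inE; case: (w \in S) (hc w) => /= hw.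
  by case: eqP => //; rewrite mul1r hw.
by case: eqP => // _; rewrite word_prob_ge0.
Qed.

End marginals.

(** * Typical words as a nearly homogeneous system *)

Section typical_blocks.
Context {R : realType} (T B1 B2 : finType) (p : T -> R).
Variables (kap1 : T -> B1) (kap2 : T -> B2).
Hypothesis kap_inj : forall t t', kap1 t = kap1 t' -> kap2 t = kap2 t' -> t = t'.
Hypothesis p0 : forall x, 0 <= p x.
Hypothesis p1 : \sum_x p x = 1.

Definition block_ifs (B : finType) (F : B -> R -> R) (a : B -> R) (D : R) (U : set R) :=
  [/\ forall i (x : R), x \in `[0, 1] -> F i x \in `[0, 1],
      forall i, 0 < a i,
      forall i (x y : R), x \in `[0, 1] -> y \in `[0, 1] ->
        a i / D * `|x - y| <= `|F i x - F i y| <= a i * `|x - y|,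
      [/\ U !=set0, open U & U `<=` `[0, 1]%classic] &
      (forall i, F i @` U `<=` U) /\
      (forall i j, i != j -> F i @` U `&` F j @` U = set0)].

(** Upper ratios multiply without loss, whereas each letter costs a factor [D] in the lower
    ratio. *)
Lemma block_ifs_words (B : finType) (F : B -> R -> R) a D U n
    (S : {set n.-tuple B}) (c d : R) :
  1 <= D -> block_ifs F a D U -> c <= d -> d < 0 ->
  (forall w, w \in S -> c <= - contraction a w <= d) ->
  homogeneous_ifs (fun w : {w | w \in S} => word_map F (val w))
    (expR (c - n%:R * ln D)) (expR d) U.
Proof.
move=> D1 [F01 a0 Fa [U0 Uo U01] [FU Fdisj]] cd d0 hS.
have D0 : 0 < D by exact: lt_le_trans ltr01 _.
have Finj i (x y : R) : x \in `[0, 1] -> y \in `[0, 1] -> F i x = F i y -> x = y.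
  move=> x01 y01 h; have /andP[+ _] := Fa i x y x01 y01.
  by rewrite h subrr normr0 pmulr_rle0 ?divr_gt0 // normr_le0 subr_eq0 => /eqP.
have lnD : 0 <= ln D by exact: ln_ge0.
have low w x y : x \in `[0, 1] -> y \in `[0, 1] ->
    expR (- contraction a w - (size w)%:R * ln D) * `|x - y| <=
    `|word_map F w x - word_map F w y|.
  move=> x01 y01; elim: w => [|i w IH] /=.
    by rewrite /contraction big_nil mul0r subr0 oppr0 expR0 mul1r.
  have /andP[h _] := Fa i _ _ (word_map01 F01 w x01) (word_map01 F01 w y01).
  apply: le_trans h; rewrite /contraction big_cons -/(contraction a w).
  have -> : - (- ln (a i) + contraction a w) - (size w).+1%:R * ln D =
      (ln (a i) - ln D) + (- contraction a w - (size w)%:R * ln D).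
    by rewrite -[(size w).+1%:R]natr1; ring.
  rewrite expRD expRB !lnK ?posrE // -mulrA ler_wpM2l //.
  by rewrite divr_ge0 ?(ltW D0) ?(ltW (a0 _)).
split.
- by move=> w x; exact: word_map01.
- split; first exact: expR_gt0.
    rewrite ler_expR; apply: le_trans cd; rewrite gerBl.
    by rewrite mulr_ge0.
  by rewrite expR_lt1.
- move=> [w wS] x y x01 y01 /=; have /andP[h1 h2] := hS w wS.
  apply/andP; split.
    apply: le_trans (low w x y x01 y01); rewrite ler_wpM2r // ler_expR size_tuple.
    by rewrite lerD2r.
  apply: le_trans (word_map_lip F01 a0 _ w x01 y01) _.
    by move=> i u v u01 v01; have /andP[] := Fa i u v u01 v01.
  by rewrite ler_wpM2r // ler_expR.
- by split.
split.
  by move=> w _ [x Ux <-]; exact: word_map_U.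
move=> w w' ww'; rewrite -subset0 => z [[x Ux xz] [x' Ux' x'z]].
case/eqP: ww'; do 2 apply: val_inj.
apply: (word_map_disjoint U01 FU Fdisj Finj _ Ux Ux'); last by rewrite xz.
by rewrite !size_tuple.
Qed.

Lemma mean_le (phi psi : T -> R) : (forall x, phi x <= psi x) ->
  mean p phi <= mean p psi.
Proof. by move=> h; apply: ler_sum => x _; rewrite ler_wpM2l. Qed.

(* [h, h1, x1, x2] are the opposites of [H, H1, L1, L2] below; typicality costs
   [n] in each of these means and distortion costs [n * lD]. *)
Lemma exponent_bound (h h1 x1 x2 lD n : R) (ltau : R) :
  0 < n -> 1 <= n -> 0 <= h1 <= h -> 2 <= x1 <= x2 -> 0 <= lD ->
  n * h - n - n <= ltau ->
  h1 / x1 + (h - h1) / x2 - (16 + 4 * lD) / x1 <=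
  (ltau + (- (2 * n) - n * lD) + (- (2 * n) - n * lD) - n * (h - h1 + 2)) /
    (n * (x1 - 1)) + n * (h - h1 + 2) / (n * (x2 - 1)).
Proof.
move=> n0 n1 /andP[h10 h1h] /andP[x12 x1x2] lD0 htau.
have y1 : 0 < x1 - 1 by lra.
have y2 : 0 < x2 - 1 by lra.
have x10 : 0 < x1 by lra.
have x20 : 0 < x2 by lra.
have e1 : (h - h1) / x2 <= n * (h - h1 + 2) / (n * (x2 - 1)).
  rewrite -mulf_div divff ?gt_eqF // mul1r.
  apply: ler_pM; rewrite ?invr_ge0 ?(ltW x20) ?subr_ge0 //; first by lra.
  by rewrite lef_pV2 ?posrE //; lra.
(* The 8 collects four costs of 2: the number of blocks, the two ratios [lo / hi], and the size of
   the fibres. *)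
have e2 : (h1 - 8 - 2 * lD) / (x1 - 1) <=
    (ltau + (- (2 * n) - n * lD) + (- (2 * n) - n * lD) - n * (h - h1 + 2)) / (n * (x1 - 1)).
  have -> : (h1 - 8 - 2 * lD) / (x1 - 1) = n * (h1 - 8 - 2 * lD) / (n * (x1 - 1)).
    by rewrite -mulf_div divff ?gt_eqF // mul1r.
  by rewrite ler_pM2r ?invr_gt0 ?mulr_gt0 //; lra.
have e3 : h1 / x1 <= h1 / (x1 - 1).
  by rewrite ler_wpM2l // lef_pV2 ?posrE //; lra.
have e4 : (8 + 2 * lD) / (x1 - 1) <= (16 + 4 * lD) / x1.
  rewrite ler_pdivrMr // mulrAC ler_pdivlMr //; nra.
have e5 : (h1 - 8 - 2 * lD) / (x1 - 1) = h1 / (x1 - 1) - (8 + 2 * lD) / (x1 - 1).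
  by rewrite -[RHS]mulrBl; congr (_ / _); ring.
rewrite e5 in e2; lra.
Qed.

Variables (F : B1 -> R -> R) (G : B2 -> R -> R) (a : B1 -> R) (b : B2 -> R).
Variables (D : R) (U1 U2 : set R).
Hypothesis D1 : 1 <= D.
Hypothesis ifsF : block_ifs F a D U1.
Hypothesis ifsG : block_ifs G b D U2.

Let L1 := mean p (fun x => ln (a (kap1 x))).
Let L2 := mean p (fun x => ln (b (kap2 x))).
Let H := mean p (fun x => ln (p x)).
Let H1 := mean p (fun x => ln (marginal p kap1 (kap1 x))).

Definition block_hits n (S : {set n.-tuple T}) l (V1 V2 : set R) :
    {set l.-tuple {w : n.-tuple T | w \in S}} :=
  [set t : l.-tuple {w : n.-tuple T | w \in S} |
    `[< meets F (map kap1 (flatten (map (fun w => tval (val w)) t))) V1 >] &&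
    `[< meets G (map kap2 (flatten (map (fun w => tval (val w)) t))) V2 >]]%SET.

(** Typical words become the letters of a system with ratios near [expR (n * L1)] and
    [expR (n * L2)], at least about [expR (- n * H)] letters and fibres of size about
    [expR (n * (H1 - H))] at most, to which [hitting_words_card] applies. *)
Lemma typical_block_hits : L2 <= L1 -> L1 <= - 2 ->
  exists n (S : {set n.-tuple T}), [/\ (0 < n)%N, (0 < #|S|)%N,
    forall w, w \in S -> forall i, 0 < p (tnth w i) &
    exists2 C : R, 0 < C & forall r : R, 0 < r <= 1 ->
    exists l, forall V1 V2 : set R,
      (forall x y, V1 x -> V1 y -> `|x - y| <= r) ->
      (forall x y, V2 x -> V2 y -> `|x - y| <= r) ->
      #|block_hits S l V1 V2|%:R <=
        C * r `^ (H1 / L1 + (H - H1) / L2 - (16 + 4 * ln D) / - L1) * #|S|%:R ^+ l].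
Proof.
move=> L21 L1le.
pose fs := [:: (fun x => ln (a (kap1 x))); (fun x => ln (b (kap2 x)));
  (fun x => ln (p x)); (fun x => ln (marginal p kap1 (kap1 x)))].
have [n [S [n0 massS typS]]] := typical_words p0 p1 fs.
have n0' : (0 : R) < n%:R by rewrite ltr0n.
have n1' : (1 : R) <= n%:R by rewrite ler1n.
have pos w : w \in S -> forall i, 0 < p (tnth w i) by move=> /typS[].
have marg0 x : 0 < p x -> 0 < marginal p kap1 (kap1 x).
  by move=> px; exact: lt_le_trans px (marginal_ge kap1 p0 x).
have dev k w : (k < 4)%N -> w \in S ->
    n%:R * mean p (nth (fun=> 0) fs k) - n%:R <= \sum_(i < n) nth (fun=> 0) fs k (tnth w i)
      <= n%:R * mean p (nth (fun=> 0) fs k) + n%:R.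
  move=> k4 /typS[_ /(_ k k4)]; rewrite /deviation ler_norml => /andP[h1 h2].
  by apply/andP; split; lra.
have contr (B : finType) (c : B -> R) (kap : T -> B) (w : n.-tuple T) :
    - contraction c (map kap w) = \sum_(i < n) ln (c (kap (tnth w i))).
  by rewrite /contraction big_map big_tuple sumrN opprK.
have wpE w : w \in S -> word_prob p w = expR (\sum_(i < n) ln (p (tnth w i))).
  by move=> wS; rewrite expR_sum; apply: eq_bigr => i _; rewrite lnK // posrE pos.
(* Each coordinate alphabet keeps only the projections of typical words, so that all its maps obey
   common contraction bounds. *)
pose S1 : {set n.-tuple B1} := [set map_tuple kap1 w | w in S]%SET.
pose S2 : {set n.-tuple B2} := [set map_tuple kap2 w | w in S]%SET.
pose W := {w : n.-tuple T | w \in S}.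
have k1P (w : W) : map_tuple kap1 (val w) \in S1 by apply: imset_f; exact: valP.
have k2P (w : W) : map_tuple kap2 (val w) \in S2 by apply: imset_f; exact: valP.
pose k1 (w : W) : {v | v \in S1} := exist (fun v => v \in S1) _ (k1P w).
pose k2 (w : W) : {v | v \in S2} := exist (fun v => v \in S2) _ (k2P w).
have kinj w w' : k1 w = k1 w' -> k2 w = k2 w' -> w = w'.
  move=> e1 e2; apply: val_inj; apply: eq_from_tnth => i; apply: kap_inj.
    by have /(congr1 (fun v => tnth (val v) i)) := e1; rewrite /= !tnth_map.
  by have /(congr1 (fun v => tnth (val v) i)) := e2; rewrite /= !tnth_map.
have cardW : #|{: W}| = #|S| by rewrite card_sig.
have H1H : H <= H1.
  rewrite /H /H1 /mean; apply: ler_sum => x _.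
  have := p0 x; rewrite le_eqVlt => /orP[/eqP <-|px]; first by rewrite !mul0r.
  by rewrite ler_wpM2l // ler_ln ?posrE ?marg0 // marginal_ge.
have H10 : H1 <= 0.
  apply: sumr_le0 => x _; rewrite mulr_ge0_le0 // ln_le0 // -p1 /marginal.
  by rewrite [leRHS](bigID (fun y => kap1 y == kap1 x)) /= lerDl sumr_ge0.
pose N := n%:R : R.
pose Phi := expR (N * (H1 - H + 2)).
have Phi1 : 1 <= Phi.
  by rewrite -[leLHS]expR0 ler_expR mulr_ge0 ?(ltW n0') //; lra.
have fib1 v : #|[set w | k1 w == v]%SET|%:R <= Phi.
  have := @fiber_card _ _ _ p kap1 p0 n S (N * H - N) (N * H1 + N) _ _ (val v).
  have -> : N * H1 + N - (N * H - N) = N * (H1 - H + 2) by ring.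
  move=> h; apply: le_trans (h _ _).
  - rewrite ler_nat -(card_imset _ val_inj); apply: subset_leq_card.
    apply/fintype.subsetP => _ /imsetP[w + ->]; rewrite !finset.inE => /eqP <-.
    by apply/andP; split; [exact: (valP w)|exact/eqP].
  - by move=> w wS; rewrite wpE // ler_expR; have /andP[] := dev 2%N w isT wS.
  - move=> w wS; have -> : \prod_(i < n) marginal p kap1 (kap1 (tnth w i)) =
        expR (\sum_(i < n) ln (marginal p kap1 (kap1 (tnth w i)))).
      by rewrite expR_sum; apply: eq_bigr => i _; rewrite lnK // posrE marg0 // pos.
    by rewrite ler_expR; have /andP[] := dev 3%N w isT wS.
(* The typical words carry half of the mass; the factor 2 is absorbed by [2 <= expR N], whence the
   second [- N]. *)
have tau_ge : expR (N * - H - N - N) <= #|S|%:R.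
  have : 2^-1 <= #|S|%:R * expR (N * H + N).
    apply: le_trans massS _; rewrite mulr_natl -sumr_const; apply: ler_sum => w wS.
    by rewrite wpE // ler_expR; have /andP[] := dev 2%N w isT wS.
  rewrite -ler_pdivrMr ?expR_gt0 //; apply: le_trans.
  rewrite -expRN ler_pdivlMl // -[X in X * _]/(1 + 1).
  have e2 : (1 + 1 : R) <= expR N by apply: le_trans (expR_ge1Dx N); rewrite lerD2l.
  apply: le_trans (ler_wpM2r (expR_ge0 _) e2) _.
  by rewrite -expRD ler_expR; lra.
have S0 : (0 < #|S|)%N by rewrite -(ltr_nat R); exact: lt_le_trans (expR_gt0 _) tau_ge.
exists n, S; split=> //.
have bnd1 v : v \in S1 -> N * L1 - N <= - contraction a v <= N * L1 + N.
  by move=> /imsetP[w wS ->] /=; rewrite contr; exact: (dev 0%N w isT wS).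
have bnd2 v : v \in S2 -> N * L2 - N <= - contraction b v <= N * L2 + N.
  by move=> /imsetP[w wS ->] /=; rewrite contr; exact: (dev 1%N w isT wS).
have N0 : 0 < N by [].
(* An exponent at most -2 leaves a genuine contraction after the tolerance of one unit per
   letter. *)
have neg L : L <= - 2 -> N * L + N < 0 by move=> hL; nra.
have L2le : L2 <= - 2 by exact: le_trans L1le.
have cd L : N * L - N <= N * L + N by lra.
have h1 := block_ifs_words D1 ifsF (cd L1) (neg _ L1le) bnd1.
have h2 := block_ifs_words D1 ifsG (cd L2) (neg _ L2le) bnd2.
have hi21 : expR (N * L2 + N) <= expR (N * L1 + N) by rewrite ler_expR lerD2r ler_pM2l.
have W0 : (0 < #|{: W}|)%N by rewrite cardW.
have [C C0 hC] := hitting_words_card kinj Phi1 fib1 W0 h1 h2 hi21.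
exists C => // r r01; have [l hl] := hC r r01; exists l => V1 V2 hV1 hV2.
pose F' := fun v : {v | v \in S1} => word_map F (val v).
pose G' := fun v : {v | v \in S2} => word_map G (val v).
have -> : block_hits S l V1 V2 = hitting_words k1 k2 F' G' l V1 V2.
  apply/setP => t; rewrite !finset.inE.
  by congr (`[< _ >] && `[< _ >]); apply/propext; split=> -[y y01 Vy]; exists y => //;
    move: Vy; rewrite map_flatten word_map_flatten !word_map_map.
apply: le_trans (hl V1 V2 hV1 hV2) _.
rewrite cardW ler_wpM2r ?exprn_ge0 // ler_wpM2l ?(ltW C0) //.
apply: ger_powR => //; rewrite /hitting_exponent cardW !expRK.
have ratio L : ln (expR (N * L - N - N * ln D) / expR (N * L + N)) = - (2 * N) - N * ln D.
  by rewrite -expRB expRK; ring.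
rewrite !ratio.
have -> : - (N * L1 + N) = N * (- L1 - 1) by ring.
have -> : - (N * L2 + N) = N * (- L2 - 1) by ring.
have -> : H1 / L1 = - H1 / - L1 by rewrite invrN mulrNN.
have -> : (H - H1) / L2 = (- H - - H1) / - L2 by rewrite -opprD invrN mulrNN.
have -> : H1 - H + 2 = - H - - H1 + 2 by ring.
apply: exponent_bound => //; last 1 first.
- by rewrite -[leLHS]expRK ler_ln ?posrE ?expR_gt0 // ltr0n.
- by apply/andP; split; lra.
- by apply/andP; split; lra.
- exact: ln_ge0.
Qed.

End typical_blocks.

Section prob_vector_means.
Context {R : realType} (A1 A2 : finType) (A : {set A1 * A2}) (p : A1 * A2 -> R).
Hypothesis hp : prob_vectors A p.

Lemma prob_vector_mean (phi : A1 * A2 -> R) : \sum_(x in A) p x * phi x = mean p phi.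
Proof.
have [p0 pA _] := hp; rewrite /mean [RHS](bigID (mem A)) /= [X in _ + X]big1 ?addr0 //.
by move=> x xA; rewrite pA // mul0r.
Qed.

Lemma prob_vector_sum : \sum_x p x = 1.
Proof.
have [p0 pA p1] := hp; rewrite (bigID (mem A)) /= [X in _ + X]big1 ?addr0 //.
Qed.

Lemma q_marg_marginal i : q_marg A p i = marginal p fst i.
Proof.
have [p0 pA _] := hp; rewrite /marginal (bigID (mem A)) /= [X in _ + X]big1 ?addr0; last first.
  by move=> x /andP[_ /pA].
rewrite /q_marg (reindex_onto (fun j => (i, j)) snd) /=; last first.
  by move=> [? ?] /= /andP[/eqP -> _].
by apply: eq_bigl => j; rewrite !eqxx !andbT.
Qed.

Lemma r_marg_marginal j : r_marg A p j = marginal p snd j.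
Proof.
have [p0 pA _] := hp; rewrite /marginal (bigID (mem A)) /= [X in _ + X]big1 ?addr0; last first.
  by move=> x /andP[_ /pA].
rewrite /r_marg (reindex_onto (fun i => (i, j)) fst) /=; last first.
  by move=> [? ?] /= /andP[/eqP -> _].
by apply: eq_bigl => i; rewrite !eqxx !andbT.
Qed.

Lemma ent1_mean : ent1 A p = mean p (fun x => ln (marginal p fst x.1)).
Proof.
by rewrite /ent1 prob_vector_mean; apply: eq_bigr => x _; rewrite q_marg_marginal.
Qed.

Lemma ent2_mean : ent2 A p = mean p (fun x => ln (marginal p snd x.2)).
Proof.
by rewrite /ent2 prob_vector_mean; apply: eq_bigr => x _; rewrite r_marg_marginal.
Qed.

End prob_vector_means.

(** * Blocks of letters for the carpet *)

Section carpet_blocks.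
Context {R : realType} (I J : finType).

Lemma self_conformal_injective (K : finType) (f : K -> R -> R) : self_conformal f ->
  forall i (x y : R), x \in `[0, 1] -> y \in `[0, 1] -> f i x = f i y -> x = y.
Proof.
move=> /self_conformal_distortion[D [k [D1 _ hD]]] i x y x01 y01 fxy.
have [d0 _ /(_ x y x01 y01) /andP[+ _]] := hD 1%N [tuple i].
rewrite /= fxy subrr normr0 pmulr_rle0 ?divr_gt0 ?(lt_le_trans ltr01 D1) //.
by rewrite normr_le0 subr_eq0 => /eqP.
Qed.

Lemma self_conformal_block (K : finType) (f : K -> R -> R) (D E : R) (U : set R) n :
  self_conformal f -> 1 <= D -> D <= E ->
  (forall w : n.-tuple K, 0 < deriv_norm f w /\
    forall x y : R, x \in `[0, 1] -> y \in `[0, 1] ->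
      deriv_norm f w / D * `|x - y| <= `|word_map f w x - word_map f w y| <=
      deriv_norm f w * `|x - y|) ->
  U !=set0 -> open U -> U `<=` `[0, 1]%classic ->
  (forall i, f i @` U `<=` U) ->
  (forall i j, i != j -> f i @` U `&` f j @` U = set0) ->
  block_ifs (fun w : n.-tuple K => word_map f w) (@deriv_norm R K f n) E U.
Proof.
move=> hf D1 DE hD U0 Uo U01 FU Fdisj.
have [f01 _ _ _ _] := hf; have D0 : 0 < D by exact: lt_le_trans ltr01 _.
have E0 : 0 < E by exact: lt_le_trans DE.
split=> //.
- by move=> w x; exact: word_map01.
- by move=> w; case: (hD w).
- move=> w x y x01 y01; have [d0 /(_ x y x01 y01) /andP[h1 h2]] := hD w.
  rewrite h2 andbT; apply: le_trans h1; rewrite ler_wpM2r // ler_pM2l //.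
  by rewrite lef_pV2.
split=> [w _ [x Ux <-]|w w' ww'].
  exact: word_map_U.
rewrite -subset0 => z [[x Ux xz] [x' Ux' x'z]].
case/eqP: ww'; apply: val_inj.
apply: (word_map_disjoint U01 FU Fdisj (self_conformal_injective hf) _ Ux Ux').
  by rewrite !size_tuple.
by rewrite xz.
Qed.

Definition block_letters n (x : n.-tuple I * n.-tuple J) : seq (I * J) := zip x.1 x.2.

Lemma unzip1_blocks n (ws : seq (n.-tuple I * n.-tuple J)) :
  unzip1 (flatten (map (@block_letters n) ws)) =
  flatten (map (fun x => tval x) (map fst ws)).
Proof.
elim: ws => //= x ws <-; rewrite unzip1_cat; congr cat.
by rewrite unzip1_zip // !size_tuple.
Qed.

Lemma unzip2_blocks n (ws : seq (n.-tuple I * n.-tuple J)) :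
  unzip2 (flatten (map (@block_letters n) ws)) =
  flatten (map (fun x => tval x) (map snd ws)).
Proof.
elim: ws => //= x ws <-; rewrite unzip2_cat; congr cat.
by rewrite unzip2_zip // !size_tuple.
Qed.

Lemma meets_flatten (K : finType) (f : K -> R -> R) n (ws : seq (n.-tuple K)) V :
  meets f (flatten (map (fun x => tval x) ws)) V =
  meets (fun w : n.-tuple K => word_map f w) ws V.
Proof.
apply/propext; split=> -[y y01 Vy]; exists y => //; move: Vy;
  by rewrite word_map_flatten !word_map_map.
Qed.

Lemma size_blocks n (ws : seq (n.-tuple I * n.-tuple J)) :
  size (flatten (map (@block_letters n) ws)) = (size ws * n)%N.
Proof.
elim: ws => //= x ws IH; rewrite size_cat IH mulSn; congr addn.
by rewrite size_zip !size_tuple minnn.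
Qed.

Variables (f : I -> R -> R) (g : J -> R -> R) (L : {set I * J}).
Hypothesis hf : self_conformal f.
Hypothesis hg : self_conformal g.
Hypothesis hosc : coordinate_osc f g.

Definition coding_hits (T : finType) (bw : T -> seq (I * J)) l (V1 V2 : set R) :
    {set l.-tuple T} :=
  [set t : l.-tuple T | `[< meets f (unzip1 (flatten (map bw t))) V1 >] &&
                        `[< meets g (unzip2 (flatten (map bw t))) V2 >]]%SET.

(* The block estimate loses [O(1) / - L1], where [- L1 >= - n * ln k] for words of
   length [n]; whence the error [c / n]. *)
Lemma carpet_block_words : exists2 c : R, 0 <= c & exists n0 : nat,
  forall n, (n0 <= n)%N -> (0 < n)%N -> forall p, prob_vectors (words L n) p ->
  exists M (T : finType) (bw : T -> seq (I * J)),
  [/\ (0 < M)%N, (0 < #|T|)%N,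
    forall t, size (bw t) = M /\ {subset bw t <= L} &
    exists2 C : R, 0 < C & forall r : R, 0 < r <= 1 ->
    exists l, forall V1 V2 : set R,
      (forall x y, V1 x -> V1 y -> `|x - y| <= r) ->
      (forall x y, V2 x -> V2 y -> `|x - y| <= r) ->
      #|coding_hits bw l V1 V2|%:R <=
        C * r `^ (g_dim (words L n) p (@deriv_norm R I f n) (@deriv_norm R J g n) - c / n%:R)
        * #|T|%:R ^+ l].
Proof.
have [Df [kf [Df1 kf01 hDf]]] := self_conformal_distortion hf.
have [Dg [kg [Dg1 kg01 hDg]]] := self_conformal_distortion hg.
have [[U [U0 Uo U01 fU fdisj]] [V [V0 Vo V01 gV gdisj]]] := hosc.
pose D := Num.max Df Dg.
have D1 : 1 <= D by rewrite le_max Df1.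
pose k := Num.max kf kg.
have k01 : 0 < k < 1.
  by rewrite lt_max gt_max; case/andP: kf01 => -> ->; case/andP: kg01 => _ ->.
have /andP[k0 k1] := k01.
have lk : 0 < - ln k by rewrite oppr_gt0 ln_lt0.
pose c := (16 + 4 * ln D) / - ln k.
have c0 : 0 <= c by rewrite divr_ge0 ?(ltW lk) // addr_ge0 // mulr_ge0 // ln_ge0.
(* From this [n] on both exponents are at most -2, as the block estimate requires. *)
exists c => //; exists (Num.bound (2 / - ln k)) => n n0n n0 p hp.
have n0' : (0 : R) < n%:R by rewrite ltr0n.
have nk : 2 <= n%:R * - ln k.
  rewrite -ler_pdivrMr //; apply: ltW; apply: lt_le_trans (archi_boundP _) _.
    by rewrite divr_ge0 // ltW.
  by rewrite ler_nat.
have ifsF := self_conformal_block (D := Df) (E := D) (n := n) hf Df1.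
have {}ifsF : block_ifs (fun w : n.-tuple I => word_map f w) (@deriv_norm R I f n) D U.
  apply: ifsF => //; first by rewrite le_max lexx.
  by move=> w; have [] := hDf n w.
have ifsG : block_ifs (fun w : n.-tuple J => word_map g w) (@deriv_norm R J g n) D V.
  apply: (self_conformal_block (D := Dg)) => //; first by rewrite le_max lexx orbT.
  by move=> w; have [] := hDg n w.
have [p0 pA p1] := hp; have psum := prob_vector_sum hp.
set a := @deriv_norm R I f n in ifsF *; set b := @deriv_norm R J g n in ifsG *.
have l1E : lambda1 (words L n) p a = mean p (fun x => ln (a x.1)).
  exact: prob_vector_mean.
have l2E : lambda2 (words L n) p b = mean p (fun x => ln (b x.2)).
  exact: prob_vector_mean.
have entE : ent (words L n) p = mean p (fun x => ln (p x)) by exact: prob_vector_mean.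
have mean_small (phi : n.-tuple I * n.-tuple J -> R) :
    (forall x, phi x <= n%:R * ln k) -> mean p phi <= - (n%:R * - ln k).
  rewrite mulrN opprK => h; apply: (@le_trans _ _ (mean p (fun=> n%:R * ln k))).
    exact: mean_le.
  by rewrite /mean -mulr_suml psum mul1r.
have lnle x : 0 < x -> x <= k ^+ n -> ln x <= n%:R * ln k.
  by move=> x0 xk; rewrite mulr_natl -lnXn // ler_ln ?posrE ?exprn_gt0.
have l1n : lambda1 (words L n) p a <= - (n%:R * - ln k).
  rewrite l1E; apply: mean_small => x; apply: lnle; first by have [] := hDf n x.1.
  have [_ h _] := hDf n x.1; apply: le_trans h _.
  by rewrite lerXn2r ?nnegrE ?(ltW k0) ?le_max ?lexx //; case/andP: kf01 => /ltW.
have l2n : lambda2 (words L n) p b <= - (n%:R * - ln k).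
  rewrite l2E; apply: mean_small => x; apply: lnle; first by have [] := hDg n x.2.
  have [_ h _] := hDg n x.2; apply: le_trans h _.
  by rewrite lerXn2r ?nnegrE ?(ltW k0) ?le_max ?lexx ?orbT //; case/andP: kg01 => /ltW.
have err l : l <= - (n%:R * - ln k) -> (16 + 4 * ln D) / - l <= c / n%:R.
  move=> hl; rewrite /c -mulrA -invfM ler_wpM2l //.
    by rewrite addr_ge0 // mulr_ge0 // ln_ge0.
  have nk0 : 0 < n%:R * - ln k by rewrite mulr_gt0.
  have l0 : 0 < - l by rewrite oppr_gt0 (le_lt_trans hl) // oppr_lt0.
  by rewrite [- ln k * _]mulrC lef_pV2 // lerNr.
(* Letters of positive probability belong to [words L n], so unzipped typical words use only letters
   of [L]. *)
have inL N (w : N.-tuple (n.-tuple I * n.-tuple J)) : (forall i, 0 < p (tnth w i)) ->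
    {subset flatten (map (@block_letters n) w) <= L}.
  move=> hw l /flattenP[_ /mapP[x xw ->] lx].
  have [i xi] : exists i, x = tnth w i by have /tnthP[i ->] := xw; exists i.
  have : x \in words L n.
    by apply: contraT => /pA px; have := hw i; rewrite -xi px ltxx.
  rewrite finset.inE => /forallP hx.
  have [m ml lE] := nthP l lx; rewrite size_zip !size_tuple minnn in ml.
  have := hx (Ordinal ml); rewrite (tnth_nth l.1) (tnth_nth l.2) /=.
  by move: lE; rewrite /block_letters {1}[l]surjective_pairing nth_zip ?size_tuple // => ->.
have flat N (S : {set N.-tuple (n.-tuple I * n.-tuple J)})
    (t : seq {w : N.-tuple (n.-tuple I * n.-tuple J) | w \in S}) :
    flatten (map (fun w => flatten (map (@block_letters n) (tval (val w)))) t) =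
    flatten (map (@block_letters n) (flatten (map (fun w => tval (val w)) t))).
  by elim: t => //= w t ->; rewrite map_cat flatten_cat.
have finish s' s (C r : R) : 0 <= C -> 0 < r <= 1 -> s <= s' -> C * r `^ s' <= C * r `^ s.
  by move=> C0 r01 ss; rewrite ler_wpM2l // ger_powR.
have [l21|l12] := leP (lambda2 (words L n) p b) (lambda1 (words L n) p a).
  have kinj (x y : n.-tuple I * n.-tuple J) : x.1 = y.1 -> x.2 = y.2 -> x = y.
    by case: x y => [? ?] [? ?] /= -> ->.
  have h21 : mean p (fun x => ln (b x.2)) <= mean p (fun x => ln (a x.1)).
    by move: l21; rewrite l1E l2E.
  have h1 : mean p (fun x => ln (a x.1)) <= - 2.
    by move: l1n; rewrite l1E => /le_trans; apply; rewrite lerN2.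
  have [N [S [N0 S0 pS [C C0 hC]]]] :=
    typical_block_hits kinj p0 psum D1 ifsF ifsG h21 h1.
  exists (N * n)%N, {w : N.-tuple (n.-tuple I * n.-tuple J) | w \in S},
    (fun w => flatten (map (@block_letters n) (tval (val w)))).
  rewrite card_sig muln_gt0 N0 n0; split => //.
    move=> w; split; first by rewrite size_blocks size_tuple.
    by apply: inL; apply: pS; exact: (valP w).
  exists C => // r r01; have [l hl] := hC r r01; exists l => V1 V2 hV1 hV2.
  have -> : coding_hits (fun w : {w | w \in S} =>
      flatten (map (@block_letters n) (tval (val w)))) l V1 V2 =
    block_hits fst snd (fun w : n.-tuple I => word_map f w)
      (fun w : n.-tuple J => word_map g w) S l V1 V2.
    apply/setP => t; rewrite !finset.inE flat unzip1_blocks unzip2_blocks.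
    by rewrite !meets_flatten.
  apply: le_trans (hl V1 V2 hV1 hV2) _; rewrite ler_wpM2r ?exprn_ge0 //.
  apply: finish => //; first exact: ltW.
  have := err _ l1n; rewrite /g_dim l21 /g1 (ent1_mean hp) l1E l2E entE => e1.
  by rewrite lerD2l lerN2.
(* The other order of the exponents: [g2] is [g1] with the coordinates exchanged, and the hitting
   condition is symmetric. *)
have kinj (x y : n.-tuple I * n.-tuple J) : x.2 = y.2 -> x.1 = y.1 -> x = y.
  by case: x y => [? ?] [? ?] /= -> ->.
have h12 : mean p (fun x => ln (a x.1)) <= mean p (fun x => ln (b x.2)).
  by move: l12; rewrite l1E l2E => /ltW.
have h2 : mean p (fun x => ln (b x.2)) <= - 2.
  by move: l2n; rewrite l2E => /le_trans; apply; rewrite lerN2.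
have [N [S [N0 S0 pS [C C0 hC]]]] :=
  typical_block_hits kinj p0 psum D1 ifsG ifsF h12 h2.
exists (N * n)%N, {w : N.-tuple (n.-tuple I * n.-tuple J) | w \in S},
  (fun w => flatten (map (@block_letters n) (tval (val w)))).
rewrite card_sig muln_gt0 N0 n0; split => //.
  move=> w; split; first by rewrite size_blocks size_tuple.
  by apply: inL; apply: pS; exact: (valP w).
exists C => // r r01; have [l hl] := hC r r01; exists l => V1 V2 hV1 hV2.
have -> : coding_hits (fun w : {w | w \in S} =>
    flatten (map (@block_letters n) (tval (val w)))) l V1 V2 =
  block_hits snd fst (fun w : n.-tuple J => word_map g w)
    (fun w : n.-tuple I => word_map f w) S l V2 V1.
  apply/setP => t; rewrite !finset.inE flat unzip1_blocks unzip2_blocks.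
  by rewrite !meets_flatten andbC.
apply: le_trans (hl V2 V1 hV2 hV1) _; rewrite ler_wpM2r ?exprn_ge0 //.
apply: finish => //; first exact: ltW.
have l12F : (lambda2 (words L n) p b <= lambda1 (words L n) p a) = false.
  by rewrite leNgt l12.
have := err _ l2n; rewrite /g_dim l12F /= /g2 (ent2_mean hp) l1E l2E entE => e2.
by rewrite lerD2l lerN2.
Qed.

End carpet_blocks.

(** * Block measures on the symbolic space *)

Lemma mkseq_cons (S : Type) (u : nat -> S) n :
  mkseq u n.+1 = u 0%N :: mkseq (fun m => u m.+1) n.
Proof. by rewrite /mkseq /= (iotaDl 1) -map_comp. Qed.

Lemma mkseq_add (S : Type) (u : nat -> S) m n :
  mkseq u (m + n) = mkseq u m ++ mkseq (fun i => u (m + i)%N) n.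
Proof. by rewrite /mkseq iotaD map_cat add0n -[X in iota X n]addn0 iotaDl -map_comp. Qed.

Section symbolic_space.
Context {R : realType} (K : finType) (L : {set K}) (l0 : {l | l \in L}).

Notation alphabet := {l | l \in L}.

Definition cylinder (s : seq alphabet) : set (symbolic l0) :=
  [set u : symbolic l0 | mkseq (u : nat -> alphabet) (size s) = s].

(** Only whole blocks have a simple law, hence lengths divisible by [M]; the empty set makes the
    family stable under intersection. *)
Definition blocks (M : nat) : set (set (symbolic l0)) :=
  [set A | A = set0 \/ exists2 s, (M %| size s)%N & A = cylinder s].

Lemma cylinder_cat s t : cylinder (s ++ t) `<=` cylinder s.
Proof.
move=> u /= h; have := congr1 (take (size s)) h.
rewrite take_size_cat // size_cat => hs; rewrite /cylinder /= -[RHS]hs.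
by rewrite /mkseq -map_take take_iota minnC (minn_idPr _) // leq_addr.
Qed.

Lemma cylinderI_eq s t u : cylinder s u -> cylinder t u -> (size s <= size t)%N ->
  exists t', t = s ++ t'.
Proof.
move=> /= hs ht st; exists (drop (size s) t).
rewrite -[LHS](cat_take_drop (size s)); congr cat.
by rewrite -[RHS]hs -[in LHS]ht /mkseq -map_take take_iota (minn_idPl st).
Qed.

Lemma cylinder_open (s : seq alphabet) : @open (symbolic_top l0) (cylinder s).
Proof.
elim/last_ind: s => [|s a IH].
  have -> : cylinder [::] = setT by apply/seteqP; split.
  exact: openT.
have -> : cylinder (rcons s a) = cylinder s `&`
    ((fun u : symbolic_top l0 => u (size s)) @^-1` [set (a : letter l0)]).
  apply/seteqP; split=> [u|u []]; rewrite /cylinder /= size_rcons mkseqS.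
    by move=> /rcons_inj[].
  by move=> -> ->.
apply: openI IH _; apply: open_comp; last exact: (@discrete_open (letter l0)).
by move=> u _; exact: (@proj_continuous nat (fun=> letter l0) (size s)).
Qed.

(** If every such cylinder around [u] left [U], points chosen outside [U] in these cylinders would
    converge to [u] coordinatewise. *)
Lemma open_cylinder (U : set (symbolic_top l0)) u : open U -> U u ->
  forall M, (0 < M)%N -> exists n, cylinder (mkseq u (n * M)) `<=` U.
Proof.
move=> Uo Uu M M0; apply: contrapT => hno.
have /choice[v vP] : forall n, exists v, cylinder (mkseq u (n * M)) v /\ ~ U v.
  move=> n; apply: contrapT => hn; apply: hno; exists n => v cv.
  by apply: contrapT => Uv; apply: hn; exists v.
have cv : v n @[n --> \oo] --> (u : symbolic_top l0).
  apply/cvg_sup => i A; rewrite nbhsE => -[B [[W oW <-] Bu] sBA].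
  exists i.+1 => //= n /= lein; apply: sBA => /=.
  suff -> : v n i = u i by [].
  have [h _] := vP n; have il : (i < n * M)%N.
    by rewrite (leq_trans lein) // leq_pmulr.
  have := congr1 (fun w => nth l0 w i) h.
  by rewrite size_mkseq !nth_mkseq.
have [n _ /(_ n (leqnn n))] := cv U (open_nbhs_nbhs (conj Uo Uu)).
by case: (vP n).
Qed.

Lemma open_bigcup_cylinder (U : set (symbolic_top l0)) M : open U -> (0 < M)%N ->
  U = \bigcup_(s in [set s | (M %| size s)%N /\ cylinder s `<=` U]) cylinder s.
Proof.
move=> Uo M0; apply/seteqP; split=> [u Uu|u [s [_ sU] su]]; last exact: sU.
have [n hn] := open_cylinder Uo Uu M0.
exists (mkseq (u : nat -> alphabet) (n * M)) => //=; last by rewrite /cylinder /= size_mkseq.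
by split=> //; rewrite size_mkseq dvdn_mull.
Qed.

Lemma cylinder_measurable s : measurable (cylinder s).
Proof. by apply: sub_sigma_algebra; exact: cylinder_open. Qed.

Lemma symbolic_blocksE M : (0 < M)%N ->
  @measurable _ (symbolic l0) = <<s blocks M >>.
Proof.
move=> M0; apply/seteqP; split.
  apply: smallest_sub; first exact: smallest_sigma_algebra.
  move=> U Uo; rewrite (open_bigcup_cylinder Uo M0) bigcup_mkcond.
  have := @countable_bigcupT_measurable _ (g_sigma_algebraType (blocks M)) (seq alphabet).
  apply; first exact: countableP.
  move=> s; case: ifPn => [|_]; last exact: measurable0.
  rewrite inE => -[sM _]; apply: sub_sigma_algebra; right; exists s => //.
apply: smallest_sub; first exact: sigma_algebra_measurable.
move=> _ [->|[s _ ->]]; [exact: measurable0|exact: cylinder_measurable].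
Qed.

Lemma blocks_setI M : setI_closed (blocks M).
Proof.
move=> A B [->|[s sM ->]]; first by rewrite set0I; left.
move=> [->|[t tM ->]]; first by rewrite setI0; left.
have [E0|/set0P[u [su tu]]] := eqVneq (cylinder s `&` cylinder t) set0.
  by left.
have [st|/ltnW ts] := leqP (size s) (size t).
  have [t' tE] := cylinderI_eq su tu st; right; exists t => //.
  by rewrite setIC; apply/setIidPl; rewrite tE; exact: cylinder_cat.
have [s' sE] := cylinderI_eq tu su ts; right; exists s => //.
by apply/setIidPl; rewrite sE; exact: cylinder_cat.
Qed.

Lemma symbolic_measure_unique M (m1 m2 : {measure set (symbolic l0) -> \bar R}) :
  (0 < M)%N -> (m1 setT < +oo)%E ->
  (forall s, (M %| size s)%N -> m1 (cylinder s) = m2 (cylinder s)) ->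
  forall A, measurable A -> m1 A = m2 A.
Proof.
move=> M0 m1oo m12; have cT : cylinder [::] = setT by apply/seteqP; split.
apply: (measure_unique (blocks M) (fun=> setT)) => //.
- exact: symbolic_blocksE.
- exact: blocks_setI.
- by move=> _; right; exists [::].
- by rewrite bigcup_const.
- by move=> A [->|[s sM ->]]; [rewrite !measure0|exact: m12].
Qed.

Lemma finite_word_measurable d (Y : measurableType d) n (h : symbolic l0 -> Y) :
  (forall u v : symbolic l0, mkseq (u : nat -> alphabet) n = mkseq v n -> h u = h v) ->
  measurable_fun setT h.
Proof.
move=> hn _ B _; rewrite setTI.
have -> : h @^-1` B = \bigcup_(s in [set s | size s = n /\ cylinder s `<=` h @^-1` B]) cylinder s.
  apply/seteqP; split=> [u hu|u [s [_ sB] su]]; last exact: sB.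
  exists (mkseq (u : nat -> alphabet) n); last by rewrite /cylinder /= size_mkseq.
  split; first by rewrite size_mkseq.
  by move=> v; rewrite /cylinder /= size_mkseq => /hn; rewrite /= => ->.
rewrite bigcup_mkcond; apply: countable_bigcupT_measurable; first exact: countableP.
by move=> s; case: ifPn => _; [exact: cylinder_measurable|exact: measurable0].
Qed.

Lemma shift_measurable : measurable_fun setT (@symb_shift K L l0).
Proof.
apply: (@measurability _ _ _ _ _ _ (blocks 1)); first exact: symbolic_blocksE.
move=> _ [_ [->|[s _ ->]] <-]; first by rewrite preimage_set0 setI0; exact: measurable0.
rewrite setTI.
have -> : @symb_shift K L l0 @^-1` cylinder s = \bigcup_a cylinder (a :: s).
  apply/seteqP; split=> [u h|u [a _ h]].
    exists (u 0%N) => //; change (mkseq (u : nat -> alphabet) (size s).+1 = u 0%N :: s).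
    by rewrite mkseq_cons; congr cons; exact: h.
  have {h} : mkseq (u : nat -> alphabet) (size s).+1 = a :: s by exact: h.
  by rewrite mkseq_cons => -[].
apply: countable_bigcupT_measurable; first exact: countableP.
by move=> a; exact: cylinder_measurable.
Qed.

Lemma iter_shiftE n (u : symbolic l0) m : iter n (@symb_shift K L l0) u m = u (n + m)%N.
Proof. by elim: n m => //= n IH m; rewrite /symb_shift IH addnS. Qed.

Lemma iter_shift_measurable n : measurable_fun setT (iter n (@symb_shift K L l0)).
Proof.
elim: n => [|n IH]; first exact: measurable_id.
by apply: measurableT_comp IH; exact: shift_measurable.
Qed.

End symbolic_space.

Section finite_unions.
Context d (R : realType) (T : measurableType d) (m : {measure set T -> \bar R}).
Variables (I : eqType) (F : I -> set T).
Hypothesis mF : forall i, measurable (F i).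

Lemma bigcup_cons_seq i (s : seq I) :
  \bigcup_(j in [set` i :: s]) F j = F i `|` \bigcup_(j in [set` s]) F j.
Proof.
apply/seteqP; split=> [x [j /=]|x [Fi|[j js Fj]]].
- by rewrite inE => /orP[/eqP ->|js] Fj; [left|right; exists j].
- by exists i => //=; rewrite inE eqxx.
- by exists j => //=; rewrite inE js orbT.
Qed.

Lemma measurable_bigcup_seq (s : seq I) : measurable (\bigcup_(i in [set` s]) F i).
Proof.
elim: s => [|i s IH]; first by rewrite set_nil bigcup_set0; exact: measurable0.
by rewrite bigcup_cons_seq; exact: measurableU.
Qed.

Lemma measure_bigcup_seq (s : seq I) : uniq s ->
  (forall i j, i \in s -> j \in s -> i != j -> F i `&` F j = set0) ->
  m (\bigcup_(i in [set` s]) F i) = (\sum_(i <- s) m (F i))%E.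
Proof.
elim: s => [_ _|i s IH /= /andP[inot us] hd].
  by rewrite set_nil bigcup_set0 measure0 big_nil.
rewrite bigcup_cons_seq measureU //; last 2 first.
- exact: measurable_bigcup_seq.
- rewrite -subset0 => x [Fi [j /= js Fj]].
  have ij : i != j by apply: contraNneq inot => ->.
  have : (F i `&` F j) x by [].
  by rewrite hd // inE ?eqxx ?js ?orbT.
by rewrite big_cons -IH // => j k js ks; apply: hd; rewrite inE ?js ?ks orbT.
Qed.

Lemma measure_bigcup_seq_le (s : seq I) :
  (m (\bigcup_(i in [set` s]) F i) <= \sum_(i <- s) m (F i))%E.
Proof.
elim: s => [|i s IH]; first by rewrite set_nil bigcup_set0 measure0 big_nil.
rewrite bigcup_cons_seq big_cons.
apply: le_trans (measureU2 _ _ _) _ => //; first exact: measurable_bigcup_seq.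
exact: leeD2l.
Qed.

End finite_unions.

(** * Digits of a Lebesgue random point *)

Section digits.
Context {R : realType} (T : finType) (t0 : T).

Notation tau := (#|T|%:R : R).

Definition digit (x : R) : T := nth t0 (enum T) (Num.truncn (tau * x)).

Definition digit_tail (x : R) : R := tau * x - (Num.truncn (tau * x))%:R.

Definition digits (x : R) (m : nat) : T := digit (iter m digit_tail x).

(** The left end of the interval of order [size s] in base [#|T|] that [s] labels. *)
Definition digits_low (s : seq T) : R :=
  foldr (fun t c => ((index t (enum T))%:R + c) / tau) 0 s.

Let tau0 : 0 < tau. Proof. by rewrite ltr0n; apply/card_gt0P; exists t0. Qed.

Lemma digits_low_bounds s : 0 <= digits_low s /\ digits_low s + tau ^- size s <= 1.
Proof.
elim: s => [|t s [IH1 IH2]] /=; first by rewrite expr0 invr1 add0r.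
have it : (index t (enum T))%:R + 1 <= tau.
  by rewrite natr1 ler_nat cardE index_mem mem_enum.
split; first by rewrite divr_ge0 ?addr_ge0 // ltW.
have -> : tau ^- (size s).+1 = tau ^- size s / tau by rewrite exprS invfM mulrC.
by rewrite -mulrDl ler_pdivrMr // mul1r; lra.
Qed.

Lemma digits_cons x n : mkseq (digits x) n.+1 = digit x :: mkseq (digits (digit_tail x)) n.
Proof.
rewrite /mkseq /= (iotaDl 1) -map_comp; congr cons; apply: eq_map => m /=.
by rewrite /digits -iterSr.
Qed.

Lemma digit_tail_itv x : 0 <= x < 1 -> 0 <= digit_tail x < 1.
Proof.
move=> /andP[x0 x1]; have tx : 0 <= tau * x by rewrite mulr_ge0 // ltW.
have /andP[h1 h2] := truncn_itv tx; rewrite /digit_tail.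
by rewrite -natr1 in h2; apply/andP; split; lra.
Qed.

(** The first digit selects one of [#|T|] equal subintervals of [0,1[, which [digit_tail] rescales
    to [0,1[. *)
Lemma digitsP x s : 0 <= x < 1 ->
  (mkseq (digits x) (size s) == s) =
  (digits_low s <= x < digits_low s + tau ^- size s).
Proof.
elim: s x => [|t s IH] x x01; first by rewrite expr0 invr1 add0r x01 eqxx.
have /andP[x0 x1] := x01; have tx : 0 <= tau * x by rewrite mulr_ge0 // ltW.
rewrite [size _]/= digits_cons eqseq_cons (IH _ (digit_tail_itv x01)) /=.
have /andP[h1 h2] := truncn_itv tx.
have trT : (Num.truncn (tau * x) < #|T|)%N.
  by rewrite -(ltr_nat R); apply: le_lt_trans h1 _; rewrite -[ltRHS]mulr1 ltr_pM2l.
have [c0 c1] := digits_low_bounds s; set c := digits_low s in c0 c1 *.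
set eta := tau ^- size s in c1 *.
have -> : tau ^- (size s).+1 = eta / tau by rewrite exprS invfM mulrC.
rewrite -mulrDl ler_pdivrMr // ltr_pdivlMr //.
rewrite [x * tau]mulrC /digit_tail.
set i := index t _; set n := Num.truncn _ in h1 h2 trT *.
have -> : (digit x == t) = (n == i).
  rewrite /digit -/n /i; apply/eqP/eqP => [<-|->].
    by rewrite index_uniq ?enum_uniq // -cardE.
  by rewrite nth_index // mem_enum.
rewrite -natr1 in h2.
have [->|ni] /= := eqVneq n i.
  by apply/idP/idP => /andP[a1 a2]; apply/andP; split; lra.
apply/esym/negbTE/negP => /andP[a1 a2].
have a3 : tau * x < i%:R + 1 by lra.
have a4 : i%:R <= tau * x by lra.
have n1 : (n <= i)%N by rewrite -ltnS -(ltr_nat R) -[i.+1%:R]natr1; lra.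
have n2 : (i <= n)%N by rewrite -ltnS -(ltr_nat R) -[n.+1%:R]natr1; lra.
by rewrite eqn_leq n1 n2 in ni.
Qed.

Definition unit_lebesgue : set (measurableTypeR R) -> \bar R :=
  mrestr lebesgue_measure (measurable_itv `[0%R, 1%R[).

HB.instance Definition _ := Measure.on unit_lebesgue.

Definition digit_cell (s : seq T) : set (measurableTypeR R) :=
  [set x : R | (0 <= x < 1) && (mkseq (digits x) (size s) == s)].

Lemma digit_cellE s :
  digit_cell s = `[digits_low s, digits_low s + tau ^- size s[%classic.
Proof.
have [c0 c1] := digits_low_bounds s.
apply/seteqP; split=> x; rewrite /digit_cell /= in_itv /=.
  by move=> /andP[x01]; rewrite digitsP.
move=> h; have x01 : 0 <= x < 1 by case/andP: h => h1 h2; apply/andP; split; lra.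
by rewrite digitsP x01.
Qed.

Lemma digit_cell_measurable s : measurable (digit_cell s).
Proof. by rewrite digit_cellE; exact: measurable_itv. Qed.

Lemma unit_lebesgue_cell s : unit_lebesgue (digit_cell s) = (tau ^- size s)%:E.
Proof.
have e0 : 0 < tau ^- size s by rewrite invr_gt0 exprn_gt0.
rewrite /unit_lebesgue /mrestr setIidl; last by move=> x /andP[x01 _]; rewrite /= in_itv.
rewrite digit_cellE lebesgue_measure_itv /= lte_fin ltrDl e0 -EFinB.
by rewrite addrAC subrr add0r.
Qed.

Definition digit_set n (E : {set n.-tuple T}) : set (measurableTypeR R) :=
  \bigcup_(t in [set` enum E]) digit_cell t.

Lemma digit_set_measurable n (E : {set n.-tuple T}) : measurable (digit_set E).
Proof. by apply: measurable_bigcup_seq => t; exact: digit_cell_measurable. Qed.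

Lemma unit_lebesgue_digit_set n (E : {set n.-tuple T}) :
  unit_lebesgue (digit_set E) = (#|E|%:R * tau ^- n)%:E.
Proof.
rewrite /digit_set (measure_bigcup_seq unit_lebesgue) ?enum_uniq //.
- rewrite (eq_bigr (fun=> (tau ^- n)%:E)); last first.
    move=> t _; transitivity ((tau ^- size t)%:E); last by rewrite size_tuple.
    exact: unit_lebesgue_cell.
  by rewrite sumEFin big_const_seq count_predT -cardE iter_addr addr0 mulr_natl.
- by move=> t; exact: digit_cell_measurable.
move=> t t' _ _ tt'; rewrite -subset0 => x [/andP[_ /eqP h1] /andP[_ /eqP h2]].
by case/eqP: tt'; apply: val_inj; rewrite /= -h1 -h2 !size_tuple.
Qed.

Lemma digit_setP n (E : {set n.-tuple T}) (x : R) : 0 <= x < 1 ->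
  digit_set E x <-> mktuple (fun i : 'I_n => digits x i) \in E.
Proof.
move=> x01; have mE : mkseq (digits x) n = mktuple (fun i : 'I_n => digits x i).
  by rewrite /mkseq -val_enum_ord -map_comp.
split=> [[t /=]|xE].
  rewrite mem_enum => tE /andP[_ /eqP]; rewrite size_tuple mE => h.
  by have -> : mktuple (fun i : 'I_n => digits x i) = t by exact: val_inj.
exists (mktuple (fun i : 'I_n => digits x i)); first by rewrite /= mem_enum.
by apply/andP; split=> //; rewrite size_tuple mE.
Qed.

End digits.

Section image_measure.
Context d d' (R : realType) (T1 : measurableType d) (T2 : measurableType d').
Variables (m : {measure set T1 -> \bar R}) (f : T1 -> T2).

Definition image_measure (mf : measurable_fun setT f) : {measure set T2 -> \bar R}.
Proof. refine (pushforward m f : {measure set T2 -> \bar R}); exact: mf. Defined.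

Lemma image_measureE (mf : measurable_fun setT f) A : image_measure mf A = m (f @^-1` A).
Proof. by []. Qed.

End image_measure.

Section block_measure.
Context {R : realType} (K : finType) (L : {set K}) (l0 : {l | l \in L}).
Context (T : finType) (t0 : T) (M : nat) (bw : T -> seq K).
Hypothesis M0 : (0 < M)%N.
Hypothesis hbw : forall t, size (bw t) = M /\ {subset bw t <= L}.

Notation alphabet := {l | l \in L}.
Notation tau := (#|T|%:R : R).
Notation shift := (@symb_shift K L l0).

Definition block_letter (t : T) (j : nat) : alphabet := insubd l0 (nth (val l0) (bw t) j).

Definition block_word (t : T) : seq alphabet := mkseq (block_letter t) M.

Lemma map_val_block_word t : map val (block_word t) = bw t.
Proof.
have [sM sL] := hbw t; rewrite /block_word /mkseq -map_comp.
rewrite -[RHS](mkseq_nth (val l0)) sM /mkseq; apply/eq_in_map => j.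
rewrite mem_iota /= add0n => jM; rewrite /block_letter val_insubd.
by rewrite sL // mem_nth // sM.
Qed.

(** Letter [m] sits in block [m %/ M] at place [m %% M]. The value outside [0,1[ is arbitrary, as
    [unit_lebesgue] does not charge it. *)
Definition block_code (x : measurableTypeR R) : symbolic l0 := fun m =>
  if (0 <= x < 1) then block_letter (digits t0 x (m %/ M)) (m %% M)%N else l0.

Lemma block_codeE (x : R) k l : 0 <= x < 1 ->
  mkseq (fun i => block_code x (k * M + i)%N) (l * M) =
  flatten (map block_word (mkseq (fun m => digits t0 x (k + m)%N) l)).
Proof.
move=> x01; elim: l => [|l IH] //.
rewrite mulSn addnC mkseq_add IH mkseqS map_rcons flatten_rcons; congr cat.
apply/eq_in_map => i; rewrite mem_iota /= add0n => iM.
by rewrite /block_code x01 addnA -mulnDl divnMDl // divn_small // addn0 modnMDl modn_small.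
Qed.

(** Different sequences of blocks may spell the same word, so the mass of a cylinder is a count. *)
Definition block_fiber l (s : seq alphabet) : {set l.-tuple T} :=
  [set t : l.-tuple T | flatten (map block_word t) == s]%SET.

Lemma block_code_cylinder (x : R) l s : 0 <= x < 1 -> size s = (l * M)%N ->
  @cylinder K L l0 s (block_code x) <-> digit_set t0 (block_fiber l s) x.
Proof.
move=> x01 sl; rewrite digit_setP // finset.inE /cylinder /= sl.
have := block_codeE 0 l x01; rewrite mul0n => h.
have -> : mkseq (block_code x : nat -> alphabet) (l * M) =
    flatten (map block_word (mkseq (fun m => digits t0 x (0 + m)%N) l)) by exact: h.
have -> : mkseq (fun m => digits t0 x (0 + m)%N) l = [tuple digits t0 x i | i < l].
  by rewrite /mkseq -val_enum_ord -map_comp.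
by split=> [->|/eqP].
Qed.

Lemma block_code_measurable : measurable_fun setT block_code.
Proof.
apply: (@measurability _ _ _ _ _ _ (@blocks K L l0 M)); first exact: symbolic_blocksE.
move=> _ [_ [->|[s /dvdnP[l sl] ->]] <-].
  by rewrite preimage_set0 setI0; exact: measurable0.
rewrite setTI; pose I01 : set (measurableTypeR R) := `[0%R, 1%R[%classic.
pose u0 : symbolic l0 := fun=> l0.
(* The complement of [0,1[ is sent to the constant sequence, hence lies entirely inside or outside
   the preimage. *)
have -> : block_code @^-1` @cylinder K L l0 s = (digit_set t0 (block_fiber l s) `&` I01) `|`
    (~` I01 `&` [set _ | @cylinder K L l0 s u0]).
  apply/seteqP; split=> x; rewrite /I01 /=.
    have [x01|x01] := boolP (0 <= x < 1) => h.
      by left; split; [apply/(block_code_cylinder x01 sl)|rewrite /= in_itv].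
    right; split; first by rewrite /= in_itv; exact/negP.
    have <- : block_code x = u0 by apply/funext => m; rewrite /block_code (negPf x01).
    exact: h.
  case=> -[]; rewrite /= in_itv /=.
    by move=> h x01; apply/(block_code_cylinder x01 sl).
  move=> /negP x01 h.
  have -> : block_code x = u0 by apply/funext => m; rewrite /block_code (negPf x01).
  exact: h.
apply: measurableU; apply: measurableI.
- exact: digit_set_measurable.
- exact: measurable_itv.
- by apply: measurableC; exact: measurable_itv.
have [c|c] := pselect (@cylinder K L l0 s u0).
  have -> : [set _ : measurableTypeR R | @cylinder K L l0 s u0] = setT by apply/seteqP; split.
  exact: measurableT.
have -> : [set _ : measurableTypeR R | @cylinder K L l0 s u0] = set0 by apply/seteqP; split.
exact: measurable0.
Qed.

Definition leb : {measure set (measurableTypeR R) -> \bar R} := unit_lebesgue.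

(* The digits in base [#|T|] of a Lebesgue random point of [0, 1[ are independent
   and uniform, so this is the law of a concatenation of independent uniform
   blocks. *)
Definition block_measure : {measure set (symbolic l0) -> \bar R} :=
  image_measure leb block_code_measurable.

Lemma lebI01 (S : set (measurableTypeR R)) : leb S = leb (S `&` `[0%R, 1%R[%classic).
Proof. by rewrite /leb /= /unit_lebesgue /mrestr -setIA setIid. Qed.

Lemma leb_cylinder l s : size s = (l * M)%N ->
  block_measure (@cylinder K L l0 s) = (#|block_fiber l s|%:R * tau ^- l)%:E.
Proof.
move=> sl; rewrite image_measureE -(unit_lebesgue_digit_set t0) -/leb.
rewrite lebI01 [RHS]lebI01; congr (leb _); apply/seteqP; split=> x [h x01].
  have x01' : 0 <= x < 1 by move: x01; rewrite /= in_itv.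
  by split=> //; have [h1 _] := block_code_cylinder x01' sl; exact: h1.
have x01' : 0 <= x < 1 by move: x01; rewrite /= in_itv.
by split=> //; have [_ h1] := block_code_cylinder x01' sl; exact: h1.
Qed.

Lemma block_measureT : block_measure setT = 1%E.
Proof.
have -> : setT = @cylinder K L l0 [::] by apply/seteqP; split.
rewrite (@leb_cylinder 0%N) // expr0 invr1 mulr1.
have -> : block_fiber 0 [::] = [set: 0.-tuple T]%SET.
  by apply/setP => t; rewrite !finset.inE tuple0.
by rewrite cardsT card_tuple expn0.
Qed.

Lemma block_measure_lty A : measurable A -> (block_measure A < +oo)%E.
Proof.
move=> mA; apply: le_lt_trans (ltry 1); rewrite -[X in (_ <= X)%E]/(1%E) -block_measureT.
by apply: le_measure => //; rewrite ?inE //; exact: measurableT.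
Qed.

Lemma leb_digit_split l (E : {set l.-tuple T}) S : measurable S ->
  leb (S `&` digit_set t0 E) = (\sum_(t in E) leb (S `&` digit_cell t0 t))%E.
Proof.
move=> mS; rewrite /digit_set setI_bigcupr measure_bigcup_seq ?enum_uniq //.
- by rewrite big_enum.
- by move=> t; apply: measurableI => //; exact: digit_cell_measurable.
move=> t t' _ _ tt'; rewrite -subset0 => x [[_ /andP[_ /eqP h1]] [_ /andP[_ /eqP h2]]].
by case/eqP: tt'; apply: val_inj; rewrite /= -h1 -h2 !size_tuple.
Qed.

Lemma iter_shift_code_cylinder (x : R) k l s : 0 <= x < 1 -> size s = (l * M)%N ->
  @cylinder K L l0 s (iter (k * M) shift (block_code x)) <->
  flatten (map block_word (mkseq (fun m => digits t0 x (k + m)%N) l)) = s.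
Proof.
move=> x01 sl; rewrite -block_codeE // /cylinder /= sl.
have -> : mkseq (iter (k * M) shift (block_code x) : nat -> alphabet) (l * M) =
    mkseq (fun i => block_code x (k * M + i)%N) (l * M).
  by apply: eq_mkseq => i; rewrite iter_shiftE.
by [].
Qed.

(** As functions of [A] both sides are finite measures, so it is enough to compare them on cylinders
    of whole blocks, where the digit words are concatenated. *)
Lemma block_independence l (t : l.-tuple T) A : measurable A ->
  leb (block_code @^-1` (iter (l * M) shift @^-1` A) `&` digit_cell t0 t) =
  ((tau ^- l)%:E * block_measure A)%E.
Proof.
have r0 : 0 <= tau ^- l by rewrite invr_ge0 exprn_ge0.
have mf : measurable_fun setT (fun x => iter (l * M) shift (block_code x)).
  by apply: measurableT_comp block_code_measurable; exact: iter_shift_measurable.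
pose m1 := image_measure (mrestr leb (digit_cell_measurable t0 t)) mf.
pose m2 : {measure set (symbolic l0) -> \bar R} := mscale (NngNum r0) block_measure.
move=> mA; have := @symbolic_measure_unique R K L l0 M m1 m2 M0; apply => //.
  rewrite /m1 image_measureE /= /mrestr preimage_setT setTI.
  by rewrite unit_lebesgue_cell ltry.
move=> s /dvdnP[l' sl]; rewrite /m1 /m2 image_measureE /= /mscale /=.
rewrite [X in (_ * X)%E](leb_cylinder sl).
pose E : {set (l + l').-tuple T} := [set cat_tuple t t' | t' in block_fiber l' s]%SET.
have cE : #|E| = #|block_fiber l' s|.
  apply: card_imset => u v /(congr1 val) /= /eqP.
  by rewrite eqseq_cat // eqxx /= => /eqP; exact: val_inj.
rewrite -EFinM mulrCA -invfM -exprD -cE -(unit_lebesgue_digit_set t0).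
rewrite /mrestr -[LHS]/(leb _) -[RHS]/(leb _) lebI01 [RHS]lebI01; congr (leb _).
have key (x : R) : 0 <= x < 1 -> (cylinder (l0 := l0) s (iter (l * M) shift (block_code x)) /\
    digit_cell t0 t x) <-> digit_set t0 E x.
  move=> x01; have dc : digit_cell t0 t x <-> mkseq (digits t0 x) l = t.
    by rewrite /digit_cell /mkset x01 size_tuple /=; split=> /eqP.
  have cc := iter_shift_code_cylinder l x01 sl.
  rewrite digit_setP //.
  have catE : [tuple digits t0 x i | i < l + l'] =
      mkseq (digits t0 x) l ++ mkseq (fun m => digits t0 x (l + m)%N) l' :> seq T.
    by rewrite -mkseq_add /mkseq -val_enum_ord -map_comp.
  split=> [[/cc h /dc ht]|/imsetP[t' +]].
    apply/imsetP; exists [tuple digits t0 x (l + i)%N | i < l'].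
      rewrite finset.inE; apply/eqP; rewrite -h; congr (flatten (map _ _)).
      by rewrite /mkseq -val_enum_ord -map_comp.
    apply: val_inj; apply: (etrans catE); rewrite ht /=; congr cat.
    by rewrite /mkseq -val_enum_ord -map_comp.
  rewrite finset.inE => /eqP ft' /(congr1 val) h; have /eqP := etrans (esym catE) h.
  rewrite eqseq_cat ?size_mkseq ?size_tuple // => /andP[/eqP ht /eqP ht'].
  by split; [apply/cc; rewrite ht'|apply/dc].
apply/seteqP; split=> x [h x01].
  have x01' : 0 <= x < 1 by move: x01; rewrite /= in_itv.
  by split=> //; apply/(key x x01').
have x01' : 0 <= x < 1 by move: x01; rewrite /= in_itv.
by split=> //; apply/(key x x01').
Qed.

Lemma preimage_code_measurable A : measurable A -> measurable (block_code @^-1` A).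
Proof.
by move=> mA; rewrite -[X in measurable X]setTI; apply: block_code_measurable.
Qed.

Lemma preimage_shift_measurable n (A : set (symbolic l0)) :
  measurable A -> measurable (iter n shift @^-1` A).
Proof.
by move=> mA; rewrite -[X in measurable X]setTI; apply: iter_shift_measurable.
Qed.

Lemma leb_digit_set_codeI l (E : {set l.-tuple T}) A : measurable A ->
  leb (block_code @^-1` (iter (l * M) shift @^-1` A) `&` digit_set t0 E) =
  ((#|E|%:R * tau ^- l)%:E * block_measure A)%E.
Proof.
move=> mA; rewrite leb_digit_split; last first.
  by apply: preimage_code_measurable; exact: preimage_shift_measurable.
under eq_bigr => t _ do rewrite block_independence //.
have fA : block_measure A \is a fin_num.
  by rewrite ge0_fin_numE; [exact: block_measure_lty|exact: measure_ge0].
by rewrite -(fineK fA) -!EFinM sumEFin sumr_const -mulrnAl mulr_natl.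
Qed.

(** Independence of the first block, summed over all its values. *)
Lemma block_measure_invariant A : measurable A ->
  block_measure (iter M shift @^-1` A) = block_measure A.
Proof.
move=> mA; rewrite image_measureE.
have := leb_digit_set_codeI [set: 1.-tuple T]%SET mA; rewrite mul1n.
rewrite cardsT card_tuple expn1 expr1 divff; last first.
  by rewrite pnatr_eq0 -lt0n; apply/card_gt0P; exists t0.
rewrite mul1e => <-; rewrite [LHS]lebI01 [RHS]lebI01; congr (leb _).
apply/seteqP; split=> x [h x01]; last by split=> //; case: h.
split=> //; split=> //; apply/digit_setP; last by rewrite finset.inE.
by move: x01; rewrite /= in_itv.
Qed.

(* Since [A] is its own preimage under every iterate of the shift, it is
   independent of all cylinders, hence of itself. *)
Lemma block_measure_01 A : measurable A -> shift @^-1` A = A ->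
  block_measure A = 0%E \/ block_measure A = 1%E.
Proof.
move=> mA sA; have iA n : iter n shift @^-1` A = A.
  elim: n => //= n IH; rewrite -[RHS]IH -[in RHS]sA.
  by apply/seteqP; split=> u /=; rewrite -iterS.
have fA : block_measure A \is a fin_num.
  by rewrite ge0_fin_numE; [exact: block_measure_lty|exact: measure_ge0].
have r0 : 0 <= fine (block_measure A) by rewrite fine_ge0.
pose m1 : {measure set (symbolic l0) -> \bar R} := mrestr block_measure mA.
pose m2 : {measure set (symbolic l0) -> \bar R} := mscale (NngNum r0) block_measure.
have : m1 A = m2 A.
  have := @symbolic_measure_unique R K L l0 M m1 m2 M0; apply => //.
    by rewrite /m1 /= /mrestr setTI block_measure_lty.
  move=> s /dvdnP[l sl]; rewrite /m1 /m2 /= /mrestr /mscale /=.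
  rewrite [X in (_ * X)%E](leb_cylinder sl) fineK // muleC.
  rewrite -leb_digit_set_codeI // iA.
  transitivity (leb (block_code @^-1` A `&` block_code @^-1` (@cylinder K L l0 s))).
    by rewrite setIC.
  rewrite [LHS]lebI01 [RHS]lebI01; congr (leb _); apply/seteqP; split=> x [[h1 h2] x01].
    have x01' : 0 <= x < 1 by move: x01; rewrite /= in_itv.
    by split=> //; split=> //; have [h _] := block_code_cylinder x01' sl; exact: h.
  have x01' : 0 <= x < 1 by move: x01; rewrite /= in_itv.
  by split=> //; split=> //; have [_ h] := block_code_cylinder x01' sl; exact: h.
rewrite /m1 /m2 /= /mrestr /mscale /= setIid fineK // -(fineK fA) -EFinM => -[].
move: (fine _) => r rr; have /eqP : r * (r - 1) = 0 by rewrite mulrBr mulr1 -rr subrr.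
by rewrite mulf_eq0 subr_eq0 => /orP[] /eqP ->; [left|right].
Qed.

End block_measure.

Section shift_average.
Context {R : realType} (K : finType) (L : {set K}) (l0 : {l | l \in L}).
Variables (nu0 : {measure set (symbolic l0) -> \bar R}) (M : nat).
Hypothesis M0 : (0 < M)%N.
Notation shift := (@symb_shift K L l0).
Hypothesis nu0T : nu0 setT = 1%E.
Hypothesis nu0M : forall A, measurable A -> nu0 (iter M shift @^-1` A) = nu0 A.
Hypothesis nu001 : forall A, measurable A -> shift @^-1` A = A ->
  nu0 A = 0%E \/ nu0 A = 1%E.

Let r0 : 0 <= (M%:R : R)^-1. Proof. by rewrite invr_ge0. Qed.

(* [nu0] is only invariant under [shift^M]; averaging over a period makes it
   shift-invariant. *)
Definition shift_average : set (symbolic l0) -> \bar R :=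
  msum (fun j => mscale (NngNum r0) (image_measure nu0 (@iter_shift_measurable K L l0 j))) M.

HB.instance Definition _ := Measure.on shift_average.

Lemma shift_averageE A : shift_average A =
  (\sum_(j < M) (M%:R^-1)%:E * nu0 (iter j shift @^-1` A))%E.
Proof. by []. Qed.

Let average_const (x : \bar R) : x \is a fin_num ->
  (\sum_(j < M) (M%:R^-1)%:E * x = x)%E.
Proof.
move=> fx; rewrite -(fineK fx) -EFinM sumEFin sumr_const card_ord -[_ *+ M]mulr_natl.
by rewrite mulrA divff ?mul1r // pnatr_eq0 -lt0n.
Qed.

Lemma shift_averageT : shift_average setT = 1%E.
Proof.
rewrite shift_averageE; under eq_bigr do rewrite preimage_setT nu0T.
exact: average_const.
Qed.

HB.instance Definition _ :=
  Measure_isProbability.Build _ _ R shift_average shift_averageT.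

Definition shift_average_prob : probability (symbolic l0) R := shift_average.

(** Shifting replaces the term of index 0 by that of index [M], which has the same value. On a
    shift-invariant set the average equals [nu0], so the zero-one law is inherited. *)
Lemma shift_average_ergodic : shift_ergodic shift_average_prob.
Proof.
split=> A mA.
  rewrite -[LHS]/(\sum_(j < M) (M%:R^-1)%:E * nu0 (iter j.+1 shift @^-1` A))%E.
  rewrite -[RHS]/(\sum_(j < M) (M%:R^-1)%:E * nu0 (iter j shift @^-1` A))%E.
  move: (nu0M mA); case: M => [|n]; first by rewrite !big_ord0.
  move=> hn; rewrite big_ord_recr [RHS]big_ord_recl /= addeC; congr adde.
  by rewrite [in RHS]/= -hn.
move=> sA; have iA n : iter n shift @^-1` A = A.
  elim: n => //= n IH; rewrite -[RHS]IH -[in RHS]sA.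
  by apply/seteqP; split=> u /=; rewrite -iterS.
have e : shift_average A = nu0 A.
  rewrite shift_averageE; under eq_bigr do rewrite iA.
  by apply: average_const; case: (nu001 mA sA) => ->.
have -> : shift_average_prob A = nu0 A by exact: e.
exact: nu001.
Qed.

End shift_average.

(** * Projection to the carpet *)

Section coding_line.
Context {R : realType} (I : finType) (f : I -> R -> R) (k : R).
Hypothesis f01 : forall i (x : R), x \in `[0, 1] -> f i x \in `[0, 1].
Hypothesis k01 : 0 < k < 1.
Hypothesis fk : forall i (x y : R), x \in `[0, 1] -> y \in `[0, 1] ->
  `|f i x - f i y| <= k * `|x - y|.

Let zero01 : (0 : R) \in `[0, 1]. Proof. by rewrite in_itv /= lexx ler01. Qed.

Lemma itv01_dist_le (x y : R) : x \in `[0, 1] -> y \in `[0, 1] -> `|x - y| <= 1.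
Proof.
by rewrite !in_itv /= ler_norml => /andP[? ?] /andP[? ?]; apply/andP; split; lra.
Qed.

Lemma word_map_dist (w : seq I) (x y : R) : x \in `[0, 1] -> y \in `[0, 1] ->
  `|word_map f w x - word_map f w y| <= k ^+ size w.
Proof.
move=> x01 y01; apply: le_trans (word_map_contract f01 k01 fk w x01 y01) _.
rewrite -[leRHS]mulr1 ler_wpM2l ?itv01_dist_le // exprn_ge0 // ltW //.
by case/andP: k01.
Qed.

Definition code1 (i : nat -> I) : R := limn (fun n => word_map f (mkseq i n) 0).

Lemma power_small (e : R) : 0 < e -> exists N, forall n, (N <= n)%N -> k ^+ n <= e.
Proof.
move=> e0; have e1 : 0 < Num.min e 1 <= 1 by rewrite lt_min e0 ltr01 ge_min lexx orbT.
have [l [hl _ _]] := geometric_level k01 e1; exists l => n ln.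
apply: le_trans (_ : k ^+ l <= e); last by move: hl; rewrite le_min => /andP[].
by case/andP: k01 => k0 k1; rewrite ler_wiXn2l // ltW.
Qed.

(** The images of [0,1] are nested with diameters at most [k ^+ n], so every starting point gives
    the same limit. This freedom is used to start in the attractor. *)
Lemma code1_cvg i (y : R) : y \in `[0, 1] ->
  word_map f (mkseq i n) y @[n --> \oo] --> code1 i.
Proof.
have mono m n x z : x \in `[0, 1] -> z \in `[0, 1] -> (m <= n)%N ->
    `|word_map f (mkseq i m) z - word_map f (mkseq i n) x| <= k ^+ m.
  move=> x01 z01 mn; rewrite -(subnKC mn) mkseq_add word_map_cat.
  by have := word_map_dist (mkseq i m) z01 (word_map01 f01 _ x01);
    rewrite size_mkseq => /(_ _); apply.
have c0 : cvgn (fun n => word_map f (mkseq i n) 0).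
  apply/cauchy_cvgP/cauchy_exP => e e0.
  have [N hN] := power_small (divr_gt0 e0 (ltr0n R 2)).
  exists (word_map f (mkseq i N) 0); exists N => // n /= Nn.
  rewrite /ball /=; apply: le_lt_trans (mono _ _ _ _ zero01 zero01 Nn) _.
  by apply: le_lt_trans (hN N (leqnn N)) _; lra.
move=> y01; apply/cvgrPdist_le => e e0.
have e20 : 0 < e / 2 by rewrite divr_gt0.
have [N hN] := power_small e20.
move/cvgrPdist_le : (c0) => /(_ _ e20) [N' _ hN'].
exists (maxn N N') => // n /= hn.
have h1 : (N <= n)%N by apply: leq_trans hn; rewrite leq_maxl.
have h2 : (N' <= n)%N by apply: leq_trans hn; rewrite leq_maxr.
have h3 := hN' n h2.
have h4 := le_trans (mono _ _ _ _ y01 zero01 (leqnn n)) (hN n h1).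
rewrite /code1; move: h3 h4; rewrite /= !ler_norml => /andP[? ?] /andP[? ?].
apply/andP; split; lra.
Qed.

Lemma code1_01 i : code1 i \in `[0, 1].
Proof.
have c := code1_cvg (i := i) zero01.
have in01 n : word_map f (mkseq i n) 0 \in `[0, 1] by exact: word_map01.
rewrite in_itv /=; apply/andP; split.
  rewrite -(cvg_lim (@Rhausdorff R) c); apply: limr_ge; first by apply/cvg_ex; exists (code1 i).
  by apply: nearW => n; have := in01 n; rewrite in_itv => /andP[].
rewrite -(cvg_lim (@Rhausdorff R) c); apply: limr_le; first by apply/cvg_ex; exists (code1 i).
by apply: nearW => n; have := in01 n; rewrite in_itv => /andP[].
Qed.

Lemma code1_shift i n :
  code1 i = word_map f (mkseq i n) (code1 (fun m => i (n + m)%N)).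
Proof.
set j := fun m => i (n + m)%N.
have c := code1_cvg (i := j) zero01.
have c' : word_map f (mkseq i m) 0 @[m --> \oo] --> word_map f (mkseq i n) (code1 j).
  apply/cvgrPdist_le => e e0; move/cvgrPdist_le : c => /(_ _ e0) [N _ hN].
  exists (n + N)%N => // m /= hm.
  have nm : (n <= m)%N by apply: leq_trans hm; rewrite leq_addr.
  rewrite -(subnKC nm) mkseq_add word_map_cat.
  have h : (N <= m - n)%N by rewrite leq_subRL.
  apply: le_trans (hN _ h).
  apply: le_trans (word_map_contract f01 k01 fk _ (code1_01 j) (word_map01 f01 _ zero01)) _.
  rewrite -[leRHS]mul1r ler_wpM2r // exprn_ile1 // ltW //; by case/andP: k01.
exact: (cvg_lim (@Rhausdorff R) c').
Qed.

End coding_line.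

Section coding_plane.
Context {R : realType} (I J : finType) (f : I -> R -> R) (g : J -> R -> R).
Context (L : {set I * J}) (l0 : {l | l \in L}) (k : R).
Hypothesis f01 : forall i (x : R), x \in `[0, 1] -> f i x \in `[0, 1].
Hypothesis g01 : forall i (x : R), x \in `[0, 1] -> g i x \in `[0, 1].
Hypothesis k01 : 0 < k < 1.
Hypothesis fk : forall i (x y : R), x \in `[0, 1] -> y \in `[0, 1] ->
  `|f i x - f i y| <= k * `|x - y|.
Hypothesis gk : forall i (x y : R), x \in `[0, 1] -> y \in `[0, 1] ->
  `|g i x - g i y| <= k * `|x - y|.

Notation code := (@coding R I J f g L l0).
Notation shift := (@symb_shift _ L l0).

Definition letters1 (u : symbolic l0) (n : nat) : I := (val (u n : {l | l \in L})).1.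
Definition letters2 (u : symbolic l0) (n : nat) : J := (val (u n : {l | l \in L})).2.

Lemma codingE u : code u = (code1 f (letters1 u), code1 g (letters2 u)).
Proof.
rewrite /coding /code1; congr (limn _, limn _); apply/funext => n;
  by rewrite word_map_carpet /= /unzip1 /unzip2 /mkseq -map_comp.
Qed.

(** Each coordinate is a pointwise limit of functions of finitely many letters. *)
Lemma coding_measurable : measurable_fun setT code.
Proof.
have -> : code = (fun u => (code1 f (letters1 u), code1 g (letters2 u))).
  by apply/funext => u; exact: codingE.
have zero01 : (0 : R) \in `[0, 1] by rewrite in_itv /= lexx ler01.
apply: measurable_fun_pair.
  apply: (@measurable_realfun.measurable_fun_cvg _ _ _ _
    (fun n (u : symbolic l0) => word_map f (mkseq (letters1 u) n) 0)).
    move=> n; apply: (@finite_word_measurable _ _ _ _ _ n) => u v uv; congr (word_map f _ 0).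
    have := congr1 (map (fun l : {l | l \in L} => (val l).1)) uv.
    by rewrite /mkseq -!map_comp.
  by move=> u _; exact: (code1_cvg f01 k01 fk).
apply: (@measurable_realfun.measurable_fun_cvg _ _ _ _
    (fun n (u : symbolic l0) => word_map g (mkseq (letters2 u) n) 0)).
  move=> n; apply: (@finite_word_measurable _ _ _ _ _ n) => u v uv; congr (word_map g _ 0).
  have := congr1 (map (fun l : {l | l \in L} => (val l).2)) uv.
  by rewrite /mkseq -!map_comp.
by move=> u _; exact: (code1_cvg g01 k01 gk).
Qed.

Lemma coding_shift u n :
  code u = (word_map f (mkseq (letters1 u) n) (code (iter n shift u)).1,
            word_map g (mkseq (letters2 u) n) (code (iter n shift u)).2).
Proof.
rewrite !codingE /=; congr pair.
  rewrite (code1_shift f01 k01 fk _ n); congr (word_map f _ (code1 f _)).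
  by apply/funext => m; rewrite /letters1 iter_shiftE.
rewrite (code1_shift g01 k01 gk _ n); congr (word_map g _ (code1 g _)).
by apply/funext => m; rewrite /letters2 iter_shiftE.
Qed.

Lemma coding01 u : (code u).1 \in `[0, 1] /\ (code u).2 \in `[0, 1].
Proof.
by rewrite codingE; split; [exact: (code1_01 f01 k01 fk)|exact: (code1_01 g01 k01 gk)].
Qed.

(** The base point 0 may lie outside [X]; the same limit is reached from a point of [X], whose
    images stay in the closed set [X]. *)
Lemma coding_attractor (X : set (R * R)) u :
  X `<=` `[0, 1]%classic `*` `[0, 1]%classic ->
  is_attractor L (carpet_map f g) X -> X (code u).
Proof.
move=> X01 [[z Xz] Xc XE].
have Xcl : closed X.
  apply: compact_closed => //; exact: norm_hausdorff.
have [z1 z2] := X01 z Xz.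
pose w n := mkseq (fun m => val (u m : {l | l \in L})) n.
have Xw n y : X y -> X (word_map (carpet_map f g) (w n) y).
  move=> Xy; have : {subset w n <= L}.
    by move=> l /mapP[m _ ->]; exact: (valP (u m : {l | l \in L})).
  elim: (w n) => //= l v IH lv; rewrite XE; exists l; first by apply: lv; rewrite inE eqxx.
  by exists (word_map (carpet_map f g) v y) => //;
      apply: IH => m mv; apply: lv; rewrite inE mv orbT.
rewrite codingE; set c1 := code1 f _; set c2 := code1 g _.
have cv : word_map (carpet_map f g) (w n) z @[n --> \oo] --> ((c1, c2) : R * R).
  under eq_fun do rewrite word_map_carpet /w /unzip1 /unzip2 /mkseq -!map_comp.
  have v1 := code1_cvg f01 k01 fk (i := letters1 u) z1.
  have v2 := code1_cvg g01 k01 gk (i := letters2 u) z2.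
  exact: (cvg_pair v1 v2).
have XP : \forall n \near \oo, X (word_map (carpet_map f g) (w n) z).
  by apply: nearW => n; exact: Xw.
exact: (@closed_cvg _ _ _ _ _ X Xcl XP _ cv).
Qed.

End coding_plane.

Section image_probability.
Context d d' (R : realType) (T1 : measurableType d) (T2 : measurableType d').
Variables (P : probability T1 R) (f : T1 -> T2) (mf : measurable_fun setT f).

Definition image_probability : set T2 -> \bar R := image_measure P mf.

HB.instance Definition _ := Measure.on image_probability.

Lemma image_probabilityT : image_probability setT = 1%E.
Proof. by rewrite /image_probability /= /pushforward preimage_setT probability_setT. Qed.

HB.instance Definition _ :=
  Measure_isProbability.Build _ _ R image_probability image_probabilityT.

Definition image_prob : probability T2 R := image_probability.

End image_probability.

(** * Mass of small squares *)

Section carpet_measure.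
Context {R : realType} (I J : finType) (f : I -> R -> R) (g : J -> R -> R).
Context (L : {set I * J}) (l0 : {l | l \in L}) (k : R).
Hypothesis f01 : forall i (x : R), x \in `[0, 1] -> f i x \in `[0, 1].
Hypothesis g01 : forall i (x : R), x \in `[0, 1] -> g i x \in `[0, 1].
Hypothesis k01 : 0 < k < 1.
Hypothesis fk : forall i (x y : R), x \in `[0, 1] -> y \in `[0, 1] ->
  `|f i x - f i y| <= k * `|x - y|.
Hypothesis gk : forall i (x y : R), x \in `[0, 1] -> y \in `[0, 1] ->
  `|g i x - g i y| <= k * `|x - y|.
Context (T : finType) (t0 : T) (M : nat) (bw : T -> seq (I * J)).
Hypothesis M0 : (0 < M)%N.
Hypothesis hbw : forall t, size (bw t) = M /\ {subset bw t <= L}.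
Variables (C s : R).
Hypothesis C0 : 0 < C.
Hypothesis hC : forall r : R, 0 < r <= 1 -> exists l, forall V1 V2 : set R,
  (forall x y, V1 x -> V1 y -> `|x - y| <= r) ->
  (forall x y, V2 x -> V2 y -> `|x - y| <= r) ->
  #|coding_hits f g bw l V1 V2|%:R <= C * r `^ s * #|T|%:R ^+ l.

Notation code := (@coding R I J f g L l0).
Notation shift := (@symb_shift _ L l0).
Notation tau := (#|T|%:R : R).
Notation alphabet := {l | l \in L}.

Let bcode := @block_code R _ L l0 T t0 M bw.
Let nu0 := @block_measure R _ L l0 T t0 M bw M0.

Let tau0 : 0 < tau. Proof. by rewrite ltr0n; apply/card_gt0P; exists t0. Qed.

Let word_nonexp (K : finType) (h : K -> R -> R) :
  (forall i (x : R), x \in `[0, 1] -> h i x \in `[0, 1]) ->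
  (forall i (x y : R), x \in `[0, 1] -> y \in `[0, 1] -> `|h i x - h i y| <= k * `|x - y|) ->
  forall w (x y : R), x \in `[0, 1] -> y \in `[0, 1] ->
  `|word_map h w x - word_map h w y| <= `|x - y|.
Proof.
move=> h01 hk w x y x01 y01; apply: le_trans (word_map_contract h01 k01 hk w x01 y01) _.
rewrite -[leRHS]mul1r ler_wpM2r // exprn_ile1 // ltW //; by case/andP: k01.
Qed.

Definition pulled1 (v : seq alphabet) (B : set (R * R)) : set R :=
  [set x | exists z, [/\ B z, z.1 \in `[0, 1] & x = word_map f (map (fun l => (val l).1) v) z.1]].
Definition pulled2 (v : seq alphabet) (B : set (R * R)) : set R :=
  [set x | exists z, [/\ B z, z.2 \in `[0, 1] & x = word_map g (map (fun l => (val l).2) v) z.2]].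

(** The coded point has two descriptions: it is the image of a point of [B] under the first [j]
    maps, and it lies in the image of the unit square under the first [l] blocks. So these blocks
    hit the transported set, although [j] need not be a multiple of [M]. *)
Lemma block_code_hits (x : R) j l (B : set (R * R)) : 0 <= x < 1 ->
  B (code (iter j shift (bcode x))) ->
  digit_set t0 (coding_hits f g bw l (pulled1 (mkseq (bcode x) j) B)
    (pulled2 (mkseq (bcode x) j) B)) x.
Proof.
move=> x01 Bx; set u := bcode x; apply/digit_setP => //; rewrite finset.inE.
have uE : map val (mkseq (u : nat -> alphabet) (l * M)) =
    flatten (map bw [tuple digits t0 x i | i < l]).
  have h : mkseq (u : nat -> alphabet) (l * M) =
      flatten (map (@block_word _ L l0 T M bw) (mkseq (fun m => digits t0 x (0 + m)%N) l)).
    by have := @block_codeE R _ L l0 T t0 M bw M0 x 0 l x01; rewrite mul0n; exact.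
  rewrite h map_flatten -map_comp; congr flatten.
  have -> : [tuple digits t0 x i | i < l] = mkseq (fun m => digits t0 x (0 + m)%N) l :> seq T.
    by rewrite /mkseq -val_enum_ord -map_comp.
  by apply: eq_map => t /=; rewrite (map_val_block_word _ hbw).
have l1E n : mkseq (letters1 u) n = unzip1 (map val (mkseq (u : nat -> alphabet) n)).
  by rewrite /unzip1 /mkseq -!map_comp.
have l2E n : mkseq (letters2 u) n = unzip2 (map val (mkseq (u : nat -> alphabet) n)).
  by rewrite /unzip2 /mkseq -!map_comp.
have [c1 c2] := coding01 f01 g01 k01 fk gk (iter j shift u).
have [d1 d2] := coding01 f01 g01 k01 fk gk (iter (l * M) shift u).
have sj := coding_shift f01 g01 k01 fk gk u j.
have sl := coding_shift f01 g01 k01 fk gk u (l * M).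
apply/andP; split; apply/asboolP.
  exists (code (iter (l * M) shift u)).1 => //.
  exists (code (iter j shift u)); split=> //.
  rewrite -uE -l1E; have /(congr1 fst) := etrans (esym sl) sj; rewrite /= => ->.
  by rewrite l1E /unzip1 -map_comp.
exists (code (iter (l * M) shift u)).2 => //.
exists (code (iter j shift u)); split=> //.
rewrite -uE -l2E; have /(congr1 snd) := etrans (esym sl) sj; rewrite /= => ->.
by rewrite l2E /unzip2 -map_comp.
Qed.

(* The first [j] letters are fixed arbitrarily: pulling [B] back by the
   corresponding maps yields a set that still has diameter at most [r]. *)
Lemma shifted_code_bound (B : set (measurableTypeR R * measurableTypeR R)) (r : R) j :
  measurable B -> 0 < r <= 1 ->
  (forall z w, B z -> B w -> `|z.1 - w.1| <= r /\ `|z.2 - w.2| <= r) ->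
  (nu0 (iter j shift @^-1` (code @^-1` B)) <=
    (#|{: alphabet}|%:R ^+ j * (C * r `^ s))%:E)%E.
Proof.
move=> mB r01 hB; have [l hl] := hC r01.
pose E (v : j.-tuple alphabet) := coding_hits f g bw l (pulled1 v B) (pulled2 v B).
pose D (v : j.-tuple alphabet) : set (measurableTypeR R) := digit_set t0 (E v).
have mD v : measurable (D v) by exact: digit_set_measurable.
have mcode : measurable (iter j shift @^-1` (code @^-1` B)).
  apply: preimage_shift_measurable; rewrite -[X in measurable X]setTI.
  exact: (coding_measurable f01 g01 k01 fk gk).
have mcode' := preimage_code_measurable t0 bw M0 mcode.
apply: (@le_trans _ _ (leb (\bigcup_(v in [set` enum {: j.-tuple alphabet}]) D v))).
  have -> : nu0 (iter j shift @^-1` (code @^-1` B)) =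
      leb ((bcode @^-1` (iter j shift @^-1` (code @^-1` B))) `&` `[0%R, 1%R[%classic).
    by rewrite -lebI01.
  apply: le_measure; rewrite ?inE.
  - by apply: measurableI => //; exact: measurable_itv.
  - exact: measurable_bigcup_seq.
  move=> x [Bx x01]; have x01' : 0 <= x < 1 by move: x01; rewrite /= in_itv.
  have szj : size (mkseq (bcode x : nat -> alphabet) j) == j by rewrite size_mkseq.
  exists (Tuple szj); first by rewrite /= mem_enum.
  exact: block_code_hits.
apply: le_trans (measure_bigcup_seq_le leb mD _) _.
apply: (@le_trans _ _ (\sum_(v <- enum {: j.-tuple alphabet}) (C * r `^ s)%:E)%E).
  apply: lee_sum => v _; rewrite /D.
  have -> : leb (digit_set t0 (E v)) = (#|E v|%:R * tau ^- l)%:E by exact: unit_lebesgue_digit_set.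
  rewrite lee_fin ler_pdivrMr ?exprn_gt0 //; apply: hl.
    move=> _ _ [z [Bz z1 ->]] [z' [Bz' z1' ->]].
    by apply: le_trans (word_nonexp f01 fk _ z1 z1') _; case: (hB z z' Bz Bz').
  move=> _ _ [z [Bz z1 ->]] [z' [Bz' z1' ->]].
  by apply: le_trans (word_nonexp g01 gk _ z1 z1') _; case: (hB z z' Bz Bz').
rewrite sumEFin lee_fin big_const_seq count_predT iter_addr addr0 -cardE card_tuple.
by rewrite -[_ *+ _]mulr_natl natrX.
Qed.

Let nu0T : nu0 setT = 1%E. Proof. exact: block_measureT. Qed.

Lemma carpet_measure_exists :
  exists mu : probability (measurableTypeR R * measurableTypeR R)%type R,
  [/\ ergodic_on_carpet f g l0 mu,
    forall B, measurable B -> (forall u, B (code u)) -> mu B = 1%E &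
    exists2 C' : R, 0 < C' &
      forall (B : set (measurableTypeR R * measurableTypeR R)) (r : R),
      measurable B -> 0 < r <= 1 ->
      (forall z w, B z -> B w -> `|z.1 - w.1| <= r /\ `|z.2 - w.2| <= r) ->
      (mu B <= (C' * r `^ s)%:E)%E].
Proof.
have inv A : measurable A -> nu0 (iter M shift @^-1` A) = nu0 A.
  exact: block_measure_invariant.
have zo A : measurable A -> shift @^-1` A = A -> nu0 A = 0%E \/ nu0 A = 1%E.
  exact: block_measure_01.
pose nu := shift_average_prob M0 nu0T.
have mc := coding_measurable (l0 := l0) f01 g01 k01 fk gk.
exists (image_prob nu mc); split.
- by exists nu => //; exact: (shift_average_ergodic M0 nu0T inv zo).
- move=> B mB hB; have -> : image_prob nu mc B = nu setT.
    by rewrite -[LHS]/(nu (code @^-1` B)); congr (nu _); apply/seteqP; split=> // u _; exact: hB.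
  exact: probability_setT.
pose A := #|{: alphabet}|%:R : R.
have A1 : 1 <= A by rewrite ler1n; apply/card_gt0P; exists l0.
(* The average involves only shifts by [j < M], each preceded by at most [A ^+ M] words. *)
exists (A ^+ M * C); first by rewrite mulr_gt0 // exprn_gt0 // (lt_le_trans ltr01).
move=> B r mB r01 hB.
rewrite -[leLHS]/(\sum_(j < M) (M%:R^-1)%:E * nu0 (iter j shift @^-1` (code @^-1` B)))%E.
apply: (@le_trans _ _ (\sum_(j < M) ((M%:R^-1) * (A ^+ M * C * r `^ s))%:E)%E).
  apply: lee_sum => j _; rewrite EFinM; apply: lee_wpmul2l; first by rewrite lee_fin invr_ge0.
  apply: le_trans (shifted_code_bound j mB r01 hB) _; rewrite lee_fin -mulrA.
  apply: ler_wpM2r; first by rewrite mulr_ge0 ?powR_ge0 // ltW.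
  by rewrite ler_weXn2l // ltnW.
rewrite sumEFin lee_fin sumr_const card_ord -[_ *+ _]mulr_natl mulrA divff ?mul1r //.
by rewrite pnatr_eq0 -lt0n.
Qed.

End carpet_measure.

(** * Mass distribution principle *)

Section mass_distribution.
Context {R : realType}.
Variables (mu : probability (measurableTypeR R * measurableTypeR R)%type R) (C s : R).
Hypothesis C0 : 0 < C.
Hypothesis mu_le : forall (B : set (measurableTypeR R * measurableTypeR R)) (r : R),
  measurable B -> 0 < r <= 1 ->
  (forall z w, B z -> B w -> `|z.1 - w.1| <= r /\ `|z.2 - w.2| <= r) ->
  (mu B <= (C * r `^ s)%:E)%E.

Definition box (z : R * R) (d : R) : set (measurableTypeR R * measurableTypeR R) :=
  `[z.1 - d, z.1 + d]%classic `*` `[z.2 - d, z.2 + d]%classic.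

Lemma box_measurable z d : measurable (box z d).
Proof. by apply: measurableX; exact: measurable_itv. Qed.

Lemma box_dist z d x y : box z d x -> box z d y ->
  `|x.1 - y.1| <= 2 * d /\ `|x.2 - y.2| <= 2 * d.
Proof.
move=> [/=]; rewrite !in_itv /= => /andP[? ?] /andP[? ?] [/=].
rewrite !in_itv /= => /andP[? ?] /andP[? ?].
by split; rewrite ler_norml; apply/andP; split; lra.
Qed.

Lemma edist_ge (z w : R * R) :
  `|z.1 - w.1| <= Defs.edist z w /\ `|z.2 - w.2| <= Defs.edist z w.
Proof.
rewrite /Defs.edist; split; rewrite -sqrtr_sqr ler_wsqrtr //.
  by rewrite lerDl sqr_ge0.
by rewrite lerDr sqr_ge0.
Qed.

Lemma sub_box (U : set (R * R)) z (d : R) : U z -> (ediam U <= d%:E)%E -> U `<=` box z d.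
Proof.
move=> Uz hd w Uw; have : ((Defs.edist w z)%:E <= d%:E)%E.
  by apply: le_trans hd; apply: ereal_sup_ubound; exists w => //; exists z.
rewrite lee_fin => h; have [h1 h2] := edist_ge w z.
have := le_trans h1 h; have := le_trans h2 h.
rewrite !ler_norml => /andP[? ?] /andP[? ?].
by split; rewrite /= in_itv /=; apply/andP; split; lra.
Qed.

(** The mass bound is stated for [r > 0]; sets of diameter 0 need a limit, which vanishes because
    [s] is positive. *)
Let s_pos_null (B : set (measurableTypeR R * measurableTypeR R)) : 0 < s -> measurable B ->
  (forall z w, B z -> B w -> `|z.1 - w.1| <= 0 /\ `|z.2 - w.2| <= 0) -> mu B = 0%E.
Proof.
move=> s0 mB hB; apply/eqP; rewrite eq_le measure_ge0 andbT.
apply/lee_addgt0Pr => e e0; rewrite add0e.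
pose q := Num.min (e / C) 1.
have q0 : 0 < q by rewrite lt_min ltr01 divr_gt0.
have q1 : q <= 1 by rewrite ge_min lexx orbT.
pose r := q `^ s^-1.
have r0 : 0 < r by rewrite powR_gt0.
have r1 : r <= 1.
  apply: (@le_trans _ _ (1 `^ s^-1)); last by rewrite powR1.
  by apply: ge0_ler_powR; rewrite ?nnegrE ?invr_ge0 ?(ltW s0) ?(ltW q0).
apply: (@le_trans _ _ (C * r `^ s)%:E).
  apply: mu_le => //; first by rewrite r0.
  by move=> z w Bz Bw; have [h1 h2] := hB z w Bz Bw; rewrite !(le_trans h1) ?(le_trans h2) // ltW.
rewrite lee_fin /r -powRrM mulVf ?gt_eqF // powRr1 ?(ltW q0) //.
by rewrite -ler_pdivlMl // mulrC ge_min lexx.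
Qed.

Lemma box_mass (t : R) (U : set (R * R)) z : 0 <= t < s -> U z ->
  (ediam U <= (1 / 2)%:E)%E ->
  (mu (box z (fine (ediam U))) <= (C * 2 `^ t)%:E * diam_pow t U)%E.
Proof.
move=> /andP[t0 ts] Uz dU; have U0 : U !=set0 by exists z.
have d0 := ediam_ge0 U0.
rewrite /diam_pow; case: asboolP => [UE|_]; first by move: Uz; rewrite UE.
have dfin : ediam U \is a fin_num.
  by rewrite ge0_fin_numE // (le_lt_trans dU) // ltry.
have [d dE] : exists d, ediam U = d%:E by exists (fine (ediam U)); rewrite fineK.
move: d0 dU; rewrite dE !lee_fin /= => d0 d12.
rewrite -EFinM.
have s0 : 0 < s by exact: le_lt_trans ts.
have [dz|dz] := eqVneq d 0.
  rewrite s_pos_null //; first by rewrite lee_fin !mulr_ge0 ?powR_ge0 // ltW.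
    exact: box_measurable.
  by rewrite dz => x y bx yb; have := box_dist bx yb; rewrite mulr0.
have dp : 0 < d by rewrite lt0r dz.
apply: (@le_trans _ _ (C * (2 * d) `^ s)%:E).
  apply: mu_le; [exact: box_measurable| |exact: box_dist].
  by apply/andP; split; lra.
rewrite lee_fin -mulrA ler_wpM2l ?(ltW C0) // -powRM //.
by apply: ger_powR; [apply/andP; split; lra|exact: ltW].
Qed.

(** The hypothesis bounds the outer measure of [E] from below. A cover of small [t]-sum with [t < s]
    would, after its arbitrary sets are enclosed in Borel boxes, have too little mass. *)
Lemma mass_distribution (E : set (R * R)) (c : R) : 0 < c ->
  (forall B : set (measurableTypeR R * measurableTypeR R),
    measurable B -> E `<=` B -> (c%:E <= mu B)%E) ->
  (s%:E <= dimH E)%E.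
Proof.
move=> c0 hE; apply: le_ereal_inf_tmp => _ [t [t0 ht] <-]; rewrite lee_fin.
rewrite leNgt; apply/negP => ts.
have ts' : 0 <= t < s by rewrite t0.
pose A := C * 2 `^ t.
have A0 : 0 < A by rewrite mulr_gt0 // powR_gt0.
(* Diameters at most 1/2 keep the sides of the boxes at most 1, where the power [s] is below the
   power [t]. *)
have hc : ((c / A)%:E <= hausdorff_premeasure (1 / 2) t E)%E.
  apply: le_ereal_inf_tmp => _ [U [EU dU] <-].
  have /choice [z zP] : forall k, exists z, U k !=set0 -> U k z.
    by move=> k; have [[z Uz]|nU] := pselect (U k !=set0); [exists z|exists (0, 0)].
  pose B k := if `[< U k !=set0 >] then box (z k) (fine (ediam (U k))) else set0.
  have mB k : measurable (B k).
    by rewrite /B; case: ifP => _; [exact: box_measurable|exact: measurable0].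
  have UB k : U k `<=` B k.
    move=> w Uw; have Uk0 : U k !=set0 by exists w.
    rewrite /B asboolT //; apply: (sub_box (zP k Uk0)) => //.
    have df : ediam (U k) \is a fin_num.
      by rewrite ge0_fin_numE ?ediam_ge0 // (le_lt_trans (dU k)) // ltry.
    by rewrite fineK.
  have cB : (c%:E <= mu (\bigcup_k B k))%E.
    apply: hE; first exact: bigcupT_measurable.
    by move=> y Ey; have [k1 _ Uky] := EU y Ey; exists k1 => //; exact: UB.
  have cS : (c%:E <= \sum_(0 <= k <oo) mu (B k))%E.
    apply: le_trans cB _; apply: measure_sigma_subadditive => //.
    exact: bigcupT_measurable.
  have : (\sum_(0 <= k <oo) mu (B k) <= A%:E * \sum_(0 <= k <oo) diam_pow t (U k))%E.
    rewrite -nneseriesZl; last by move=> k _; exact: diam_pow_ge0.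
    apply: lee_nneseries => [k _ _|k _]; first exact: measure_ge0.
    rewrite /B; case: asboolP => Uk0; first by apply: box_mass => //; exact: zP.
    by rewrite measure0 mule_ge0 ?diam_pow_ge0 // lee_fin ltW.
  move=> /(le_trans cS).
  have := nneseries_ge0 (fun k (_ : (0 <= k)%N) (_ : true) => diam_pow_ge0 t (U k)).
  case: (\sum_(0 <= k <oo) diam_pow t (U k))%E.
  - by move=> x _; rewrite -EFinM !lee_fin ler_pdivrMr // mulrC.
  - by move=> _ _; rewrite leey.
  - by [].
move: hc; apply/negP; rewrite -ltNge; apply: (@le_lt_trans _ _ (hausdorff_measure t E)).
  by apply: ereal_sup_ubound; exists (1 / 2) => //=; rewrite divr_gt0.
by rewrite ht lte_fin divr_gt0.
Qed.

End mass_distribution.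

(** * Existence of the maximum *)

Lemma continuous_at_sum (R : realType) (T : topologicalType) (K : Type) (r : seq K) (P : pred K)
    (h : K -> T -> R) (x : T) :
  (forall i, P i -> {for x, continuous (h i)}) ->
  {for x, continuous (fun y => \sum_(i <- r | P i) h i y)}.
Proof.
move=> hc; elim: r => [|i r IH].
  under [X in {for x, continuous X}]funext do rewrite big_nil; exact: cvg_cst.
under [X in {for x, continuous X}]funext do rewrite big_cons.
case: ifP => // Pi; apply: continuousD => //; exact: hc.
Qed.

(* From [ln y <= y], applied to [y = 1 / sqrt x] when [x < 1]. *)
Lemma xlnx_le (R : realType) (x : R) : `|x * ln x| <= 2 * Num.sqrt `|x| + `|x| ^+ 2.
Proof.
have [x0|x0] := leP x 0.
  by rewrite ln0 // mulr0 normr0 addr_ge0 ?mulr_ge0 ?sqrtr_ge0 ?exprn_ge0.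
rewrite (gtr0_norm x0).
have [x1|x1] := leP 1 x.
  rewrite ger0_norm ?mulr_ge0 ?ln_ge0 ?(ltW x0) // -[leLHS]add0r lerD ?mulr_ge0 ?sqrtr_ge0 //.
  by rewrite expr2 ler_wpM2l ?(ltW x0) // ltW // ln_sublinear.
have s0 : 0 < Num.sqrt x by rewrite sqrtr_gt0.
have h : ln (Num.sqrt x)^-1 <= (Num.sqrt x)^-1 by rewrite ltW // ln_sublinear // invr_gt0.
have hx : x = Num.sqrt x ^+ 2 by rewrite sqr_sqrtr // ltW.
have l : ln x = - (2 * ln (Num.sqrt x)^-1) by rewrite lnV // mulrN opprK {1}hx lnXn // mulr_natl.
rewrite l mulrN normrN ger0_norm.
  apply: (@le_trans _ _ (2 * Num.sqrt x)); last by rewrite lerDl exprn_ge0 // ltW.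
  rewrite (mulrCA x 2) ler_wpM2l // {1}hx expr2 -mulrA -[leRHS]mulr1 ler_wpM2l ?(ltW s0) //.
  by rewrite -ler_pdivlMl // mulr1.
by rewrite !mulr_ge0 ?(ltW x0) // ln_ge0 // invf_ge1 // -[leRHS]sqrtr1 ler_sqrt // ltW.
Qed.

Lemma xlnx_continuous (R : realType) : continuous (fun x : R => x * ln x).
Proof.
move=> x; have [x0|x0|->] := ltgtP x 0.
- rewrite /continuous_at ln0 ?(ltW x0) // mulr0; apply: cvg_near_cst.
  near=> y; rewrite ln0 ?mulr0 //; apply/ltW; near: y; exact: lt_nbhsl.
- by apply: continuousM; [exact: cvg_id|exact: continuous_ln].
- pose m (y : R) := 2 * Num.sqrt `|y| + `|y| ^+ 2.
  have mc : m y @[y --> 0] --> (0 : R).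
    have m0 : m 0 = 0 by rewrite /m normr0 sqrtr0 mulr0 expr0n addr0.
    rewrite -[X in _ --> X]m0; apply: cvgD.
      apply: cvgM; first exact: cvg_cst.
      apply: (continuous_comp (@norm_continuous _ R 0)); exact: sqrt_continuous.
    exact: (@continuous_comp _ _ _ (fun y : R => `|y|) (fun y : R => y ^+ 2) 0
      (@norm_continuous _ _ _) (@exprn_continuous _ _ _)).
  rewrite /continuous_at mul0r.
  apply: (@squeeze_cvgr _ _ _ _ (fun y => - m y) m) => //.
    by apply: nearW => y; rewrite -ler_norml; exact: xlnx_le.
  by rewrite -[X in _ --> X]oppr0; exact: cvgN.
Unshelve. all: by end_near.
Qed.

Section maximum.
Context {R : realType} (A1 A2 : finType).
Variables (A : {set A1 * A2}) (a : A1 -> R) (b : A2 -> R).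
Hypothesis A0 : exists x, x \in A.
Hypotheses (a01 : forall i, 0 < a i < 1) (b01 : forall j, 0 < b j < 1).

(** Vectors as functions with the product topology, so that Tychonoff gives compactness of the
    cube. *)
Let V := prod_topology (fun _ : A1 * A2 => R).

Let coord_continuous x : continuous (fun p : V => p x).
Proof. exact: (@proj_continuous _ (fun _ : A1 * A2 => R) x). Qed.

Let sum_pairE (h : A1 * A2 -> R) :
  \sum_(x in A) h x = \sum_i \sum_(j | (i, j) \in A) h (i, j).
Proof. by rewrite pair_big_dep; apply: eq_big => [[]|[]]. Qed.

Let sum_pair_swapE (h : A1 * A2 -> R) :
  \sum_(x in A) h x = \sum_j \sum_(i | (i, j) \in A) h (i, j).
Proof.
rewrite sum_pairE (exchange_big_dep xpredT) //=; apply: eq_bigr => j _.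
Qed.

(** The logarithm of a marginal is unbounded near 0; grouping the letters by coordinate exhibits the
    continuous function [x * ln x]. *)
Let ent1E (p : V) : ent1 A p = \sum_i q_marg A p i * ln (q_marg A p i).
Proof. by rewrite /ent1 sum_pairE; apply: eq_bigr => i _; rewrite /= -mulr_suml. Qed.

Let ent2E (p : V) : ent2 A p = \sum_j r_marg A p j * ln (r_marg A p j).
Proof. by rewrite /ent2 sum_pair_swapE; apply: eq_bigr => i _; rewrite /= -mulr_suml. Qed.

Let xlnx_comp_continuous (h : V -> R) : continuous h -> continuous (fun p => h p * ln (h p)).
Proof.
move=> hc p; apply: (@continuous_comp _ _ _ h (fun x => x * ln x)); first exact: hc.
exact: xlnx_continuous.
Qed.

Let ent_continuous : continuous (fun p : V => ent A p).
Proof.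
by move=> p; apply: continuous_at_sum => x _; apply: xlnx_comp_continuous; exact: coord_continuous.
Qed.

Let ent1_continuous : continuous (fun p : V => ent1 A p).
Proof.
rewrite (funext ent1E) => p.
apply: continuous_at_sum => i _; apply: xlnx_comp_continuous => q.
by apply: continuous_at_sum => j _; exact: coord_continuous.
Qed.

Let ent2_continuous : continuous (fun p : V => ent2 A p).
Proof.
rewrite (funext ent2E) => p.
apply: continuous_at_sum => i _; apply: xlnx_comp_continuous => q.
by apply: continuous_at_sum => j _; exact: coord_continuous.
Qed.

Let scaled_continuous (h : V -> R) (c : R) p :
  {for p, continuous h} -> {for p, continuous (fun q => h q * c)}.
Proof. by move=> hc; apply: (@continuousM _ V h (fun=> c) p hc); exact: cst_continuous. Qed.

Let lambda1_continuous : continuous (fun p : V => lambda1 A p a).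
Proof.
move=> p; apply: continuous_at_sum => x _; apply: scaled_continuous.
exact: coord_continuous.
Qed.

Let lambda2_continuous : continuous (fun p : V => lambda2 A p b).
Proof.
move=> p; apply: continuous_at_sum => x _; apply: scaled_continuous.
exact: coord_continuous.
Qed.

Let sum_lt0 (c : A1 * A2 -> R) (p : V) : prob_vectors A p -> (forall x, 0 < c x < 1) ->
  \sum_(x in A) p x * ln (c x) < 0.
Proof.
move=> [p0 _ p1] c01.
have ln0 x : ln (c x) < 0 by apply: ln_lt0; exact: c01.
rewrite lt_neqAle sumr_le0 ?andbT; last by move=> x _; rewrite mulr_ge0_le0 // ltW.
rewrite -oppr_eq0 -sumrN psumr_eq0; last first.
  by move=> x _; rewrite oppr_ge0 mulr_ge0_le0 // ltW.
apply/negP => /allP h; have : \sum_(x in A) p x = 0.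
  apply: big1 => x xA; have := h x (mem_index_enum x).
  by rewrite xA oppr_eq0 mulf_eq0 (lt_eqF (ln0 x)) orbF => /eqP.
by rewrite p1 => /eqP; rewrite oner_eq0.
Qed.

(* One formula for both cases of [g_dim], in which continuity is apparent. *)
Let G (p : V) : R :=
  let k := (lambda1 A p a)^-1 - (lambda2 A p b)^-1 in
  ent A p * (((lambda1 A p a)^-1 + (lambda2 A p b)^-1 + `|k|) / 2) +
  ent1 A p * ((k - `|k|) / 2) - ent2 A p * ((k + `|k|) / 2).

Let g_dimE (p : V) : prob_vectors A p -> g_dim A p a b = G p.
Proof.
move=> hp; have l1 : lambda1 A p a < 0 by exact: (@sum_lt0 (fun x => a x.1)).
have l2 : lambda2 A p b < 0 by exact: (@sum_lt0 (fun x => b x.2)).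
rewrite /g_dim /G /g1 /g2; case: leP => [h|/ltW h].
  have : (lambda1 A p a)^-1 <= (lambda2 A p b)^-1 by rewrite lef_nV2 ?negrE.
  by rewrite -subr_le0 => /ler0_norm ->; field; rewrite ?(lt_eqF l1) ?(lt_eqF l2).
have : (lambda2 A p b)^-1 <= (lambda1 A p a)^-1 by rewrite lef_nV2 ?negrE.
by rewrite -subr_ge0 => /ger0_norm ->; field; rewrite ?(lt_eqF l1) ?(lt_eqF l2).
Qed.

Let G_continuous (p : V) : prob_vectors A p -> {for p, continuous G}.
Proof.
move=> hp.
have c1 : {for p, continuous (fun p : V => (lambda1 A p a)^-1)}.
  apply: continuousV; last exact: lambda1_continuous.
  by rewrite lt_eqF //; exact: (@sum_lt0 (fun x => a x.1)).
have c2 : {for p, continuous (fun p : V => (lambda2 A p b)^-1)}.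
  apply: continuousV; last exact: lambda2_continuous.
  by rewrite lt_eqF //; exact: (@sum_lt0 (fun x => b x.2)).
have ck := continuousB c1 c2.
have cn := continuous_comp ck (@norm_continuous _ _ _).
apply: continuousB; [apply: continuousD|]; apply: continuousM;
  [exact: ent_continuous| |exact: ent1_continuous| |exact: ent2_continuous|];
  apply: scaled_continuous.
- exact: (continuousD (continuousD c1 c2) cn).
- exact: (continuousB ck cn).
- exact: (continuousD ck cn).
Qed.

Let prob_vectors_compact : compact (prob_vectors A : set V).
Proof.
have cube : compact [set p : V | forall x, p x \in `[0, 1]].
  exact: (@tychonoff _ (fun _ => R) (fun _ => `[0, 1]%classic) (fun _ => @segment_compact R 0 1)).
apply: (subclosed_compact _ cube); last first.
  move=> p [p0 pA p1] x; rewrite /= in_itv /= p0 /=.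
  have [xA|xA] := boolP (x \in A); last by rewrite pA // ler01.
  by rewrite -p1 (bigD1 x) //= lerDl sumr_ge0.
have -> : (prob_vectors A : set V) =
    \bigcap_(x in [set: A1 * A2]) [set p : V | 0 <= p x] `&`
    \bigcap_(x in [set x | x \notin A]) [set p : V | p x = 0] `&`
    [set p : V | \sum_(x in A) p x = 1].
  apply/seteqP; split => [p [p0 pA p1]|p [[p0 pA] p1]].
    by split=> //; split=> x /=; [move=> _; exact: p0|exact: pA].
  by split => [x|x|//]; [exact: p0|exact: pA].
apply: closedI; first apply: closedI.
- apply: closed_bigI => x _.
  by apply: (@preimage_closed _ _ (fun p : V => p x) [set y | 0 <= y]) => // p _;
    exact: coord_continuous.
- apply: closed_bigI => x _.
  by apply: (@preimage_closed _ _ (fun p : V => p x) [set y | y = 0]) => // p _;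
    exact: coord_continuous.
- apply: (@preimage_closed _ _ (fun p : V => \sum_(x in A) p x) [set y | y = 1]) => // p _.
  by apply: continuous_at_sum => x _; exact: coord_continuous.
Qed.

Lemma g_dim_max : exists2 p, prob_vectors A p &
  forall q, prob_vectors A q -> g_dim A q a b <= g_dim A p a b.
Proof.
have [x0 x0A] := A0.
have P0 : (prob_vectors A : set V) !=set0.
  exists (fun x => (x == x0)%:R); split=> [x|x xA|]; first exact: ler0n.
    by case: eqP => // xx; rewrite xx x0A in xA.
  by rewrite (bigD1 x0) //= eqxx big1 ?addr0 // => x /andP[_ /negPf ->].
have Gc : {within (prob_vectors A : set V), continuous G}.
  by apply: continuous_in_subspaceT => p; rewrite inE => /G_continuous.
have [p pP pm] := compact_EVT_max P0 prob_vectors_compact Gc.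
rewrite inE in pP; exists p => // q qP.
by rewrite !g_dimE //; apply: pm; rewrite inE.
Qed.

End maximum.

(** * Dimension of the carpet *)

Lemma self_conformal_contraction (R : realType) (I J : finType)
    (f : I -> R -> R) (g : J -> R -> R) :
  self_conformal f -> self_conformal g ->
  exists2 k : R, 0 < k < 1 &
    (forall i x y, x \in `[0, 1] -> y \in `[0, 1] -> `|f i x - f i y| <= k * `|x - y|) /\
    (forall j x y, x \in `[0, 1] -> y \in `[0, 1] -> `|g j x - g j y| <= k * `|x - y|).
Proof.
move=> [_ [k1 k11 h1] _ _ _] [_ [k2 k21 h2] _ _ _].
exists (Num.max (1 / 2) (Num.max k1 k2)).
  by rewrite lt_max !gt_max k11 k21 divr_gt0 //= andbT; lra.
split=> i x y x01 y01; [apply: le_trans (h1 _ _ _ x01 y01) _|apply: le_trans (h2 _ _ _ x01 y01) _];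
  by rewrite ler_wpM2r // !le_max lexx !orbT.
Qed.

Lemma deriv_norm01 (R : realType) (I : finType) (f : I -> R -> R) (n : nat) (w : n.-tuple I) :
  self_conformal f -> (0 < n)%N -> 0 < deriv_norm f w < 1.
Proof.
move=> /self_conformal_distortion[D [k [_ /andP[k0 k1] h]]] n0.
have [-> dk _] := h n w; apply: le_lt_trans dk _.
by rewrite exprn_ilt1 ?ltW // -lt0n.
Qed.

Lemma deriv_norm_lip (R : realType) (I : finType) (f : I -> R -> R) (n : nat) (w : n.-tuple I) x y :
  self_conformal f -> x \in `[0, 1] -> y \in `[0, 1] ->
  `|word_map f w x - word_map f w y| <= deriv_norm f w * `|x - y|.
Proof.
move=> /self_conformal_distortion[D [k [_ _ h]]] x01 y01.
by have [_ _ /(_ x y x01 y01)/andP[]] := h n w.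
Qed.

Lemma words_neq0 (I J : finType) (L : {set I * J}) (l : I * J) n :
  l \in L -> exists w, w \in words L n.
Proof.
move=> lL; exists ([tuple of nseq n l.1], [tuple of nseq n l.2]).
by rewrite finset.inE; apply/forallP => i; rewrite !tnth_nseq -surjective_pairing.
Qed.

Section carpet.
Context {R : realType} (I J : finType).
Variables (f : I -> R -> R) (g : J -> R -> R) (L : {set I * J}) (l0 : {l | l \in L}).
Variable X : set (R * R).
Hypotheses (hX : nonlinear_carpet f g L X) (hosc : coordinate_osc f g).

Let a n := @deriv_norm R I f n.
Let b n := @deriv_norm R J g n.

Lemma attractor_iterate n z : X z ->
  exists w, [/\ size w = n, {subset w <= L} & exists2 x, X x & z = word_map (carpet_map f g) w x].
Proof.
have [_ _ _ [_ _ XE] _] := hX.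
elim: n z => [|n IH] z Xz; first by exists [::]; split=> //; exists z.
move: Xz; rewrite {1}XE => -[l /= lL [y Xy <-]].
have [w [sw wL [x Xx ->]]] := IH y Xy.
exists (l :: w); split; [by rewrite /= sw| |by exists x].
by move=> t; rewrite inE => /predU1P[->//|/wL].
Qed.

(** The carpet is covered by its images under the words of length [n], whose coordinate maps have
    Lipschitz constants [deriv_norm]. *)
Lemma carpet_dim_le n (m : R) : (0 < n)%N ->
  (forall p, prob_vectors (words L n) p -> g_dim (words L n) p (@a n) (@b n) <= m) ->
  (dimH X <= m%:E)%E.
Proof.
have [hf hg X01 [X0 _ _] _] := hX; move=> n0 hm.
have f01 : forall i x, x \in `[0, 1] -> f i x \in `[0, 1] by case: hf.
have g01 : forall i x, x \in `[0, 1] -> g i x \in `[0, 1] by case: hg.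
apply: (@dimH_attractor_le _ _ _ (words L n) (fun w => word_map f w) (fun w => word_map g w)
  (@a n) (@b n)) => //.
- by move=> w; exact: deriv_norm01.
- by move=> w; exact: deriv_norm01.
- by move=> w x; exact: word_map01.
- by move=> w x; exact: word_map01.
- by move=> w x y; exact: deriv_norm_lip.
- by move=> w x y; exact: deriv_norm_lip.
move=> z /(attractor_iterate n)[w [sw wL [x Xx ->]]].
have s1 : size (unzip1 w) == n by rewrite size_map sw.
have s2 : size (unzip2 w) == n by rewrite size_map sw.
exists (Tuple s1, Tuple s2); last by exists x => //; rewrite word_map_carpet.
rewrite /= finset.inE; apply/forallP => i.
have iw : (i < size w)%N by rewrite sw.
have /= := wL _ (mem_nth (val l0) iw); case: (val l0) => x0 y0.
rewrite (tnth_nth x0) (tnth_nth y0) /= !(nth_map (x0, y0)) //.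
by rewrite -surjective_pairing.
Qed.

(** Mass distribution is applied twice: to a Borel set of positive mass with that mass as the
    constant, and to [X] with constant 1, since a Borel set containing [X] contains all coded
    points. *)
Lemma carpet_dim_ge : exists2 c : R, 0 <= c & exists n0 : nat,
  forall n, (n0 <= n)%N -> (0 < n)%N -> forall p, prob_vectors (words L n) p ->
  exists mu : probability (measurableTypeR R * measurableTypeR R)%type R,
    [/\ ergodic_on_carpet f g l0 mu,
        ((g_dim (words L n) p (@a n) (@b n) - c / n%:R)%:E <= dimH_measure mu)%E
      & ((g_dim (words L n) p (@a n) (@b n) - c / n%:R)%:E <= dimH X)%E].
Proof.
have [hf hg X01 Xa _] := hX.
have f01 : forall i x, x \in `[0, 1] -> f i x \in `[0, 1] by case: hf.
have g01 : forall i x, x \in `[0, 1] -> g i x \in `[0, 1] by case: hg.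
have [k k01 [fk gk]] := self_conformal_contraction hf hg.
have [c c0 [n0 hn0]] := carpet_block_words L hf hg hosc.
exists c => //; exists n0 => n n0n n_gt0 p hp.
have [M [T [bw [M0 T0 hbw [C C0 hC]]]]] := hn0 n n0n n_gt0 p hp.
have /card_gt0P[t0 _] := T0.
have [mu [mu_erg mu1 [C' C'0 mu_le]]] :=
  carpet_measure_exists l0 f01 g01 k01 fk gk t0 M0 hbw C0 hC.
exists mu; split=> //.
  apply: le_ereal_inf_tmp => _ [B [mB B0] <-].
  have Bfin : mu B \is a fin_num by exact: fin_num_measure.
  apply: (mass_distribution C'0 mu_le (c := fine (mu B))).
    by rewrite fine_gt0 // B0 ltey_eq Bfin.
  by move=> E mE BE; rewrite fineK // le_measure // inE.
apply: (mass_distribution C'0 mu_le ltr01) => B mB XB.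
rewrite mu1 // => u; apply: XB.
exact: (coding_attractor f01 g01 k01 fk gk).
Qed.

End carpet.

Theorem theorem4p2 (R : realType) (I J : finType) (f : I -> R -> R)
    (g : J -> R -> R) (L : {set I * J}) (l0 : {l | l \in L})
    (X : set (R * R))
    (hX : nonlinear_carpet f g L X) (hosc : coordinate_osc f g) :
  (forall eps : R, 0 < eps ->
     exists2 mu : probability (measurableTypeR R * measurableTypeR R)%type R,
       ergodic_on_carpet f g l0 mu &
       (dimH X - eps%:E <= dimH_measure mu)%E) /\
  (exists2 m : nat -> R,
     forall n, (0 < n)%N -> is_maximum (g_values f g L n) (m n) &
     (m n)%:E @[n --> \oo] --> dimH X).
Proof.
have [hf hg _ _ _] := hX.
(* At [n = 0] nothing is claimed, and the value 0 is a placeholder. *)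
have /choice[m hm] : forall n, exists m, (0 < n)%N -> is_maximum (g_values f g L n) m.
  move=> n; have [->|n0] := posnP n; first by exists 0.
  have [p hp pmax] := g_dim_max (words_neq0 n (valP l0))
    (fun w => deriv_norm01 w hf n0) (fun w => deriv_norm01 w hg n0).
  exists (g_dim (words L n) p (@deriv_norm R I f n) (@deriv_norm R J g n)) => _.
  by split=> [|_ [q hq <-]]; [exists p|exact: pmax].
have up n : (0 < n)%N -> (dimH X <= (m n)%:E)%E.
  move=> n0; apply: (carpet_dim_le l0 hX n0) => p hp.
  by have [_] := hm n n0; apply; exists p.
have Xfin : dimH X \is a fin_num.
  by rewrite ge0_fin_numE ?dimH_ge0 // (le_lt_trans (up 1%N isT)) // ltry.
have [c c0 [n0 hn0]] := carpet_dim_ge l0 hX hosc.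
split=> [eps eps0|]; last first.
  exists m => //; rewrite -(fineK Xfin); apply: cvg_EFin; first exact: nearW.
  (* The maximum lies between [dimH X] and [dimH X + c / n] for large [n]. *)
  apply: (@squeeze_cvgr _ _ _ _ (fun=> fine (dimH X)) (fun n => fine (dimH X) + c * n%:R^-1)).
  - near=> n.
    have n_gt0 : (0 < n)%N by near: n; exact: nbhs_infty_gt.
    have n0n : (n0 <= n)%N by near: n; exact: nbhs_infty_ge.
    have [[p hp mp] _] := hm n n_gt0.
    have [mu [_ _]] := hn0 n n0n n_gt0 p hp.
    rewrite mp -{1}(fineK Xfin) lee_fin lerBlDr => ->.
    by rewrite andbT -lee_fin fineK // up.
  - exact: cvg_cst.
  - rewrite -[X in _ --> X]addr0 -[X in _ --> _ + X](mulr0 c).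
    apply: cvgD; first exact: cvg_cst.
    apply: cvgM; first exact: cvg_cst.
    by rewrite -cvg_shiftS; exact: cvg_harmonic.
have [n1 hn1] : exists n1 : nat, c / eps < n1%:R.
  by exists (Num.bound (c / eps)); rewrite archi_boundP // divr_ge0 // ltW.
(* For this [n] the error [c / n] is at most [eps], so the measure attached to an optimal vector has
   dimension at least [m n - eps]. *)
pose n := (maxn n0 n1).+1.
have [[p hp mp] _] := hm n isT.
have [mu [mu_erg hmu _]] := hn0 n (leq_trans (leq_maxl _ _) (leqnSn _)) isT p hp.
exists mu => //; apply: le_trans hmu; rewrite mp.
rewrite EFinB; apply: leeB; first exact: up.
rewrite lee_fin ler_pdivrMr // mulrC -ler_pdivrMr // ltW // (lt_le_trans hn1) //.
by rewrite ler_nat (leq_trans (leq_maxr _ _) (leqnSn _)).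
Unshelve. all: by end_near.
Qed.
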